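(* Let $P=\Gamma_k$ for some $k\in\{0,\dots,N+1\}$, and suppose that $P$ extends to a subdivision $\Sigma$ of $\Delta$ with a circuit $C$ of type D that is dual to a surface $S\in\mathrm{Sing}^{\mathrm{tr}}(\Delta,\overline{x})$. Then: (i) the circuit $C$ contains $w_k$ and three more vertices $w_i,w_j,w_l$ with $i<j<l$; (ii) the subdivision $\Sigma$ is uniquely determined by the pair $(k,C)$; in particular, - $\Sigma$ contains the smooth triangulation of $\mathrm{Conv}(P(l^* ))$, where $P(l^* )$ is the part of $P$ bounded from above by the vertex $w_{l^*}$ preceding $w_l$ in $P$; - the parallelogram $\mathrm{Conv}(C)$ intersects $\mathrm{Conv}(P(l^* ))$ along the edge $[w_i,w_j]$; - $\Sigma$ is obtained from the triangulation of $\mathrm{Conv}(P(l^* ))$ by the extension to $\mathrm{Conv}(P(l^* )\cup C)$ (with $\delta'=\mathrm{Conv}(P(l^* ))$, $\delta''=\mathrm{Conv}(C)$), followed by the sequence of smooth extensions that subsequently add the points of $P$ following $w_l$.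
   Context: General setting. $\mathbb K=\bigcup_{m\ge1}\mathbb C\{t^{1/m}\}$ is the field of locally convergent Puiseux series with $\mathrm{Val}(\sum_r a_rt^r)=-\min\{r:a_r\ne0\}$. $\Delta\subset\mathbb R^3$ is a convex lattice polytope such that the differences of points of $\Delta\cap\mathbb Z^3$ generate $\mathbb Z^3$; $N=|\Delta\cap\mathbb Z^3|-2>0$. $\mathrm{Sing}(\Delta)$ is the family of surfaces defined by Laurent polynomials over $\mathbb K$ with support in $\Delta$ having a singular point in $(\mathbb K^* )^3$; $\Delta$ is assumed non-defective, i.e. $\mathrm{Sing}(\Delta)$ is a hypersurface in the $(N+1)$-dimensional linear system. A tropical surface $S$ with Newton polytope $\Delta$ is the corner locus of $F_S(X)=\max_{\omega\in\Delta\cap\mathbb Z^3}(c_\omega+\langle\omega,X\rangle)$; $\nu_S:\Delta\to\mathbb R$ is the Legendre dual convex piecewise linear function (its graph is the lower part of the convex hull of the points $(\omega,-c_\omega)$) and $\Sigma_S$ is the dual subdivision of $\Delta$ into linearity domains of $\nu_S$. $\mathrm{Sing}^{\mathrm{tr}}(\Delta)$ is the set of tropicalizations of surfaces in $\mathrm{Sing}(\Delta)$. Point configuration (Mikhalkin's position). Fix $v\in\mathbb Q^3$ that is not parallel or orthogonal to any proper affine subspace of $\mathbb R^3$ spanned by a subset of $\Delta\cap\mathbb Z^3$. Write $u\succ u'$ iff $\langle u-u',v\rangle>0$; this linearly orders $\Delta\cap\mathbb Z^3=\{w_0\prec w_1\prec\dots\prec w_{N+1}\}$. $\overline x=(x_1,\dots,x_N)$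 with $x_i=M_iv$, $M_i$ rational, $0\ll M_1\ll\dots\ll M_N$ ($M_1$ and the ratios $M_{i+1}/M_i$ exceed a sufficiently large constant depending only on $\Delta$ and $v$). $\mathrm{Sing}^{\mathrm{tr}}(\Delta,\overline x)=\{S\in\mathrm{Sing}^{\mathrm{tr}}(\Delta): S\supset\overline x\}$. It is known that this set is finite, all its elements are of maximal-dimensional geometric type (deformation space of dimension $N$), each $x_i$ is an interior point of a 2-face $F_i$ of $S$, and the $F_i$ are distinct. Circuits. A circuit is an affinely dependent set of lattice points all of whose proper subsets are affinely independent. It is known that $\Sigma_S$, for $S\in\mathrm{Sing}^{\mathrm{tr}}(\Delta,\overline x)$, has a unique circuit $C_S$. It is of type D if $\mathrm{Conv}(C_S)$ is a parallelogram whose vertices are its only lattice points and form $C_S$ (equivalent under affine automorphisms of $\mathbb Z^3$ to $\{(0,0,0),(1,0,0),(0,1,0),(1,1,0)\}$). Lattice paths. For $A=\{a_1\prec\dots\prec a_m\}\subset\Delta\cap\mathbb Z^3$, $P(A)$ is the set of segments $[a_i,a_{i+1}]$, $1\le i<m$. $\Gamma_k=P(\Delta\cap\mathbb Z^3\setminus\{w_k\})$. For $S\in\mathrm{Sing}^{\mathrm{tr}}(\Delta,\overline x)$, $P(S,\overline x)=\{e_1,\dots,e_N\}$, where $e_i$ is the edge of $\Sigma_S$ dual to $F_i$. A path $P$ extends to a subdivision $\Sigma$ dual to $S$ if $\Sigma=\Sigma_S$ and $P=P(S,\overline x)$. The convex hull of a path is that of its vertices. Extensions of subdivisions. Let $\delta'$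 be a convex lattice polytope with a convex piecewise linear $\nu':\delta'\to\mathbb R$ whose linearity domains form a subdivision $\sigma'$ into lattice polytopes, and $\delta''$ a convex lattice polytope such that $\delta_0=\delta'\cap\delta''$ is a cell of $\sigma'$ and a codimension one face of $\delta''$; pick a lattice point $w\in\delta''\setminus\delta'$. The extension of $\sigma'$ to $\mathrm{Conv}(\delta'\cup\delta'')$ is the unique convex subdivision whose vertices are the vertices of $\sigma'$ and of $\delta''$, having $\delta''$ as a cell, and whose cells are the linearity domains of a convex piecewise linear $\nu$ with $\nu|_{\delta'}=\nu'$ and $\nu(w)\gg\max\nu'$. The smooth extension of $\sigma'$ by a lattice point $w\succ w'$ for all $w'\in\delta'$ is the special case $\delta''=[\tilde w,w]$, where $\tilde w$ is the $\succ$-maximal point of $\delta'$. The smooth triangulation of the convex hull of $a_0\prec\dots\prec a_r$ is obtained by starting with the point $a_0$ and subsequently performing the smooth extensions by $a_1,\dots,a_r$. *)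

(* Defs.v *)
From HB Require Import structures.
From mathcomp Require Import all_boot all_order all_algebra finmap.
From mathcomp Require Import complex.
From mathcomp Require mpoly.
From mathcomp Require Import all_classical all_reals all_analysis.
From mathcomp Require Import zify ring lra.
Set Implicit Arguments.
Unset Strict Implicit.
Unset Printing Implicit Defensive.
Import Order.TTheory GRing.Theory Num.Theory.
Import numFieldNormedType.Exports.
Local Open Scope classical_set_scope.
Local Open Scope ring_scope.
Local Open Scope complex_scope.

Section Cauchy.
Variable F : fieldType.
Implicit Types A B D : nat -> F.

Definition cauchy_prod A B k : F := \sum_(i < k.+1) A i * B (k - i)%N.

Definition trunc n A : {poly F} := \poly_(i < n) A i.

Lemma cauchyE n A B k : (k < n)%N -> cauchy_prod A B k = (trunc n A * trunc n B)`_k.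
Proof.
move=> kn; rewrite coefM; apply: eq_bigr => i _.
have ik : (i < n)%N by apply: leq_trans (ltn_ord i) kn.
by rewrite !coef_poly ik (leq_ltn_trans (leq_subr _ _) kn).
Qed.

Lemma cauchyC A B : cauchy_prod A B =1 cauchy_prod B A.
Proof. by move=> k; rewrite !(@cauchyE k.+1) // mulrC. Qed.

Lemma cauchyA A B D : cauchy_prod A (cauchy_prod B D) =1 cauchy_prod (cauchy_prod A B) D.
Proof.
move=> k; transitivity ((trunc k.+1 A * trunc k.+1 B * trunc k.+1 D)`_k).
  rewrite -mulrA coefM; apply: eq_bigr => i _.
  by rewrite (@cauchyE k.+1) ?ltnS ?leq_subr // coef_poly ltn_ord.
rewrite coefM; apply: eq_bigr => i _.
by rewrite -(cauchyE _ _ (ltn_ord i)) coef_poly ltnS leq_subr.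
Qed.

Lemma cauchy1 A : cauchy_prod (fun j => (j == 0)%:R) A =1 A.
Proof.
move=> k; rewrite /cauchy_prod big_ord_recl /= mul1r subn0 big1 ?addr0 // => i _.
by rewrite mul0r.
Qed.

Lemma eq_cauchy A A' B B' : A =1 A' -> B =1 B' -> cauchy_prod A B =1 cauchy_prod A' B'.
Proof. by move=> eA eB k; apply: eq_bigr => i _; rewrite eA eB. Qed.

Variable A : nat -> F.

Fixpoint inv_prefix n : seq F :=
  if n isn't n'.+1 then [::] else
  rcons (inv_prefix n')
    ((A 0)^-1 * ((n' == 0)%:R -
       \sum_(i < n') A i.+1 * (inv_prefix n')`_(n' - i.+1))).

Lemma size_inv_prefix n : size (inv_prefix n) = n.
Proof. by elim: n => //= n IHn; rewrite size_rcons IHn. Qed.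

Definition cauchy_inv k := (inv_prefix k.+1)`_k.

Lemma nth_inv_prefix n k : (k < n)%N -> (inv_prefix n)`_k = cauchy_inv k.
Proof.
elim: n => // n IHn; rewrite ltnS leq_eqVlt => /predU1P[->//|kn].
by rewrite /= nth_rcons size_inv_prefix kn IHn.
Qed.

Lemma cauchy_invE k : cauchy_inv k =
  (A 0)^-1 * ((k == 0)%:R - \sum_(i < k) A i.+1 * cauchy_inv (k - i.+1)).
Proof.
rewrite {1}/cauchy_inv /= nth_rcons size_inv_prefix ltnn eqxx.
congr (_ * (_ - _)); apply: eq_bigr => i _.
by rewrite nth_inv_prefix // ltn_subrL; case: k i => [[]|].
Qed.

Lemma cauchyV : A 0 != 0 -> cauchy_prod A cauchy_inv =1 (fun j => (j == 0)%:R).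
Proof.
move=> A0 k; rewrite /cauchy_prod big_ord_recl subn0 cauchy_invE mulVKf //.
by rewrite subrK.
Qed.

End Cauchy.

Section Puiseux.
Variable R : realType.
Local Notation C := R[i].
Implicit Types (f g h : rat -> C) (A B : nat -> C) (m : nat) (n : int).

Definition grid m n (j : nat) : rat := (n + j%:Z)%:~R / m%:R.

Definition grid_supp m n f := forall r, f r != 0 -> exists j, r = grid m n j.

Definition convergent A := exists2 rho : R, 0 < rho &
  cvgn (series (fun j => Normc.normc (A j) * rho ^+ j)).

(* f is the coefficient function of an element of C{t^(1/m)}[t^(-1)], a function
   of the exponent. *)
Definition is_puiseux f := exists m n,
  [/\ (0 < m)%N, grid_supp m n f & convergent (fun j => f (grid m n j))].

(* The support of the summand is finite when f and g are Puiseux series;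
   in general the sum over an infinite support is 0. *)
Definition puiseux_mul f g (r : rat) : C := \sum_(s \in [set: rat]) f s * g (r - s).

Lemma normr_normc (x : C) : `|x| = (Normc.normc x)%:C.
Proof. by case: x. Qed.

Lemma normc_ge0 (x : C) : 0 <= Normc.normc x.
Proof. by case: x => a b; rewrite sqrtr_ge0. Qed.

Lemma normc_le (x : C) (c : nat) : (`|x| <= c%:R) = (Normc.normc x <= c%:R).
Proof. by rewrite normr_normc -(rmorph_nat (real_complex R)) lecR. Qed.

(* A positive radius of convergence amounts to geometric growth. *)
Definition geo A := exists b : nat, forall j, `|A j| <= (b.+1 ^ j.+1)%:R.

Lemma geo_cvg A : geo A -> convergent A.
Proof.
case=> b bA; pose r : R := (2 * b.+1)%:R^-1.
have r0 : 0 < r by rewrite invr_gt0 ltr0n muln_gt0.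
exists r => //.
have h2 : `|2^-1 : R| < 1 by rewrite gtr0_norm ?invr_gt0 ?ltr0n // invf_lt1 ?ltr1n ?ltr0n.
apply: (@series_le_cvg R _ (geometric (b.+1%:R) 2^-1)); last exact: is_cvg_geometric_series.
all: move=> j.
- by rewrite mulr_ge0 ?exprn_ge0 ?normc_ge0 // ltW.
- by rewrite /geometric /= mulr_ge0 ?exprn_ge0 ?invr_ge0 ?ler0n.
rewrite /geometric /=.
have : Normc.normc (A j) <= (b.+1 ^ j.+1)%:R.
  by rewrite -normc_le.
move=> /(ler_wpM2r (exprn_ge0 j (ltW r0))) /le_trans -> //.
by rewrite expnS natrM natrX -mulrA -exprMn /r natrM invfM mulrCA mulfV ?mulr1 // pnatr_eq0.
Qed.

Lemma cvg_geo A : convergent A -> geo A.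
Proof.
case=> r r0 /cvg_series_bounded bA.
have [M hM] : exists M : R, forall j, `|Normc.normc (A j) * r ^+ j| <= M.
  by have [M [_ hM]] := bA; exists (M + 1) => j; apply: hM; rewrite ?ltrDl.
have hM' j : Normc.normc (A j) * r ^+ j <= M.
  by apply: le_trans (hM j); apply: ler_norm.
pose b1 := Num.bound M; pose b2 := Num.bound r^-1.
exists (b1 + b2)%N => j.
rewrite normc_le.
have rj : 0 < r ^+ j by rewrite exprn_gt0.
rewrite -(ler_pM2r rj); apply: (le_trans (hM' j)).
have M0 : 0 <= M.
  apply: le_trans (hM' 0%N); rewrite expr0 mulr1.
  exact: normc_ge0.
have Mb : M <= (b1 + b2).+1%:R.
  apply: le_trans (ltW (archi_boundP M0)) _.
  by rewrite ler_nat; lia.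
rewrite expnS natrM -mulrA -[leLHS]mulr1 ler_pM //.
rewrite natrX -exprMn exprn_ege1 // -ler_pdivrMr // mul1r.
apply: le_trans (ltW (archi_boundP _)) _; first by rewrite invr_ge0 ltW.
by rewrite ler_nat -/b2 (leq_trans (leq_addl b1 b2)).
Qed.

Lemma geo_eq0 A A' (s : nat -> nat) : geo A ->
  (forall j, A' j = 0 \/ exists2 i, (i <= j)%N & A' j = A i) -> geo A'.
Proof.
case=> b hb h; exists b => j.
case: (h j) => [->|[i ij ->]]; first by rewrite normr0 ler0n.
by apply: le_trans (hb i) _; rewrite ler_nat leq_pexp2l.
Qed.

Lemma geo_add A B : geo A -> geo B -> geo (fun j => A j + B j).
Proof.
move=> [a ha] [b hb]; exists (a + b).+1 => j.
apply: le_trans (ler_normD _ _) _.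
apply: le_trans (lerD (ha j) (hb j)) _; rewrite -natrD ler_nat.
elim: j => [|j IHj]; first by rewrite !expn1; lia.
rewrite [X in (_ <= X)%N]expnS [X in (X + _ <= _)%N]expnS [X in (_ + X <= _)%N]expnS.
apply: leq_trans (leq_mul (leqnn _) IHj); rewrite mulnDr.
by apply: leq_add; rewrite leq_mul2r; apply/orP; right; lia.
Qed.

Lemma geo_cauchy A B : geo A -> geo B -> geo (cauchy_prod A B).
Proof.
move=> [a ha] [b hb].
pose d := (a.+1 * b.+1)%N.
have d0 : (0 < d)%N by rewrite muln_gt0.
exists (2 * (d * d)).-1 => k.
rewrite prednK; last by rewrite muln_gt0 /= muln_gt0.
apply: le_trans (ler_norm_sum _ _ _) _.
apply: (@le_trans _ _ (\sum_(i < k.+1) (d ^ k.+2)%:R)); last first.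
  rewrite sumr_const card_ord -[leLHS]mulr_natr -natrM ler_nat mulnC.
  rewrite expnMn leq_mul //; first by rewrite ltnW // ltn_expl.
  by rewrite expnMn -expnD leq_pexp2l //; lia.
apply: ler_sum => i _; rewrite normrM.
apply: (@le_trans _ _ ((a.+1 ^ i.+1)%:R * (b.+1 ^ (k - i).+1)%:R)).
  by rewrite ler_pM.
rewrite -natrM ler_nat.
have -> : (k.+2 = i.+1 + (k - i).+1)%N by have := ltn_ord i; lia.
rewrite expnD leq_mul // leq_exp2r //.
  by rewrite /d leq_pmulr.
by rewrite /d leq_pmull.
Qed.

Lemma geo_inv A : A 0%N != 0 -> geo A -> geo (cauchy_inv A).
Proof.
move=> A0 [a ha].
pose c0 := Num.bound (Normc.normc (A 0%N)^-1).
have hc : `|(A 0%N)^-1| <= c0.+1%:R.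
  rewrite normc_le.
  apply: le_trans (ltW (archi_boundP _)) _; last by rewrite ler_nat; lia.
  exact: normc_ge0.
pose w := (c0.+1 * (a.+1 * a.+1))%N.
have w0 : (0 < w)%N by rewrite !muln_gt0.
exists (2 * w).-1; rewrite prednK; last by rewrite muln_gt0 w0.
move=> k; elim/ltn_ind: k => k IHk.
have step : (\sum_(i < k) (w ^ i.+1 * (2 * w) ^ (k - i)) + 2 * w ^ k.+1 <= (2 * w) ^ k.+1)%N.
  elim: k {IHk} => [|k IH]; first by rewrite big_ord0 add0n !expn1; lia.
  rewrite big_ord_recr /= subSn // subnn.
  rewrite (eq_bigr (fun i : 'I_k => ((2 * w) * (w ^ i.+1 * (2 * w) ^ (k - i)))%N)); last first.
    by move=> i _; rewrite subSn ?(ltnW (ltn_ord i)) // [((2 * w) ^ _.+1)%N]expnS mulnCA.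
  rewrite -big_distrr /= expn1.
  rewrite [X in (_ <= X)%N]expnS; apply: leq_trans (leq_mul (leqnn _) IH).
  rewrite mulnDr -addnA leq_add2l [X in (_ + 2 * X <= _)%N]expnS.
  by set u := (w ^ k.+1)%N; lia.
rewrite cauchy_invE normrM.
apply: le_trans (ler_wpM2r (normr_ge0 _) hc) _.
case: k IHk step => [|k] IHk step.
  rewrite big_ord0 subr0 normr1 mulr1 ler_nat expn1 /w; nia.
rewrite sub0r normrN.
apply: (@le_trans _ _ (\sum_(i < k.+1) (w ^ i.+1 * (2 * w) ^ (k.+1 - i))%:R)); last first.
  by rewrite -natr_sum ler_nat (leq_trans _ step) // leq_addr.
apply: le_trans (ler_wpM2l (ler0n _ _) (ler_norm_sum _ _ _)) _.
rewrite mulr_sumr; apply: ler_sum => i _; rewrite normrM.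
have iB : `|cauchy_inv A (k.+1 - i.+1)| <= ((2 * w) ^ (k.+1 - i))%:R.
  have -> : (k.+1 - i = (k.+1 - i.+1).+1)%N by have := ltn_ord i; lia.
  by apply: IHk; lia.
rewrite natrM mulrA ler_pM // ?mulr_ge0 //.
apply: le_trans (ler_wpM2l (ler0n _ _) (ha _)) _.
rewrite -natrM ler_nat /w expnMn leq_mul //.
  by rewrite -[X in (X <= _)%N]expn1 leq_pexp2l.
by rewrite expnMn -expnD leq_pexp2l //; lia.
Qed.

Lemma grid_inj m n i j : (0 < m)%N -> grid m n i = grid m n j -> i = j.
Proof.
move=> m0 /(congr1 (fun x : rat => x * m%:R)).
rewrite !divfK ?pnatr_eq0 -?lt0n // => /eqP.
by rewrite eqr_int => /eqP; lia.
Qed.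

Definition gridded m n f :=
  [/\ (0 < m)%N, grid_supp m n f & geo (fun j => f (grid m n j))].

Lemma is_puiseuxP f : is_puiseux f <-> exists m n, gridded m n f.
Proof.
by split=> -[m [n [m0 sf cf]]]; exists m, n; split=> //; [apply: cvg_geo|apply: geo_cvg].
Qed.

Lemma regrid m n q t f : (0 < q)%N -> gridded m n f ->
  gridded (m * q) (n * q%:Z - t%:Z) f.
Proof.
move=> q0 [m0 sf gf].
have E j : grid m n j = grid (m * q) (n * q%:Z - t%:Z) (j * q + t).
  have e : n * q%:Z - t%:Z + (j * q + t)%N%:Z = (n + j%:Z) * q%:Z.
    by rewrite PoszD PoszM; ring.
  rewrite /grid e natrM invfM intrM mulrACA mulfV ?mulr1 //.
  by rewrite pnatr_eq0 -lt0n.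
have mq0 : (0 < m * q)%N by rewrite muln_gt0 m0.
split=> //.
  by move=> r /sf [j ->]; exists (j * q + t)%N; exact: E.
apply: geo_eq0 gf _ => [//|j].
set x := f _; have [->|/sf [i Ei]] := eqVneq x 0; [by left|right].
exists i; last by rewrite -Ei.
move: Ei; rewrite E => /(grid_inj mq0) ->.
by rewrite (leq_trans _ (leq_addr _ _)) // leq_pmulr.
Qed.

Lemma join_grid m n m' n' : (0 < m)%N -> (0 < m')%N -> exists m'' n'',
  (forall f, gridded m n f -> gridded m'' n'' f) /\
  (forall f, gridded m' n' f -> gridded m'' n'' f).
Proof.
move=> m0 m0'.
have [le|/ltW le] := leP (n * m'%:Z) (n' * m%:Z).
- exists (m * m')%N, (n * m'%:Z); split=> f gf.
    by have := regrid 0 m0' gf; rewrite subr0.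
  have := regrid (absz (n' * m%:Z - n * m'%:Z)%R) m0 gf.
  by rewrite gez0_abs ?subr_ge0 // subKr mulnC.
- exists (m * m')%N, (n' * m%:Z); split=> f gf.
    have := regrid (absz (n * m'%:Z - n' * m%:Z)%R) m0' gf.
    by rewrite gez0_abs ?subr_ge0 // subKr.
  by have := regrid 0 m0 gf; rewrite subr0 mulnC.
Qed.

Lemma common2 f g : is_puiseux f -> is_puiseux g ->
  exists m n, gridded m n f /\ gridded m n g.
Proof.
move=> /is_puiseuxP[m [n gf]] /is_puiseuxP[m' [n' gg]].
have [m0 m0'] : (0 < m)%N /\ (0 < m')%N by case: gf gg => + _ _ [].
have [m2 [n2 [h1 h2]]] := join_grid n n' m0 m0'.
by exists m2, n2; split; [apply: h1|apply: h2].
Qed.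

Lemma common3 f g h : is_puiseux f -> is_puiseux g -> is_puiseux h ->
  exists m n, [/\ gridded m n f, gridded m n g & gridded m n h].
Proof.
move=> pf pg /is_puiseuxP[m' [n' gh]].
have [m [n [gf gg]]] := common2 pf pg.
have [m0 m0'] : (0 < m)%N /\ (0 < m')%N by case: gf gh => + _ _ [].
have [m2 [n2 [h1 h2]]] := join_grid n n' m0 m0'.
by exists m2, n2; split; [apply: h1|apply: h1|apply: h2].
Qed.

Lemma eq_grid m n f g : grid_supp m n f -> grid_supp m n g ->
  (forall j, f (grid m n j) = g (grid m n j)) -> f = g.
Proof.
move=> sf sg e; apply/funext => r.
have [f0|/sf[j ->]//] := eqVneq (f r) 0.
have [->//|g0] := eqVneq (g r) 0.
by have [j rj] := sg _ g0; rewrite rj e.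
Qed.

Lemma gridD m n n' i j : grid m (n + n') (i + j) = grid m n i + grid m n' j.
Proof.
rewrite /grid -mulrDl -rmorphD /=; congr (_%:~R / _); rewrite PoszD; ring.
Qed.

Lemma mul_supp m n n' f g : grid_supp m n f -> grid_supp m n' g ->
  grid_supp m (n + n') (puiseux_mul f g).
Proof.
move=> sf sg r /eqP h.
have [s hs] : exists s, f s * g (r - s) != 0.
  apply: contrapT => no; apply: h; apply: fsbig1 => s _.
  by apply: contrapT => /eqP hs; apply: no; exists s.
move: hs; rewrite mulf_eq0 negb_or => /andP[/sf[i si] /sg[j rj]].
by exists (i + j)%N; rewrite gridD -si -rj addrC subrK.
Qed.

Lemma mul_grid m n n' f g : (0 < m)%N -> grid_supp m n f -> grid_supp m n' g ->
  forall k, puiseux_mul f g (grid m (n + n') k) =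
    cauchy_prod (fun j => f (grid m n j)) (fun j => g (grid m n' j)) k.
Proof.
move=> m0 sf sg k; rewrite /puiseux_mul.
rewrite (fsbigE [seq grid m n i | i <- iota 0 k.+1]) //.
- rewrite big_map; under eq_bigl do rewrite in_setT.
  rewrite -[iota _ _]/(index_iota 0 k.+1) big_mkord; apply: eq_bigr => i _.
  congr (_ * g _); rewrite -{1}(subnKC (ltnSE (ltn_ord i))) gridD.
  by rewrite addrC addKr.
- by rewrite map_inj_uniq ?iota_uniq // => i j; apply: grid_inj.
move=> s _; apply: contraNeq; rewrite mulf_eq0 negb_or => /andP[/sf[i si] /sg[j kj]].
have : grid m (n + n') k = grid m (n + n') (i + j) by rewrite gridD -si -kj [s + _]addrC subrK.
move=> /(grid_inj m0) kij; rewrite si map_f // mem_iota; lia.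
Qed.

Lemma gridded_mul m n n' f g : gridded m n f -> gridded m n' g ->
  gridded m (n + n') (puiseux_mul f g).
Proof.
move=> [m0 sf gf] [_ sg gg]; split=> //; first exact: mul_supp.
have -> : (fun j => puiseux_mul f g (grid m (n + n') j)) =
    cauchy_prod (fun j => f (grid m n j)) (fun j => g (grid m n' j)).
  by apply/funext => k; exact: mul_grid.
exact: geo_cauchy.
Qed.

Definition pz_const (c : C) (r : rat) : C := if r == 0 then c else 0.

Lemma const_supp m c : (0 < m)%N -> grid_supp m 0 (pz_const c).
Proof.
move=> m0 r; rewrite /pz_const; case: (eqVneq r 0) => [-> _|_]; last by rewrite eqxx.
by exists 0%N; rewrite /grid addr0 mul0r.
Qed.

Lemma const_grid m c j : (0 < m)%N ->
  pz_const c (grid m 0 j) = (j == 0)%:R * c.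
Proof.
move=> m0; rewrite /pz_const /grid add0r mulf_eq0 invr_eq0 !pnatr_eq0.
by rewrite (gtn_eqF m0) orbF; case: j => [|j]; rewrite ?mul1r ?mul0r.
Qed.

Lemma gridded_const m c : (0 < m)%N -> gridded m 0 (pz_const c).
Proof.
move=> m0; split=> //; first exact: const_supp.
exists (Num.bound (Normc.normc c)) => j; rewrite const_grid // normc_le.
case: j => [|j]; last first.
  by rewrite mul0r Normc.normc0 ler0n.
rewrite mul1r expn1; apply: le_trans (ltW (archi_boundP _)) _.
  exact: normc_ge0.
by rewrite ler_nat.
Qed.

Record puiseux := Puiseux { pcoef :> rat -> C; _ : is_puiseux pcoef }.

Lemma pcoefP (x : puiseux) : is_puiseux x. Proof. by case: x. Qed.

Lemma puiseux_inj (x y : puiseux) : pcoef x = pcoef y -> x = y.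
Proof.
case: x y => [f pf] [g pg] /= fg; case: _ / fg in pg *.
by congr Puiseux; exact: Prop_irrelevance.
Qed.

HB.instance Definition _ := gen_eqMixin puiseux.
HB.instance Definition _ := gen_choiceMixin puiseux.

Fact is_puiseux_const c : is_puiseux (pz_const c).
Proof. by apply/is_puiseuxP; exists 1%N, 0; apply: gridded_const. Qed.

Fact is_puiseux_add f g : is_puiseux f -> is_puiseux g ->
  is_puiseux (fun r => f r + g r).
Proof.
move=> pf pg; have [m [n [[m0 sf gf] [_ sg gg]]]] := common2 pf pg.
apply/is_puiseuxP; exists m, n; split=> //; last exact: geo_add.
move=> r h; have [f0|/sf//] := eqVneq (f r) 0.
by apply: sg; move: h; rewrite f0 add0r.
Qed.

Fact is_puiseux_opp f : is_puiseux f -> is_puiseux (fun r => - f r).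
Proof.
move=> /is_puiseuxP[m [n [m0 sf [b gf]]]].
apply/is_puiseuxP; exists m, n; split=> // [r|]; first by rewrite oppr_eq0 => /sf.
by exists b => j; rewrite normrN.
Qed.

Fact is_puiseux_mul f g : is_puiseux f -> is_puiseux g ->
  is_puiseux (puiseux_mul f g).
Proof.
move=> pf pg; have [m [n [gf gg]]] := common2 pf pg.
by apply/is_puiseuxP; exists m, (n + n); apply: gridded_mul.
Qed.

Definition pz_C c : puiseux := Puiseux (is_puiseux_const c).
Definition pz_add (x y : puiseux) : puiseux :=
  Puiseux (is_puiseux_add (pcoefP x) (pcoefP y)).
Definition pz_opp (x : puiseux) : puiseux := Puiseux (is_puiseux_opp (pcoefP x)).
Definition pz_mul (x y : puiseux) : puiseux :=
  Puiseux (is_puiseux_mul (pcoefP x) (pcoefP y)).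

Fact pz_addA : associative pz_add.
Proof. by move=> x y z; apply/puiseux_inj/funext => r /=; rewrite addrA. Qed.
Fact pz_addC : commutative pz_add.
Proof. by move=> x y; apply/puiseux_inj/funext => r /=; rewrite addrC. Qed.
Fact pz_add0 : left_id (pz_C 0) pz_add.
Proof.
by move=> x; apply/puiseux_inj/funext => r /=; rewrite /pz_const if_same add0r.
Qed.
Fact pz_addN : left_inverse (pz_C 0) pz_opp pz_add.
Proof.
by move=> x; apply/puiseux_inj/funext => r /=; rewrite /pz_const if_same addNr.
Qed.

HB.instance Definition _ := GRing.isZmodule.Build puiseux
  pz_addA pz_addC pz_add0 pz_addN.

Fact pz_mulC : commutative pz_mul.
Proof.
move=> x y; apply/puiseux_inj => /=.
have [m [n [[m0 sx _] [_ sy _]]]] := common2 (pcoefP x) (pcoefP y).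
apply: (eq_grid (m := m) (n := n + n)); try exact: mul_supp.
by move=> j; rewrite !mul_grid // cauchyC.
Qed.

Fact pz_mulA : associative pz_mul.
Proof.
move=> x y z; apply/puiseux_inj => /=.
have [m [n [[m0 sx _] [_ sy _] [_ sz _]]]] := common3 (pcoefP x) (pcoefP y) (pcoefP z).
have syz := mul_supp sy sz; have sxy := mul_supp sx sy.
apply: (eq_grid (m := m) (n := n + (n + n))); first exact: mul_supp.
  by rewrite addrA; apply: mul_supp.
move=> j; rewrite mul_grid // addrA mul_grid //.
rewrite (eq_cauchy (fun=> erefl) (mul_grid m0 sy sz)).
by rewrite (eq_cauchy (mul_grid m0 sx sy) (fun=> erefl)) cauchyA.
Qed.

Fact pz_mul1 : left_id (pz_C 1) pz_mul.
Proof.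
move=> x; apply/puiseux_inj => /=.
have [m [n [m0 sx _]]] := (is_puiseuxP _).1 (pcoefP x).
have s1 := @const_supp m 1 m0.
apply: (eq_grid (m := m) (n := n)) => //.
  by rewrite -[n]add0r; apply: mul_supp.
move=> j; rewrite -[n in LHS]add0r mul_grid //.
have e i : pz_const 1 (grid m 0 i) = (i == 0%N)%:R by rewrite const_grid ?mulr1.
by rewrite (eq_cauchy e (fun=> erefl)) cauchy1.
Qed.

Fact pz_mulDl : left_distributive pz_mul pz_add.
Proof.
move=> x y z; apply/puiseux_inj => /=.
have [m [n [[m0 sx _] [_ sy _] [_ sz _]]]] := common3 (pcoefP x) (pcoefP y) (pcoefP z).
have sxy : grid_supp m n (fun r => x r + y r).
  move=> r h; have [f0|/sx//] := eqVneq (x r) 0.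
  by apply: sy; move: h; rewrite f0 add0r.
have sxz := mul_supp sx sz; have syz := mul_supp sy sz.
apply: (eq_grid (m := m) (n := n + n)); first exact: mul_supp.
  move=> r h; have [f0|/sxz//] := eqVneq (puiseux_mul x z r) 0.
  by apply: syz; move: h; rewrite f0 add0r.
move=> j; rewrite !mul_grid // -big_split; apply: eq_bigr => i _.
by rewrite mulrDl.
Qed.

Fact pz_one_neq0 : pz_C 1 != 0.
Proof.
apply/eqP => /(congr1 (fun x : puiseux => pcoef x 0)) /eqP.
by rewrite /= /pz_const eqxx oner_eq0.
Qed.

HB.instance Definition _ := GRing.Zmodule_isComNzRing.Build puiseux
  pz_mulA pz_mulC pz_mul1 pz_mulDl pz_one_neq0.

Fact pz_inv_ex (x : puiseux) : x != 0 -> exists y : puiseux, y * x = 1.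
Proof.
move=> x0.
have [m [n [m0 sx gx]]] := (is_puiseuxP _).1 (pcoefP x).
pose A j := x (grid m n j).
have exA : exists j, A j != 0.
  apply: contrapT => no; move/eqP: x0; apply; apply/puiseux_inj => /=.
  apply: (@eq_grid m n) => // [r|j].
    by rewrite /pz_const if_same eqxx.
  rewrite /pz_const if_same; apply: contrapT => /eqP Aj; apply: no; by exists j.
pose i0 := ex_minn exA.
have [Ai0 mini0] : A i0 != 0 /\ forall j, (j < i0)%N -> A j = 0.
  rewrite /i0; case: ex_minnP => i Ai mi; split=> // j ji.
  by apply: contraTeq ji => /mi; rewrite leqNgt.
pose n1 := n + i0%:Z.
have En1 j : grid m n1 j = grid m n (i0 + j) by rewrite /grid /n1 PoszD addrA.
have sx1 : grid_supp m n1 x.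
  move=> r xr; have [j rj] := sx _ xr.
  exists (j - i0)%N; rewrite En1 subnKC // leqNgt; apply/negP => /mini0.
  by rewrite /A -rj => /eqP; apply/negP.
have gx1 : geo (fun j => x (grid m n1 j)).
  case: gx => b hb; exists (b.+1 ^ i0.+1).-1 => j.
  rewrite prednK ?expn_gt0 // En1; apply: le_trans (hb _) _.
  by rewrite ler_nat -expnM leq_pexp2l //; nia.
pose A1 j := x (grid m n1 j).
have A10 : A1 0%N != 0 by rewrite /A1 En1 addn0.
have ex_idx (r : rat) : {j | r = grid m (- n1) j} + {~ exists j, r = grid m (- n1) j}.
  case: (pselect (exists j, r = grid m (- n1) j)) => [/cid|]; [by left|by right].
pose g (r : rat) : C := if ex_idx r is inleft j then cauchy_inv A1 (sval j) else 0.
have gE j : g (grid m (- n1) j) = cauchy_inv A1 j.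
  rewrite /g; case: (ex_idx _) => [[i /= /(grid_inj m0) ->//]|[]]; by exists j.
have sg : grid_supp m (- n1) g.
  move=> r; rewrite /g; case: (ex_idx _) => [[j rj] _|]; last by rewrite eqxx.
  by exists j.
have gg : gridded m (- n1) g.
  split=> //; rewrite (_ : (fun j => _) = cauchy_inv A1); last exact/funext.
  exact: geo_inv.
have pg : is_puiseux g by apply/is_puiseuxP; exists m, (- n1).
exists (Puiseux pg); apply/puiseux_inj => /=.
have s1 := @const_supp m 1 m0.
apply: (@eq_grid m 0) => //.
  by rewrite -[0 in X in grid_supp _ X _](addNr n1); apply: mul_supp.
move=> j; rewrite const_grid // mulr1 -[0 in LHS](addNr n1) mul_grid //.
by rewrite (eq_cauchy gE (fun=> erefl)) cauchyC cauchyV.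
Qed.

Definition pz_inv (x : puiseux) : puiseux :=
  if pselect (exists y, y * x = 1) is left h then sval (cid h) else 0.

Fact pz_mulVx (x : puiseux) : x != 0 -> pz_inv x * x = 1.
Proof.
move=> /pz_inv_ex ex; rewrite /pz_inv; case: pselect => // h.
by case: cid.
Qed.

Fact pz_inv0 : pz_inv 0 = 0.
Proof.
rewrite /pz_inv; case: pselect => // h; exfalso; case: h => y; rewrite mulr0 => /eqP.
by rewrite eq_sym oner_eq0.
Qed.

HB.instance Definition _ := GRing.ComNzRing_isField.Build puiseux pz_mulVx pz_inv0.

End Puiseux.

Section ConvexGeometry.
Variable R : realType.
Local Notation point := 'rV[R]_3.
Local Notation lattice_point := 'rV[int]_3.
Implicit Types (p q X : point) (s F : set point) (u a : lattice_point).

Definition dotp p q : R := \sum_i p 0 i * q 0 i.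

Definition toR u : point := map_mx intr u.

Definition convex_hull (E : lmodType R) (A : set E) : set E :=
  [set x | exists n (y : 'I_n -> E) (l : 'I_n -> R),
     [/\ forall i, A (y i), forall i, 0 <= l i, \sum_i l i = 1 &
         x = \sum_i l i *: y i]].

Definition lattice_polytope s :=
  exists2 V : seq lattice_point, V <> [::] & s = convex_hull (toR @` [set` V]).

(* The direction space of the affine hull of A. *)
Definition direction (A : set point) (W : {vspace point}) :=
  forall U : {vspace point},
    (forall p q, A p -> A q -> p - q \in U) <-> (W <= U)%VS.

(* The nonempty faces, the set itself included. *)
Definition face s F := F !=set0 /\
  exists X, F = [set p | s p /\ forall q, s q -> dotp q X <= dotp p X].

Definition codim1_face s F := face s F /\
  exists U W, [/\ direction F U, direction s W & \dim W = (\dim U).+1].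

Definition affine_on s (nu : point -> R) :=
  exists X b, forall p, s p -> nu p = dotp p X + b.

Definition linearity_domain (D : set point) (nu : point -> R) s :=
  [/\ @convex_set R point s, s `<=` D, affine_on s nu &
      forall s', @convex_set R point s' -> s' `<=` D -> affine_on s' nu ->
        s `<=` s' -> s' = s].

(* A subdivision is represented by its cells of all dimensions. *)
Definition subdivision (D : set point) (nu : point -> R) : set (set point) :=
  [set F | exists2 s, linearity_domain D nu s & face s F].

Definition convex_lattice_pl (D : set point) (nu : point -> R) :=
  [/\ @convex_function R point D nu,
      finite_set (linearity_domain D nu),
      D `<=` \bigcup_(s in linearity_domain D nu) s &
      forall s, linearity_domain D nu s -> lattice_polytope s].

(* sigma is the extension of sigma' = subdivision d' nu' to the convex hull of
   d' and d''; the condition nu(w) >> max nu' is rendered as: for all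
   sufficiently large values of nu(w). *)
Definition extension (d' : set point) (nu' : point -> R)
    (sigma' : set (set point)) (d'' : set point) (sigma : set (set point)) :=
  let d := convex_hull (d' `|` d'') in
  [/\ lattice_polytope d', convex_lattice_pl d' nu', sigma' = subdivision d' nu' &
    [/\ lattice_polytope d'', sigma' (d' `&` d''), codim1_face d'' (d' `&` d'') &
    forall w : lattice_point, (d'' `\` d') (toR w) ->
      exists h0 : R, forall h : R, h0 <= h ->
        exists nu : point -> R,
          [/\ convex_lattice_pl d nu, forall p, d' p -> nu p = nu' p,
              nu (toR w) = h, sigma = subdivision d nu &
              sigma d'' /\
              forall p, sigma [set p] <-> sigma' [set p] \/ face d'' [set p]]]].

Variable v : 'rV[rat]_3.
Let vR : point := map_mx ratr v.

Definition precv p q := dotp p vR < dotp q vR.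

Definition smooth_extension (sigma' : set (set point)) (w : lattice_point)
    (sigma : set (set point)) :=
  exists d' nu' w',
    [/\ forall p, d' p -> precv p (toR w),
        d' w', forall p, d' p -> p = w' \/ precv p w' &
        extension d' nu' sigma' (convex_hull [set w'; toR w]) sigma].

Fixpoint smooth_extensions (sigma' : set (set point)) (A : seq lattice_point)
    (sigma : set (set point)) :=
  if A is w :: A' then
    exists2 tau, smooth_extension sigma' w tau & smooth_extensions tau A' sigma
  else sigma = sigma'.

(* A lists a_0, ..., a_r in increasing order. *)
Definition smooth_triangulation (A : seq lattice_point) (sigma : set (set point)) :=
  if A is a0 :: A' then smooth_extensions [set [set toR a0]] A' sigma else False.

Definition lattice_path (A : seq lattice_point) : set (set point) :=
  [set convex_hull [set toR A`_i; toR A`_i.+1] | i in [set i | (i.+1 < size A)%N]].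

Definition affinely_independent (B : {fset lattice_point}) :=
  forall l : lattice_point -> R,
    \sum_(u <- B) l u = 0 -> \sum_(u <- B) l u *: toR u = 0 ->
    forall u, u \in B -> l u = 0.

Definition circuit (B : {fset lattice_point}) :=
  ~ affinely_independent B /\
  forall B', fproper B' B -> affinely_independent B'.

Definition fconv (B : {fset lattice_point}) : set point := convex_hull (toR @` [set` B]).

Definition type_D (B : {fset lattice_point}) :=
  [/\ exists a b c d, [/\ B = [fset a; b; c; d]%fset, b - a = d - c &
        free [:: toR (b - a); toR (c - a)]] &
      forall a, fconv B (toR a) -> a \in B].

(* The points of a circuit of sigma are lattice points of one cell; they need
   not be vertices of it. *)
Definition circuit_of (sigma : set (set point)) (B : {fset lattice_point}) :=
  circuit B /\ exists2 d, sigma d & forall u, u \in B -> d (toR u).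

End ConvexGeometry.

Section SingularSurfaces.
Variable R : realType.
Local Notation K := (puiseux R).

(* Val, with Val 0 = -oo *)
Definition Val (x : K) : \bar R :=
  if x == 0 then -oo%E
  else (- ratr (xget 0 [set r | x r != 0 /\ forall r', r' < r -> x r' = 0]))%:E.

Variables (n : nat) (w : 'I_n -> 'rV[int]_3).

Definition monomial (z : 'I_3 -> K) (u : 'rV[int]_3) : K := \prod_j z j ^ u 0 j.

Definition laurent (a : 'I_n -> K) (z : 'I_3 -> K) : K :=
  \sum_i a i * monomial z (w i).

Definition laurent_deriv (a : 'I_n -> K) (j : 'I_3) (z : 'I_3 -> K) : K :=
  \sum_i a i * (w i 0 j)%:~R * monomial z (w i - delta_mx 0 j).

(* Sing(Delta), for w listing the lattice points of Delta: a surface is given by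
   the coefficients of its (nonzero) Laurent polynomial. *)
Definition Sing : set ('I_n -> K) :=
  [set a | (exists i, a i != 0) /\
     exists z : 'I_3 -> K,
       [/\ forall j, z j != 0, laurent a z = 0 &
           forall j, laurent_deriv a j z = 0]].

(* Sing is a hypersurface: its Zariski closure is the zero locus of a single
   nonconstant polynomial. *)
Definition nondefective :=
  exists2 D : mpoly.mpoly n K, forall b, D <> mpoly.mpolyC n b &
    forall a : 'I_n -> K,
      (forall G : mpoly.mpoly n K,
         (forall b, Sing b -> mpoly.meval b G = 0) -> mpoly.meval a G = 0) <->
      mpoly.meval a D = 0.

Definition trop_poly (c : 'I_n -> \bar R) (X : 'rV[R]_3) : \bar R :=
  \big[maxe/-oo%E]_i (c i + (dotp (toR R (w i)) X)%:E)%E.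

(* A tropical surface S with Newton polytope Delta is given by coefficients
   c of F_S. *)
Definition trop_surface (c : 'I_n -> R) (X : 'rV[R]_3) : \bar R :=
  trop_poly (fun i => (c i)%:E) X.

Definition maximal_terms (c : 'I_n -> R) (X : 'rV[R]_3) : set 'I_n :=
  [set i | (c i + dotp (toR R (w i)) X)%:E = trop_surface c X].

Definition corner_locus (c : 'I_n -> R) : set 'rV[R]_3 :=
  [set X | exists i j, [/\ i <> j, maximal_terms c X i & maximal_terms c X j]].

(* Sing^tr(Delta): F_S is the tropicalization of a polynomial in Sing(Delta). *)
Definition Sing_tr : set ('I_n -> R) :=
  [set c | exists2 a, Sing a &
     forall X, trop_surface c X = trop_poly (fun i => Val (a i)) X].

(* The lower part of the convex hull of the points (omega, - c_omega). *)
Definition nu_S (c : 'I_n -> R) (p : 'rV[R]_3) : R :=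
  inf [set h : R | @convex_hull R ('rV[R]_3 * R^o)%type
         [set (toR R (w i), - c i) | i in [set: 'I_n]] (p, h)].

(* The cell dual to the face of S (or to the component of its complement) whose
   relative interior contains X. *)
Definition dual_cell (c : 'I_n -> R) (X : 'rV[R]_3) : set 'rV[R]_3 :=
  convex_hull [set toR R (w i) | i in maximal_terms c X].

(* P(S,x). The face of S through x_i in its relative interior is a 2-face exactly
   when dual_cell c (x i) is a segment. *)
Definition surface_path N (c : 'I_n -> R) (x : 'I_N -> 'rV[R]_3) :
    set (set 'rV[R]_3) :=
  [set dual_cell c (x i) | i in [set: 'I_N]].

Definition Gamma (k : 'I_n) : set (set 'rV[R]_3) :=
  lattice_path [seq w i | i <- enum 'I_n & i != k].

End SingularSurfaces.

Section MikhalkinPosition.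
Variables (R : realType) (N : nat) (Delta : set 'rV[R]_3).
Variables (w : 'I_N.+2 -> 'rV[int]_3) (v : 'rV[rat]_3).
Let vR : 'rV[R]_3 := map_mx ratr v.

Definition generates_lattice :=
  forall u : 'rV[int]_3, exists z : 'I_N.+2 -> 'I_N.+2 -> int,
    u = \sum_i \sum_j z i j *: (w i - w j).

Definition generic_direction :=
  forall (A : set 'I_N.+2) (W : {vspace 'rV[R]_3}),
    direction [set toR R (w i) | i in A] W -> (0 < \dim W < 3)%N ->
    vR \notin W /\ exists2 u, u \in W & dotp u vR != 0.

Definition lattice_setting :=
  [/\ (0 < N)%N, lattice_polytope Delta,
      forall u, Delta (toR R u) <-> exists i, u = w i,
      generates_lattice &
      [/\ nondefective R w, generic_direction &
          forall i j : 'I_N.+2, (i < j)%N -> precv v (toR R (w i)) (toR R (w j))]].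

(* M i stands for M_(i+1). *)
Definition growth (kappa : rat) (M : 'I_N -> rat) :=
  (forall i : 'I_N, val i = 0%N -> kappa < M i) /\
  (forall i j : 'I_N, val j = (val i).+1 -> kappa < M j / M i).

Definition config (M : 'I_N -> rat) (i : 'I_N) : 'rV[R]_3 := ratr (M i) *: vR.

(* The path P extends to Sigma, dual to the surface S in Sing^tr(Delta, x)
   with coefficients c. *)
Definition extends_to (P : set (set 'rV[R]_3)) (M : 'I_N -> rat)
    (c : 'I_N.+2 -> R) (Sigma : set (set 'rV[R]_3)) :=
  [/\ Sing_tr w c, forall i, corner_locus w c (config M i),
      Sigma = subdivision Delta (nu_S w c) & P = surface_path w c (config M)].

(* The vertices of Gamma w k up to w_m, resp. following w_m. *)
Definition path_upto (k m : 'I_N.+2) : seq 'rV[int]_3 :=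
  [seq w i | i <- enum 'I_N.+2 & (i != k) && (i <= m)%N].
Definition path_after (k m : 'I_N.+2) : seq 'rV[int]_3 :=
  [seq w i | i <- enum 'I_N.+2 & (i != k) && (m < i)%N].

Definition precedes_in_path (k m l : 'I_N.+2) :=
  [/\ (m < l)%N, m != k & forall i : 'I_N.+2, (m < i < l)%N -> i = k].

End MikhalkinPosition.

(* Main.v *)
(* Restricted to the line spanned by v, the tropical polynomial is a one-variable
   polynomial whose breakpoints are the M_s. Hence the heights a = - c on the vertices of
   Gamma_k are a positive combination sum_s M_s chi_s of fixed step functions chi_s, and
   strict convexity along the line shows that w_k belongs to the circuit and that
   w_k + w_j = w_l + w_i with i < j < l, which determines the height of w_k as well.

   A cell of the subdivision is the convex hull of a contact set, the set of points at
   which a supporting affine functional is tight. By Farkas' lemma, for H a bound on a and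
   h larger than a constant times H, the constant depending on the points only, the
   contact sets of a + h chi are those of a inside the contact sets of chi. Iterating, the
   contact sets of sum_s M_s chi_s do not depend on M as soon as M grows fast enough. This
   gives uniqueness, and, as the last coefficient may be raised arbitrarily, the
   description of the subdivision by successive extensions. *)
Require Import Defs.
From HB Require Import structures.
From mathcomp Require Import all_boot all_order all_algebra finmap.
From mathcomp Require Import all_classical all_reals all_analysis.
From mathcomp Require Import zify ring lra.
Set Implicit Arguments.
Unset Strict Implicit.
Unset Printing Implicit Defensive.
Import Order.TTheory GRing.Theory Num.Theory.
Local Open Scope classical_set_scope.
Local Open Scope ring_scope.

(** * Farkas' lemma and the theorem of the alternative *)

Section Farkas.
Variable R : realFieldType.

(** The hypotheses give less than a picture suggests. A circuit is only known to lie in some cell,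
    and the path is only known as a set of segments, without the matching of its edges to the points
    of the configuration. The growth of the [M_s] closes both gaps. The matching turns out to be an
    increasing self-map of an interval, hence the identity. Path vertices that lie in a cell belong
    to its contact set, and they are affinely independent there, because a relation among them would
    be broken by raising the coefficient attached to the last one. Independence in turn provides a
    functional that cuts the parallelogram out of the cell containing it, so that it is a cell
    itself.

    Cells are handled through sets of indices, which is what linear programming duality speaks
    about; [subdivisionE] translates back to faces of linearity domains. The growth bound must be
    fixed before the surface is given. This is why every constant below has to be independent of the
    heights, and why a single constant can be taken for the finitely many quadruples
    [(k, i, j, l)]. *)

Definition linear_form (V : lmodType R) (f : V -> R) :=
  forall k x y, f (k *: x + y) = k * f x + f y.

Lemma linear_form0 (V : lmodType R) (f : V -> R) : linear_form f -> f 0 = 0.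
Proof. by move=> lf; have := lf (-1) 0 0; rewrite scaler0 addr0; lra. Qed.

Lemma linear_formZ (V : lmodType R) (f : V -> R) : linear_form f ->
  forall k x, f (k *: x) = k * f x.
Proof. by move=> lf k x; have := lf k x 0; rewrite !addr0 linear_form0 // addr0. Qed.

(* Bartl's induction on the number of inequalities. *)
Lemma farkas_seq (V : lmodType R) (J : eqType) (s : seq J) (f : J -> V -> R) (c : V -> R) :
    uniq s -> (forall j, linear_form (f j)) -> linear_form c ->
    (forall x, (forall j, j \in s -> f j x <= 0) -> c x <= 0) ->
  exists2 l : J -> R, forall j, 0 <= l j & forall x, c x = \sum_(j <- s) l j * f j x.
Proof.
elim: s f c => [|j s IHs] f c.
  move=> _ lf lc h; exists (fun=> 0) => // x; rewrite big_nil.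
  have c_le0 y : c y <= 0 by apply: h.
  have := c_le0 (- x); rewrite -scaleN1r (linear_formZ lc).
  have := c_le0 x; lra.
move=> /= /andP[js us] lf lc h.
have [h1|] := pselect (forall x, (forall i, i \in s -> f i x <= 0) -> c x <= 0).
  have [l l0 cE] := IHs f c us lf lc h1.
  exists (fun i => if i == j then 0 else l i); first by move=> i; case: ifP.
  move=> x; rewrite big_cons eqxx mul0r add0r cE; apply: eq_big_seq => i si.
  by case: eqP si js => // -> ->.
move=> /existsNP[x0 /not_implyP[fx0 /negP]]; rewrite -ltNge => cx0.
have fj0 : 0 < f j x0.
  rewrite ltNge; apply/negP => fj; move: cx0; rewrite ltNge => /negP; apply.
  by apply: h => i; rewrite inE => /predU1P[->|/fx0].
(* The point [x0] allows a projection onto the kernel of [f j]; the forms [f'] and [c'] are [f] and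
   [c] composed with this projection. *)
pose f' i x := f i x - f i x0 / f j x0 * f j x.
pose c' x := c x - c x0 / f j x0 * f j x.
have lf' i : linear_form (f' i) by move=> k x y; rewrite /f' !lf; ring.
have lc' : linear_form c' by move=> k x y; rewrite /c' !lc !lf; ring.
have [x fx|l l0 cE] := IHs f' c' us lf' lc'.
  have sub g : linear_form g -> g (- (f j x / f j x0) *: x0 + x) =
      g x - g x0 / f j x0 * f j x by move=> lg; rewrite lg; field; rewrite gt_eqF.
  rewrite /c' -sub //; apply: h => i; rewrite inE => /predU1P[->|si]; rewrite sub //.
    by rewrite divff ?gt_eqF // mul1r subrr.
  exact: fx.
pose S := \sum_(i <- s) l i * f i x0.
have S0 : S <= 0.
  rewrite /S big_seq; apply: sumr_le0 => i si.
  by rewrite mulr_ge0_le0 // fx0.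
exists (fun i => if i == j then (c x0 - S) / f j x0 else l i).
  by move=> i; case: ifP => // _; apply: divr_ge0; [lra|exact: ltW].
move=> x; rewrite big_cons eqxx.
rewrite (eq_big_seq (fun i => l i * f i x)); last first.
  by move=> i si; case: eqP si js => // -> ->.
have := cE x; rewrite /c' => h'.
rewrite -[LHS](subrK (c x0 / f j x0 * f j x)) h'.
have -> : \sum_(i <- s) l i * f' i x =
    \sum_(i <- s) l i * f i x - S / f j x0 * f j x.
  rewrite /S !mulr_suml -sumrB; apply: eq_bigr => i _; rewrite /f'; ring.
ring.
Qed.

Lemma farkas (V : lmodType R) (J : finType) (A : {set J}) (f : J -> V -> R) (c : V -> R) :
    (forall j, linear_form (f j)) -> linear_form c ->
    (forall x, (forall j, j \in A -> f j x <= 0) -> c x <= 0) ->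
  exists2 l : J -> R, forall j, 0 <= l j & forall x, c x = \sum_(j in A) l j * f j x.
Proof.
move=> lf lc h; have [x hx|l l0 cE] := farkas_seq (enum_uniq A) lf lc.
  by apply: h => j jA; apply: hx; rewrite mem_enum.
by exists l => // x; rewrite cE big_enum.
Qed.

(** Homogenization: a pair [(x, t)] with [t > 0] and [f j x <= t * r j] yields the solution
    [t^-1 *: x]; if there is none, Farkas' lemma for the form [t] yields the certificate. The
    boolean in [F] doubles the constraints of [E] with the opposite sign, so the multipliers on [E]
    have no sign condition. *)
Lemma affine_farkas (V : lmodType R) (J : finType) (A E : {set J}) (f : J -> V -> R) (r : J -> R) :
    (forall j, linear_form (f j)) -> E \subset A ->
  (exists2 x, forall j, j \in A -> f j x <= r j & forall j, j \in E -> f j x = r j) \/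
  (exists y : J -> R, [/\ forall j, j \in A -> j \notin E -> 0 <= y j,
     forall x, \sum_(j in A) y j * f j x = 0 & \sum_(j in A) y j * r j < 0]).
Proof.
move=> lf EA.
pose F (jb : J * bool) (xt : V * R^o) :=
  (-1) ^+ jb.2 * (f jb.1 xt.1 - xt.2 * r jb.1).
pose B := [set jb : J * bool | if jb.2 then jb.1 \in E else jb.1 \in A]%SET.
have lF jb : linear_form (F jb).
  move=> k [x t] [x' t']; rewrite /F /= lf.
  have e (u k' a b c t1 t2 : R) : u * (k' * a + b - (k' * t1 + t2) * c) =
      k' * (u * (a - t1 * c)) + u * (b - t2 * c) by ring.
  exact: e.
have lc : linear_form (fun xt : V * R^o => xt.2 : R) by [].
have [h|] := pselect (forall x, (forall j, j \in B -> F j x <= 0) -> x.2 <= 0); last first.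
  move=> /existsNP[[x t] /not_implyP[Fx /negP]]; rewrite -ltNge /= => t0; left.
  have eA j : j \in A -> f j (t^-1 *: x) <= r j.
    move=> jA; have := Fx (j, false); rewrite inE /F /= expr0 mul1r => /(_ jA).
    by rewrite (linear_formZ (lf j)) ler_pdivrMl //; lra.
  exists (t^-1 *: x) => // j jE; apply/eqP; rewrite eq_le (eA _ (fintype.subsetP EA _ jE)) /=.
  have := Fx (j, true); rewrite inE /F /= expr1 mulN1r => /(_ jE).
  by rewrite (linear_formZ (lf j)) ler_pdivlMl //; lra.
have [l l0 cE] := farkas lF lc h; right.
pose y j := l (j, false) - (if j \in E then l (j, true) else 0).
have yE (x : V) (t : R) : t = \sum_(j in A) y j * (f j x - t * r j).
  rewrite [LHS](cE (x, t)) /F /B /=.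
  rewrite (eq_bigl (fun jb => if jb.2 then jb.1 \in E else jb.1 \in A)); last first.
    by move=> jb; rewrite inE.
  rewrite big_mkcond /=.
  pose G (j : J) (b : bool) : R := if (if b then j \in E else j \in A)
    then l (j, b) * ((-1) ^+ b * (f j x - t * r j)) else 0.
  rewrite (eq_bigr (fun jb => G jb.1 jb.2)); last by case.
  rewrite -(pair_bigA _ G) /G /=.
  rewrite [RHS]big_mkcond; apply: eq_bigr => j _.
  rewrite big_bool /= /y; have := fintype.subsetP EA j.
  by case: (j \in E) => [->//|_]; [rewrite expr0 expr1; ring|case: (j \in A); rewrite ?expr0; ring].
exists y; split.
- by move=> j _ jE; rewrite /y (negPf jE) subr0.
- by move=> x; have := yE x 0 => {2}->; apply: eq_bigr => j _; rewrite mul0r subr0.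
have := yE 0 1; under eq_bigr do rewrite (linear_form0 (lf _)) mul1r sub0r mulrN.
by rewrite sumrN; lra.
Qed.

End Farkas.

(** * Convex hulls, lower hulls and supporting functionals *)

Section ConvexHulls.
Variable R : realType.
Local Notation point := 'rV[R]_3.

Lemma dotp_linear (p : point) : linear_form (dotp p).
Proof.
move=> k x y; rewrite /dotp mulr_sumr -big_split; apply: eq_bigr => i _ /=.
by rewrite !mxE; ring.
Qed.

Lemma dotpC (p q : point) : dotp p q = dotp q p.
Proof. by apply: eq_bigr => i _; rewrite mulrC. Qed.

Lemma dotpDl (p q r : point) : dotp (p + q) r = dotp p r + dotp q r.
Proof. by rewrite dotpC -[p in LHS]scale1r dotp_linear mul1r ![dotp r _]dotpC. Qed.

Lemma dotpNl (p q : point) : dotp (- p) q = - dotp p q.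
Proof. by rewrite dotpC -scaleN1r (linear_formZ (dotp_linear q)) mulN1r dotpC. Qed.

Lemma dotp_suml (J : finType) (l : J -> R) (p : J -> point) (q : point) :
  dotp (\sum_i l i *: p i) q = \sum_i l i * dotp (p i) q.
Proof.
rewrite /dotp; under [RHS]eq_bigr do rewrite mulr_sumr.
rewrite exchange_big; apply: eq_bigr => i _ /=.
by rewrite summxE mulr_suml; apply: eq_bigr => j _; rewrite mxE mulrA.
Qed.

Lemma dotp_inj (p q : point) : (forall x, dotp p x = dotp q x) -> p = q.
Proof.
move=> h; apply/rowP => i; have := h (delta_mx 0 i).
have e r : dotp r (delta_mx 0 i) = r 0 i.
  rewrite /dotp (bigD1 i) //= big1 ?addr0 ?mxE ?eqxx ?mulr1 // => j ji.
  by rewrite mxE (negPf ji) andbF mulr0.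
by rewrite !e.
Qed.

(** The pair [x] is an affine functional, given by slope and constant term. With the functional as
    the variable, evaluation at a point is a linear form, so Farkas' lemma applies to systems whose
    unknown is a supporting functional. *)
Definition aff (p : point) (x : (point * R^o)%type) : R := dotp p x.1 + x.2.

Lemma aff_linear p : linear_form (aff p).
Proof.
move=> k [x b] [y c]; rewrite /aff /= dotp_linear.
have e (d1 d2 k' b1 c1 : R) : k' * d1 + d2 + (k' * b1 + c1) = k' * (d1 + b1) + (d2 + c1).
  by ring.
exact: e.
Qed.

Lemma affD p x y : aff p (x + y) = aff p x + aff p y.
Proof. by rewrite -[x in LHS]scale1r aff_linear mul1r. Qed.

Lemma affZ p k x : aff p (k *: x) = k * aff p x.
Proof. exact/linear_formZ/aff_linear. Qed.

Lemma affN p x : aff p (- x) = - aff p x.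
Proof. by rewrite -scaleN1r affZ mulN1r. Qed.

Lemma aff_cst p (b : R) : aff p (0, b) = b.
Proof. by rewrite /aff /= (linear_form0 (dotp_linear p)) add0r. Qed.

Section Weights.
Variable I : finType.
Implicit Types (A T : {set I}) (l a : I -> R).

Definition weights A l := [/\ forall i, 0 <= l i, forall i, i \notin A -> l i = 0 &
  \sum_i l i = 1].

Lemma convex_hullP (E : lmodType R) (y : I -> E) A q :
  convex_hull (y @` [set` A]) q <-> exists2 l, weights A l & q = \sum_i l i *: y i.
Proof.
split=> [[n [z [l [zA l0 l1 ->]]]]|[l [l0 lA l1] ->]].
  have /choice[f fP] : forall j : 'I_n, exists i, i \in A /\ y i = z j.
    by move=> j; have [i iA <-] := zA j; exists i.
  exists (fun i => \sum_(j | f j == i) l j); first split.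
  - by move=> i; apply: sumr_ge0.
  - move=> i iA; apply: big1 => j /eqP ji; move: iA; rewrite -ji.
    by have [-> _] := fP j.
  - by rewrite -l1 [RHS](partition_big f xpredT).
  rewrite (partition_big f xpredT) //=; apply: eq_bigr => i _.
  by rewrite scaler_suml; apply: eq_bigr => j /eqP <-; have [_ ->] := fP j.
have sA (W : nmodType) (F : I -> W) : (forall i, i \notin A -> F i = 0) ->
    \sum_i F i = \sum_(j < #|A|) F (enum_val j).
  move=> F0; rewrite -big_enum_val /= [RHS]big_mkcond; apply: eq_bigr => i _.
  by case: ifPn => // /F0.
exists #|A|, (fun j => y (enum_val j)), (fun j => l (enum_val j)); split=> //.
- by move=> j; exists (enum_val j) => //; apply: enum_valP.
- by rewrite -sA.
- by apply: sA => i iA; rewrite lA // scale0r.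
Qed.

Lemma weights1 i : weights [set i]%SET (fun j => (j == i)%:R).
Proof.
split=> [j|j|]; first exact: ler0n.
  by rewrite finset.inE => /negPf ->.
by rewrite (bigD1 i) //= eqxx big1 ?addr0 // => j /negPf ->.
Qed.

Lemma weightsS A T l : T \subset A -> weights T l -> weights A l.
Proof. by move=> /fintype.subsetP TA [l0 lT l1]; split=> // i iA; apply/lT/(contra _ iA)/TA. Qed.

Lemma weights_gt0 A l : weights A l -> exists2 i, i \in A & 0 < l i.
Proof.
move=> [l0 lA l1]; apply: contrapT => no.
suff : \sum_i l i = 0 by rewrite l1 => /eqP; rewrite oner_eq0.
apply: big1 => i _; have [iA|/lA//] := boolP (i \in A).
apply/eqP; rewrite eq_le l0 andbT leNgt; apply/negP => li; apply: no; by exists i.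
Qed.

(** Complementary slackness: a positive weight at an index of strict inequality would make the
    weighted sums strictly ordered the wrong way. *)
Lemma weights_eq A T l (b c : I -> R) : weights A l -> (forall i, i \in A -> b i <= c i) ->
  (forall i, i \in A -> b i = c i -> i \in T) ->
  \sum_i l i * c i <= \sum_i l i * b i -> weights T l.
Proof.
move=> [l0 lA l1] bc bT cb; split=> // i iT.
have [iA|/lA//] := boolP (i \in A).
apply/eqP/negP => /negP li.
have h j : l j * b j <= l j * c j.
  have [jA|/lA ->] := boolP (j \in A); last by rewrite !mul0r.
  by rewrite ler_wpM2l ?bc.
have lt : b i < c i.
  by rewrite lt_neqAle bc // andbT; apply: contra iT => /eqP /bT ->.
have : \sum_j l j * b j < \sum_j l j * c j.
  rewrite [ltLHS](bigD1 i) // [ltRHS](bigD1 i) //=; apply: ltr_leD.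
    by rewrite ltr_pM2l // lt_neqAle eq_sym li l0.
  by apply: ler_sum => j _; apply: h.
by rewrite ltNge cb.
Qed.

Lemma weights_conv A l l' (t : R) : 0 <= t <= 1 -> weights A l -> weights A l' ->
  weights A (fun i => t * l i + (1 - t) * l' i).
Proof.
move=> /andP[t0 t1] [l0 lA l1] [l'0 l'A l'1]; split=> [i|i iA|].
- by apply: addr_ge0; apply: mulr_ge0; rewrite ?subr_ge0.
- by rewrite lA // l'A // !mulr0 addr0.
- by rewrite big_split /= -!mulr_sumr l1 l'1; ring.
Qed.

Variable u : I -> point.
Local Notation conv A := (convex_hull (u @` [set` A])).

Lemma aff_comb l x : \sum_i l i = 1 -> aff (\sum_i l i *: u i) x = \sum_i l i * aff (u i) x.
Proof.
move=> l1; rewrite /aff dotp_suml.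
under [RHS]eq_bigr do rewrite mulrDr.
by rewrite big_split /= -mulr_suml l1 mul1r.
Qed.

Lemma conv_mem A i : i \in A -> conv A (u i).
Proof.
move=> iA; apply/convex_hullP; exists (fun j => (j == i)%:R).
  by apply: weightsS (weights1 i); rewrite finset.sub1set.
by rewrite (bigD1 i) //= eqxx scale1r big1 ?addr0 // => j /negPf ->; rewrite scale0r.
Qed.

Lemma convS A T : T \subset A -> conv T `<=` conv A.
Proof.
move=> TA p /convex_hullP[l lT ->]; apply/convex_hullP; exists l => //.
exact: weightsS lT.
Qed.

Lemma conv1 i : conv [set i]%SET = [set u i].
Proof.
apply/seteqP; split=> [p /convex_hullP[l [_ lT l1] ->]|p ->]; last first.
  by apply: conv_mem; rewrite finset.set11.
have l0 j : j != i -> l j = 0 by move=> ji; apply: lT; rewrite finset.inE.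
rewrite (bigD1 i) //= big1 ?addr0 => [|j /l0 ->]; last by rewrite scale0r.
by move: l1; rewrite (bigD1 i) //= big1 ?addr0 => [->|j /l0 //]; rewrite scale1r.
Qed.

Lemma conv_neq0 A : conv A !=set0 <-> A != finset.set0.
Proof.
split=> [[p /convex_hullP[l /weights_gt0[i iA _] _]]|/finset.set0Pn[i iA]].
  by apply/finset.set0Pn; exists i.
by exists (u i); apply: conv_mem.
Qed.

Lemma conv_convex A : @convex_set R point (conv A).
Proof.
move=> p q t; rewrite !inE => /convex_hullP[l lA ->] /convex_hullP[l' lA' ->].
apply/convex_hullP; exists (fun i => t%:num * l i + (1 - t%:num) * l' i).
  by apply: weights_conv => //; apply/andP; split.
rewrite /= /convex.conv /=.
under [RHS]eq_bigr do rewrite scalerDl -!scalerA.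
by rewrite big_split /= -!scaler_sumr.
Qed.

(** An affine functional below the heights, the indices where it touches them, and the sets so
    obtained. A contact set may be empty, and it records indices, so it also keeps points that are
    not vertices of its hull. *)
Definition supp A a x := forall i, i \in A -> aff (u i) x <= a i.
Definition tight A a x : {set I} := [set i in A | aff (u i) x == a i]%SET.
Definition contact A a T := exists2 x, supp A a x & T = tight A a x.

Definition lower_hull A a (p : point) : R :=
  inf [set h : R | @convex_hull R (point * R^o)%type
         [set (u i, a i) | i in [set` A]] (p, h)].

Lemma lower_hull_set A a p h :
  @convex_hull R (point * R^o)%type [set (u i, a i) | i in [set` A]] (p, h) <->
  exists2 l, weights A l & p = \sum_i l i *: u i /\ h = \sum_i l i * a i.
Proof.
have e l : \sum_i l i *: ((u i, a i) : point * R^o) =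
    (\sum_i l i *: u i, \sum_i l i * a i).
  rewrite [LHS]surjective_pairing (raddf_sum (fst : point * R^o -> point)).
  by rewrite (raddf_sum (snd : point * R^o -> R^o)).
split=> [/convex_hullP[l lA]|[l lA [-> ->]]]; first by rewrite e => -[-> ->]; exists l.
by apply/convex_hullP; exists l => //; rewrite e.
Qed.

Lemma lower_hull_le A a l : weights A l ->
  lower_hull A a (\sum_i l i *: u i) <= \sum_i l i * a i.
Proof.
move=> lA; apply: ge_inf; last by apply/lower_hull_set; exists l.
(* The infimum is meaningful only for a set bounded below; weights lie between 0 and 1, which gives
   this bound. *)
exists (- \sum_i `|a i|) => h /lower_hull_set[m [m0 mA m1] [_ ->]].
rewrite -sumrN; apply: ler_sum => i _.
have m_le1 : m i <= 1 by rewrite -m1 (bigD1 i) //= lerDl sumr_ge0.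
have := m0 i; have := ler_norm (- a i); rewrite normrN; have := normr_ge0 (a i); nra.
Qed.

Lemma le_lower_hull A a p (b : R) : conv A p ->
  (forall l, weights A l -> p = \sum_i l i *: u i -> b <= \sum_i l i * a i) ->
  b <= lower_hull A a p.
Proof.
move=> /convex_hullP[l lA pE] h; apply: lb_le_inf.
  by exists (\sum_i l i * a i); apply/lower_hull_set; exists l.
by move=> _ /lower_hull_set[m mA [pm ->]]; apply: h.
Qed.

Lemma lower_hull_ge A a x p : supp A a x -> conv A p -> aff p x <= lower_hull A a p.
Proof.
move=> sx Ap; apply: le_lower_hull => // l [l0 lA l1] ->.
rewrite aff_comb //; apply: ler_sum => i _.
by have [/sx h|/lA ->] := boolP (i \in A); [rewrite ler_wpM2l|rewrite !mul0r].
Qed.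

Lemma lower_hull_tight A a x p : supp A a x -> conv (tight A a x) p ->
  lower_hull A a p = aff p x.
Proof.
move=> sx Tp; have TA : tight A a x \subset A.
  by apply/fintype.subsetP => i; rewrite finset.inE => /andP[].
apply/eqP; rewrite eq_le lower_hull_ge // ?andbT; last exact: convS Tp.
have /convex_hullP[l lT ->] := Tp; have [_ lT0 l1] := lT.
apply: le_trans (lower_hull_le _ (weightsS TA lT)) _.
rewrite aff_comb //; apply: ler_sum => i _.
have [|/lT0 ->] := boolP (i \in tight A a x); last by rewrite !mul0r.
by rewrite finset.inE => /andP[_ /eqP ->].
Qed.

(** A bounded linear program attains its minimum. The unknown is a functional [x] together with a
    scale [s], and the index [None] stands for the constraint [s <= 0]. In the resulting identity
    the multipliers of the points are the optimal weights, and that of [None] is a nonnegative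
    slack. *)
Lemma lower_hull_attained A a p : conv A p ->
  exists2 l, weights A l & p = \sum_i l i *: u i /\ lower_hull A a p = \sum_i l i * a i.
Proof.
move=> Ap; set nu := lower_hull A a p.
pose F (o : option I) (xs : (point * R^o) * R^o) : R :=
  if o is Some i then aff (u i) xs.1 + xs.2 * a i else xs.2.
pose c (xs : (point * R^o) * R^o) : R := aff p xs.1 + xs.2 * nu.
pose B := [set o : option I | if o is Some i then i \in A else true]%SET.
have e (k' f1 f2 t1 t2 b : R) : k' * f1 + f2 + (k' * t1 + t2) * b =
    k' * (f1 + t1 * b) + (f2 + t2 * b) by ring.
have lF o : linear_form (F o).
  by move=> k [x t] [y s]; case: o => [i|] //=; rewrite aff_linear; apply: e.
have lc : linear_form c by move=> k [x t] [y s]; rewrite /c /= aff_linear; apply: e.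
have [[x s] Fx|m m0 cE] := farkas (A := B) lF lc.
  have s0 : s <= 0 by apply: (Fx None); rewrite finset.inE.
  have ge0 l : weights A l -> p = \sum_i l i *: u i -> aff p x <= - s * \sum_i l i * a i.
    move=> [l0 lA l1] ->; rewrite aff_comb // mulr_sumr; apply: ler_sum => i _.
    have [iA|/lA ->] := boolP (i \in A); last by rewrite !mul0r mulr0.
    have : aff (u i) x + s * a i <= 0 by apply: (Fx (Some i)); rewrite finset.inE.
    by rewrite mulrCA => h; rewrite ler_wpM2l //; lra.
  rewrite /c /=; have [s00|sn] := eqVneq s 0.
    have /convex_hullP[l lA pE] := Ap.
    by have := ge0 _ lA pE; rewrite s00 oppr0 !mul0r addr0.
  have s_lt0 : 0 < - s by rewrite oppr_gt0 lt_neqAle sn.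
  have : (- s)^-1 * aff p x <= nu.
    apply: le_lower_hull => // l lA pE.
    by rewrite ler_pdivrMl //; apply: ge0.
  by rewrite ler_pdivrMl //; lra.
pose l i := if i \in A then m (Some i) else 0.
have cE' x : c x = m None * x.2 + \sum_i l i * F (Some i) x.
  rewrite cE big_mkcond /= (bigD1 None) //= finset.inE; congr (_ + _).
  rewrite (reindex_omap Some id) /=; last by case.
  apply: eq_big => [i|i _]; first by rewrite eqxx.
  by rewrite finset.inE /l; case: ifP => // _; rewrite mul0r.
have l0 i : 0 <= l i by rewrite /l; case: ifP.
have l1 : \sum_i l i = 1.
  have := cE' ((0, 1), 0); rewrite /c /= aff_cst mul0r mulr0 addr0 add0r => ->.
  by apply: eq_bigr => i _; rewrite /F /= aff_cst mul0r addr0 mulr1.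
have pE : p = \sum_i l i *: u i.
  apply: dotp_inj => x; rewrite dotp_suml.
  have := cE' ((x, 0), 0); rewrite /c /aff /= mul0r mulr0 !addr0 add0r => ->.
  by apply: eq_bigr => i _; rewrite /F /aff /= mul0r !addr0.
have lA : weights A l by split=> // i iA; rewrite /l (negPf iA).
exists l => //; split=> //; apply/eqP; rewrite eq_le {1}/nu {1}pE lower_hull_le //=.
have := cE' (0, 1); rewrite /c /= (linear_form0 (aff_linear p)) mul1r mulr1 add0r => ->.
rewrite -[leLHS]add0r lerD //; apply: ler_sum => i _.
by rewrite /F /= (linear_form0 (aff_linear _)) mul1r add0r.
Qed.

(** Linear programming duality. If no functional below the heights reaches the value [nu] at [p],
    the certificate has total weight [y None] on the points. When this is zero all its terms vanish;
    otherwise normalization gives weights for [p] of value less than the minimum [nu]. *)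
Lemma supporting A a p : conv A p -> exists2 x, supp A a x & conv (tight A a x) p.
Proof.
move=> Ap; have [l lA [pE nuE]] := lower_hull_attained a Ap.
set nu := lower_hull A a p in nuE.
pose F (o : option I) (x : point * R^o) : R := if o is Some i then aff (u i) x else - aff p x.
pose r (o : option I) : R := if o is Some i then a i else - nu.
pose B := [set o : option I | if o is Some i then i \in A else true]%SET.
have lF o : linear_form (F o).
  by move=> k x y; case: o => [i|] /=; rewrite aff_linear //; ring.
have [[x Fx _]|[y [y0 yF yr]]] := affine_farkas r lF (finset.sub0set B).
  have sx : supp A a x by move=> i iA; apply: (Fx (Some i)); rewrite finset.inE.
  exists x => //; apply/convex_hullP; exists l => //.
  apply: (weights_eq lA sx) => [i iA xi|]; first by rewrite finset.inE iA xi eqxx.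
  have [_ _ l1] := lA.
  rewrite -nuE -aff_comb // -pE -lerN2; apply: (Fx None); by rewrite finset.inE.
exfalso.
pose z i := if i \in A then y (Some i) else 0.
have z0 i : 0 <= z i.
  by rewrite /z; case: ifP => // iA; apply: y0; rewrite ?finset.inE.
have yN : 0 <= y None by apply: y0; rewrite finset.inE.
have sE (G : option I -> R) : \sum_(o in B) y o * G o =
    y None * G None + \sum_i z i * G (Some i).
  rewrite big_mkcond /= (bigD1 None) //= finset.inE; congr (_ + _).
  rewrite (reindex_omap Some id) /=; last by case.
  apply: eq_big => [i|i _]; first by rewrite eqxx.
  by rewrite finset.inE /z; case: ifP => // _; rewrite mul0r.
have zF x : \sum_i z i * aff (u i) x = y None * aff p x.
  by have := yF x; rewrite sE /F mulrN; lra.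
have z1 : \sum_i z i = y None.
  have := zF (0, 1); rewrite aff_cst mulr1 => <-.
  by apply: eq_bigr => i _; rewrite aff_cst mulr1.
move: yr; rewrite sE /r mulrN => zr.
have [yN0|yN0] := eqVneq (y None) 0.
  have zz i : z i = 0.
    apply/eqP; rewrite eq_le z0 andbT -yN0 -z1 (bigD1 i) //= lerDl.
    by apply: sumr_ge0.
  move: zr; rewrite yN0 mul0r oppr0 add0r big1 ?ltxx // => i _.
  by rewrite zz mul0r.
have yp : 0 < y None by rewrite lt_neqAle eq_sym yN0.
pose m i := (y None)^-1 * z i.
have mA : weights A m.
  split=> [i|i iA|]; first by rewrite /m mulr_ge0 // invr_ge0.
    by rewrite /m /z (negPf iA) mulr0.
  by rewrite -mulr_sumr z1 mulVf.
have pm : p = \sum_i m i *: u i.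
  apply: dotp_inj => x; rewrite dotp_suml.
  have zFx : \sum_i z i * dotp (u i) x = y None * dotp p x.
    have := zF (x, 0); rewrite /aff /= addr0 => <-.
    by apply: eq_bigr => i _; rewrite addr0.
  under [RHS]eq_bigr do rewrite /m -mulrA.
  by rewrite -mulr_sumr zFx mulKf.
have : nu <= \sum_i m i * a i by rewrite /nu {1}pm; apply: lower_hull_le.
have -> : \sum_i m i * a i = (y None)^-1 * \sum_i z i * a i.
  by rewrite mulr_sumr; apply: eq_bigr => i _; rewrite mulrA.
rewrite ler_pdivlMl //; lra.
Qed.

End Weights.
End ConvexHulls.

(** * Contact sets and the cells of a regular subdivision *)

Section Subdivisions.
Variables (R : realType) (I : finType) (u : I -> 'rV[R]_3).
Local Notation point := 'rV[R]_3.
Implicit Types (A B T : {set I}) (a : I -> R) (s F : set point).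
Local Notation conv A := (convex_hull (u @` [set` A])).
Local Notation supp := (supp u).
Local Notation tight := (tight u).
Local Notation contact := (contact u).

Lemma tightP A a x i : reflect (i \in A /\ aff (u i) x = a i) (i \in tight A a x).
Proof. by rewrite finset.inE; apply: (iffP andP) => -[? /eqP]. Qed.

Lemma contact_sub A a T : contact A a T -> T \subset A.
Proof. by move=> [x _ ->]; apply/fintype.subsetP => i /tightP[]. Qed.

Lemma eq_contact A a a' T : {in A, a =1 a'} -> contact A a T -> contact A a' T.
Proof.
move=> aa' [x sx ->]; exists x => [i iA|]; first by rewrite -aa' // sx.
apply/finset.setP => i; rewrite !finset.inE; have [iA /=|//] := boolP (i \in A).
by rewrite aa'.
Qed.

Lemma contact_restr A B a T : A \subset B -> contact B a T -> contact A a (T :&: A)%SET.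
Proof.
move=> /fintype.subsetP AB [x sx ->]; exists x => [i /AB /sx //|].
apply/finset.setP => i; rewrite !finset.inE andbC; have [/AB ->|//] := boolP (i \in A).
by [].
Qed.

Lemma contact_cst A a T (e : R) : contact A a T -> contact A (fun i => e + a i) T.
Proof.
move=> [x sx ->]; exists ((0, e) + x) => [i iA|].
  by rewrite affD aff_cst lerD2l sx.
apply/finset.setP => i; rewrite !finset.inE affD aff_cst.
by rewrite (inj_eq (addrI e)).
Qed.

Lemma small_positive A (r d : I -> R) : (forall i, i \in A -> 0 < r i) ->
  exists2 e, 0 < e & forall i, i \in A -> e * d i < r i.
Proof.
move=> r0; pose S := \sum_(i in A) `|d i| / r i.
have h i : i \in A -> 0 <= `|d i| / r i by move=> /r0 ri; rewrite divr_ge0 // ltW.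
have S0 : 0 <= S by apply: sumr_ge0.
have e0 : 0 < (1 + S)^-1 by rewrite invr_gt0; lra.
exists (1 + S)^-1 => // i iA; have ri := r0 _ iA.
rewrite ltr_pdivrMl; last lra.
have : `|d i| / r i <= S by rewrite /S (bigD1 i) //= lerDl sumr_ge0 // => j /andP[/h].
rewrite ler_pdivrMr //; have := ler_norm (d i); nra.
Qed.

(** Points outside the tight set have positive slack, and there are finitely many of them, so a
    small multiple of [y] does not use it up. *)
Lemma perturb A a x y : supp A a x -> (forall i, i \in tight A a x -> aff (u i) y <= 0) ->
  contact A a [set i in tight A a x | aff (u i) y == 0]%SET.
Proof.
move=> sx ty.
have r0 i : i \in A :\: tight A a x -> 0 < a i - aff (u i) x.
  by rewrite !finset.inE => /andP[+ iA]; rewrite iA subr_gt0 lt_neqAle sx // andbT.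
have [e e0 he] := small_positive (fun i => aff (u i) y) r0.
have lt i : i \in A -> i \notin tight A a x -> aff (u i) (x + e *: y) < a i.
  move=> iA iT; have := he i; rewrite finset.inE iA iT affD affZ => /(_ isT); lra.
exists (x + e *: y) => [i iA|].
  have [iT|/lt/ltW->//] := boolP (i \in tight A a x).
  have /tightP[_ xi] := iT; rewrite affD affZ xi.
  by rewrite -[leRHS]addr0 lerD2l pmulr_rle0 // ty.
apply/finset.setP => i; rewrite finset.in_set; apply/andP/tightP => [[iT /eqP y0]|[iA xi]].
  by have /tightP[iA xi] := iT; rewrite affD affZ y0 mulr0 addr0.
have iT : i \in tight A a x by apply: contraLR (eqxx (a i)) => /(lt _ iA); rewrite xi ltxx.
split=> //; have /tightP[_ xi'] := iT; move: xi; rewrite affD affZ xi' => /eqP.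
by rewrite -subr_eq0 addrAC subrr add0r mulf_eq0 gt_eqF.
Qed.

Definition argmax T (X : point) : {set I} :=
  [set i in T | [forall j in T, dotp (u j) X <= dotp (u i) X]]%SET.

Lemma conv_argmax T X :
  [set p | conv T p /\ forall q, conv T q -> dotp q X <= dotp p X] = conv (argmax T X).
Proof.
apply/seteqP; split=> p.
  move=> [/convex_hullP[l lT ->] pm].
  have [i0 i0T _] := weights_gt0 lT.
  have [i iT im] : exists2 i, i \in T & forall j, j \in T -> dotp (u j) X <= dotp (u i) X.
    by case: (@Order.TotalTheory.arg_maxP _ _ _ i0 (mem T) (fun j => dotp (u j) X) i0T) => i; exists i.
  apply/convex_hullP; exists l => //.
  apply: (weights_eq (b := fun j => dotp (u j) X) (c := fun=> dotp (u i) X) lT) => [j /im //|j jT e|].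
    by rewrite finset.inE jT /=; apply/forall_inP => j' /im; rewrite e.
  have [_ _ l1] := lT; rewrite -mulr_suml l1 mul1r -dotp_suml.
  by apply: pm; apply: conv_mem.
move=> /convex_hullP[l lT ->]; split.
  apply/convex_hullP; exists l => //; apply: weightsS lT.
  by apply/fintype.subsetP => i; rewrite finset.inE => /andP[].
have [i0 i0T _] := weights_gt0 lT.
have aE i : i \in argmax T X -> dotp (u i) X = dotp (u i0) X.
  move: i0T; rewrite !finset.inE => /andP[i0T /forall_inP i0m] /andP[iT /forall_inP im].
  by apply/eqP; rewrite eq_le i0m // im.
move=> _ /convex_hullP[m [m0 mT m1] ->]; have [l0 lT0 l1] := lT.
rewrite !dotp_suml; apply: (@le_trans _ _ (dotp (u i0) X)).
  rewrite -[leRHS]mul1r -m1 mulr_suml; apply: ler_sum => i _.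
  have [iT|/mT ->] := boolP (i \in T); last by rewrite !mul0r.
  move: i0T; rewrite finset.inE => /andP[_ /forall_inP i0m].
  by rewrite ler_wpM2l ?i0m.
rewrite -[leLHS]mul1r -l1 mulr_suml; apply: ler_sum => i _.
by have [/aE ->|/lT0 ->] := boolP (i \in argmax T X); rewrite ?mul0r.
Qed.

(** On [T'] the functional [x'] equals the heights, so [x - x'] is nonpositive there and vanishes
    exactly on [T]; its slope exposes the face. *)
Lemma contact_face A a T T' : contact A a T -> contact A a T' -> T \subset T' ->
  T != finset.set0 -> face (conv T') (conv T).
Proof.
move=> [x sx Tx] [x' sx' Tx'] TT' T0; split; first exact/conv_neq0.
exists (x - x').1; rewrite conv_argmax; suff -> : T = argmax T' (x - x').1 by [].
have yE i : dotp (u i) (x - x').1 = aff (u i) x - aff (u i) x' - (x - x').2.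
  by rewrite -affN -affD /aff addrK.
have inT' i : i \in T' -> i \in A /\ aff (u i) x' = a i by rewrite Tx' => /tightP.
have inT i : i \in T -> i \in A /\ aff (u i) x = a i by rewrite Tx => /tightP.
have [i0 i0T] := finset.set0Pn _ T0.
apply/finset.setP => i; apply/idP/idP => [iT|].
  rewrite finset.inE (fintype.subsetP TT') //=; apply/forall_inP => j /inT'[jA xj].
  by rewrite !yE xj; have [_ ->] := inT _ iT; have [_ ->] := inT' _ (fintype.subsetP TT' _ iT);
     have := sx _ jA; lra.
rewrite finset.inE => /andP[iT' /forall_inP im]; have [iA x'i] := inT' _ iT'.
have := im _ (fintype.subsetP TT' _ i0T); rewrite !yE x'i.
have [_ ->] := inT _ i0T; have [_ ->] := inT' _ (fintype.subsetP TT' _ i0T) => h.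
rewrite Tx; apply/tightP; split=> //; apply/eqP; rewrite eq_le sx //; lra.
Qed.

(** Adding to the supporting functional of [T] a small multiple of the functional exposing the face
    leaves just the points of the face in contact. *)
Lemma face_contact A a T F : contact A a T -> face (conv T) F ->
  exists2 T', contact A a T' & [/\ T' \subset T, T' != finset.set0 & F = conv T'].
Proof.
move=> [x sx Tx] [F0 [X FE]].
have FE' : F = conv (argmax T X) by rewrite FE conv_argmax.
have T'0 : argmax T X != finset.set0 by apply/(conv_neq0 u); rewrite -FE'.
have sT : argmax T X \subset T by apply/fintype.subsetP => i; rewrite finset.inE => /andP[].
exists (argmax T X) => //.
have [i0] := finset.set0Pn _ T'0; rewrite finset.inE => /andP[i0T /forall_inP i0m].
pose y : point * R^o := (X, - dotp (u i0) X).
have yi i : aff (u i) y = dotp (u i) X - dotp (u i0) X by [].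
have h i : i \in tight A a x -> aff (u i) y <= 0.
  by rewrite -Tx => iT; rewrite yi subr_le0 i0m.
suff -> : argmax T X = [set i in tight A a x | aff (u i) y == 0]%SET by apply: perturb.
rewrite -Tx; apply/finset.setP => i; rewrite !finset.inE; have [iT /=|//] := boolP (i \in T).
rewrite yi subr_eq0; apply/forall_inP/eqP => [im|-> //].
by apply/eqP; rewrite eq_le i0m // im.
Qed.

Lemma lower_hull_contact A a T p : contact A a T -> conv T p ->
  exists2 x, supp A a x /\ T = tight A a x & lower_hull u A a p = aff p x.
Proof.
by move=> [x sx TE] Tp; exists x => //; apply: lower_hull_tight; rewrite -?TE.
Qed.

Lemma lower_hull_weights A a T l : contact A a T -> weights T l ->
  lower_hull u A a (\sum_i l i *: u i) = \sum_i l i * a i.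
Proof.
move=> cT lT; have Tp : conv T (\sum_i l i *: u i) by apply/convex_hullP; exists l.
have [x [sx TE] ->] := lower_hull_contact cT Tp.
have [_ lT0 l1] := lT; rewrite aff_comb //; apply: eq_bigr => i _.
have [|/lT0 ->] := boolP (i \in T); last by rewrite !mul0r.
by rewrite TE => /tightP[_ ->].
Qed.

Lemma weights_contact A a T l : contact A a T -> weights A l ->
  conv T (\sum_i l i *: u i) -> lower_hull u A a (\sum_i l i *: u i) = \sum_i l i * a i ->
  weights T l.
Proof.
move=> cT lA Tp nuE; have [x [sx TE] nux] := lower_hull_contact cT Tp.
have [_ _ l1] := lA.
rewrite TE; apply: (weights_eq lA sx) => [i iA xi|]; first by apply/tightP.
by rewrite -nuE nux aff_comb.
Qed.

Lemma contact_conv A a p : conv A p ->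
  exists2 T, contact A a T & conv T p.
Proof. by move=> /(supporting a)[x sx Tp]; exists (tight A a x) => //; exists x. Qed.

Lemma conv_lattice_polytope (w : I -> 'rV[int]_3) T : (forall i, u i = toR R (w i)) ->
  T != finset.set0 -> lattice_polytope (conv T).
Proof.
move=> uw T0; exists [seq w i | i <- enum T].
  have [i iT] := finset.set0Pn _ T0; move=> e.
  by have := map_f w (_ : i \in enum T); rewrite mem_enum e => /(_ iT).
congr convex_hull; apply/seteqP; split=> [_ [i iT <-]|_ [z /= /mapP[i iT ->] <-]].
  by exists (w i); rewrite ?uw //=; apply: map_f; rewrite mem_enum.
by exists i; rewrite ?uw //=; move: iT; rewrite mem_enum.
Qed.

Definition maximal_contact A a T := contact A a T /\
  forall T', contact A a T' -> T \subset T' -> T' = T.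

Lemma exists_maximal_contact A a T : contact A a T ->
  exists2 T', maximal_contact A a T' & T \subset T'.
Proof.
move=> cT; have := @finset.maxset_exists I (fun T => `[< contact A a T >]) T.
move=> /(_ (introT (asboolP _) cT))[T' /finset.maxsetP[/asboolP cT' mT'] TT']; exists T' => //.
by split=> // T'' /asboolP cT''; apply: mT'.
Qed.

Variables (A : {set I}) (a : I -> R) (nu : point -> R).
Hypothesis nuE : forall p, conv A p -> nu p = lower_hull u A a p.

Lemma contact_affine T : contact A a T -> affine_on (conv T) nu.
Proof.
move=> cT; have [x sx TE] := cT; exists x.1, x.2 => p Tp.
rewrite nuE; last exact: convS (contact_sub cT) _ Tp.
by rewrite (lower_hull_tight sx) // -TE.
Qed.

(* An affine piece lies in the contact set of a point of it whose optimal weights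
   have maximal support. *)
Lemma affine_sub_contact s : @convex_set R point s -> s `<=` conv A -> affine_on s nu ->
  s !=set0 -> exists2 T, contact A a T & s `<=` conv T.
Proof.
move=> cs sA [X [b nub]] [p0 sp0].
pose Q (S : {set I}) := exists2 l, weights A l &
  [/\ s (\sum_i l i *: u i), nu (\sum_i l i *: u i) = \sum_i l i * a i
   & S = [set i | l i != 0]%SET].
have optimal p : s p -> exists2 l, weights A l & p = \sum_i l i *: u i /\ nu p = \sum_i l i * a i.
  by move=> sp; have := lower_hull_attained a (sA _ sp); rewrite -nuE //; apply: sA.
have [l lA [p0E nup0]] := optimal _ sp0.
have Q0 : Q [set i | l i != 0]%SET by exists l => //; rewrite -p0E.
have := @finset.maxset_exists I (fun S => `[< Q S >]) _ (introT (asboolP _) Q0).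
move=> [S /finset.maxsetP[/asboolP [m mA [sm num SE]] mS] _] {p0 sp0 l lA p0E nup0 Q0}.
have [T cT Tm] := contact_conv a (sA _ sm); exists T => // q sq.
have mT : weights T m.
  by apply: weights_contact cT mA Tm _; rewrite -nuE //; apply: sA.
have [l lA [qE nuq]] := optimal _ sq.
(* The average of two optimal weights is again optimal, because [nu] is affine on [s], and its
   support is the union of both. Maximality of [S] then puts the support of [l] inside that of [m],
   hence inside [T]. *)
pose r i := 2^-1 * l i + (1 - 2^-1) * m i.
have h2 : 0 <= (2^-1 : R) <= 1 by apply/andP; split; lra.
have rA : weights A r by apply: weights_conv.
have rE : \sum_i r i *: u i = 2^-1 *: q + (1 - 2^-1) *: \sum_i m i *: u i.
  rewrite qE !scaler_sumr -big_split; apply: eq_bigr => i _.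
  by rewrite /r scalerDl !scalerA.
have sr : s (\sum_i r i *: u i).
  have := cs q (\sum_i m i *: u i) (Itv01 (proj1 (andP h2)) (proj2 (andP h2))).
  by rewrite !inE rE => /(_ sq sm).
have [l0 lA0 l1] := lA; have [m0 mA0 m1] := mA.
have Qr : Q [set i | r i != 0]%SET.
  exists r => //; split=> //; rewrite nub // rE.
  rewrite dotpC dotp_linear (linear_formZ (dotp_linear X)).
  have := nub _ sq; have := nub _ sm; rewrite num nuq => hm hq.
  have -> : \sum_i r i * a i = 2^-1 * \sum_i l i * a i + (1 - 2^-1) * \sum_i m i * a i.
    rewrite !mulr_sumr -big_split; apply: eq_bigr => i _; rewrite /r /=; ring.
  by rewrite hm hq ![dotp X _]dotpC; field.
have r0 i : r i = 0 -> l i = 0.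
  by rewrite /r => h; have := l0 i; have := m0 i; lra.
have rS : [set i | r i != 0]%SET = S.
  apply: mS; first exact/asboolP.
  apply/fintype.subsetP => i; rewrite SE !finset.inE; apply: contra => /eqP h.
  by apply/eqP; move: h; rewrite /r => h; have := l0 i; have := m0 i; lra.
rewrite qE; apply/convex_hullP; exists l => //; split=> // i iT.
apply: r0; apply/eqP; apply: contraNT iT => ri.
have : i \in S by rewrite -rS finset.inE.
rewrite SE finset.inE; apply: contraNT => iT; apply/eqP.
by have [_ -> //] := mT.
Qed.

Hypothesis A0 : A != finset.set0.

Lemma linearity_domainP s : linearity_domain (conv A) nu s <->
  exists2 T, maximal_contact A a T /\ T != finset.set0 & s = conv T.
Proof.
split=> [[cs sA af ms]|[T [[cT mT] T0] ->]].
  have s0 : s !=set0.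
    apply: contrapT => no; have [i iA] := finset.set0Pn _ A0.
    have c1 : @convex_set R point [set u i] by rewrite -conv1; apply: conv_convex.
    have s1 : s `<=` [set u i] by move=> p sp; exfalso; apply: no; exists p.
    apply: no; exists (u i); rewrite -(ms _ c1 _ _ s1) //.
      by move=> _ ->; apply: conv_mem.
    exists 0, (nu (u i)) => _ ->.
    by rewrite (linear_form0 (dotp_linear _)) add0r.
  have [T cT sT] := affine_sub_contact cs sA af s0.
  have [T' mT' TT'] := exists_maximal_contact cT.
  have sT' : s `<=` conv T' by apply: subset_trans (convS TT').
  have T'0 : T' != finset.set0.
    by have [p sp] := s0; apply/(conv_neq0 u); exists p; apply: sT'.
  exists T' => //; apply/esym/ms => //; first exact: conv_convex.
    by apply: convS; have [/contact_sub] := mT'.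
  by apply: contact_affine; have [] := mT'.
split; [exact: conv_convex|exact: convS (contact_sub cT)|exact: contact_affine cT|].
move=> s' cs' sA' af' Ts'.
have s'0 : s' !=set0 by have [p Tp] := (conv_neq0 u T).2 T0; exists p; apply: Ts'.
have [T' cT' sT'] := affine_sub_contact cs' sA' af' s'0.
apply/seteqP; split=> //; suff -> : T = T' by [].
apply/esym/mT => //; apply/fintype.subsetP => i iT.
have [l lT'] : conv T' (u i) by apply/sT'/Ts'/conv_mem.
have iA : i \in A := fintype.subsetP (contact_sub cT) _ iT.
(* That [u i] lies in [conv T'] does not by itself put the index [i] into [T']. But the unit weight
   at [i] is optimal, as [i] is tight for [T], and optimal weights at a point of [conv T'] are
   supported in [T']. *)
have w1 := weights1 R i.
have uE : \sum_j ((j == i)%:R : R) *: u j = u i.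
  by rewrite (bigD1 i) //= eqxx scale1r big1 ?addr0 // => j /negPf ->; rewrite scale0r.
have := @weights_contact A a T' (fun j => (j == i)%:R) cT'.
case=> [|||_ /(_ i) w _].
- by apply: weightsS w1; rewrite finset.sub1set.
- by rewrite uE; apply/sT'/Ts'/conv_mem.
- by apply: lower_hull_weights cT _; apply: weightsS w1; rewrite finset.sub1set.
by apply: contraTT (eqxx i) => /w /eqP; rewrite eqxx pnatr_eq0.
Qed.

Definition cells : set (set point) :=
  [set conv T | T in [set T | contact A a T /\ T != finset.set0]].

(** The bridge to the geometric definition: linearity domains are the hulls of the maximal contact
    sets, and their faces are the hulls of all the nonempty ones. *)
Lemma subdivisionE : subdivision (conv A) nu = cells.
Proof.
apply/seteqP; split=> F.
  move=> [s /linearity_domainP[T [[cT _] T0] ->] /(face_contact cT)[T' cT' [_ T'0 ->]]].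
  by exists T'.
move=> [T [cT T0] <-]; have [T' mT' TT'] := exists_maximal_contact cT.
exists (conv T'); last by apply: contact_face cT _ TT' T0; have [] := mT'.
apply/linearity_domainP; exists T' => //; split=> //.
have [i iT] := finset.set0Pn _ T0; apply/finset.set0Pn; exists i.
exact: (fintype.subsetP TT').
Qed.

Lemma lower_hull_convex_pl (w : I -> 'rV[int]_3) : (forall i, u i = toR R (w i)) ->
  convex_lattice_pl (conv A) nu.
Proof.
move=> uw; split.
- move=> t p q; rewrite !inE => Ap Aq.
  have Apq : conv A (t%:num *: p + (1 - t%:num) *: q).
    have := @conv_convex R I u A p q t; rewrite !inE; exact.
  have -> : @convex.conv R (convex_lmodType point) t p q = t%:num *: p + (1 - t%:num) *: q by [].
  have -> : @convex.conv R R^o t (nu p) (nu q) = t%:num * nu p + (1 - t%:num) * nu q by [].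
  rewrite !nuE //; have [T [x sx TE] Tpq] := contact_conv a Apq.
  rewrite (lower_hull_tight sx) -?TE //.
  have -> : aff (t%:num *: p + (1 - t%:num) *: q) x = t%:num * aff p x + (1 - t%:num) * aff q x.
    rewrite /aff dotpC dotp_linear (linear_formZ (dotp_linear _)) ![dotp x.1 _]dotpC.
    by set b := x.2 : R; set c := (t%:num : R); ring.
  have /andP[t0 t1] : 0 <= (t%:num : R) <= 1 by apply/andP.
  by apply: lerD; rewrite ler_wpM2l ?subr_ge0 // lower_hull_ge.
- apply: (@sub_finite_set _ _ [set conv T | T in [set: {set I}]]).
    by move=> s /linearity_domainP[T _ ->]; exists T.
  by apply: finite_image; apply: finite_finset.
- move=> p /(contact_conv a)[T cT Tp]; have [T' mT' TT'] := exists_maximal_contact cT.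
  have Tp' := convS TT' Tp.
  exists (conv T') => //; apply/linearity_domainP; exists T' => //; split=> //.
  by apply/(conv_neq0 u); exists p.
- by move=> s /linearity_domainP[T [_ T0] ->]; apply: conv_lattice_polytope uw T0.
Qed.

End Subdivisions.

Lemma eq_cells (R : realType) (I : finType) (u : I -> 'rV[R]_3) (A : {set I}) (a a' : I -> R) :
  {in A, a =1 a'} -> cells u A a = cells u A a'.
Proof.
move=> aa'; apply/seteqP; split=> _ [T [cT T0] <-]; exists T => //; split=> //.
  exact: eq_contact cT.
by apply: eq_contact cT => i iA; rewrite aa'.
Qed.

(** * Stability of contact sets under dominating heights *)

Section DominatingHeights.
Variables (R : realType) (I : finType) (u : I -> 'rV[R]_3).
Implicit Types (A B T G : {set I}) (a chi : I -> R).
Local Notation supp := (supp u).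
Local Notation tight := (tight u).
Local Notation contact := (contact u).
Local Notation "a +h* h chi" := (fun i => a i + h * chi i) (at level 50, h at level 9, chi at level 9).

Lemma uniform_bound (F : finType) (P : F -> R -> Prop) :
    (forall x k k', k <= k' -> P x k -> P x k') -> (forall x, exists2 k, 0 <= k & P x k) ->
  exists2 k, 0 <= k & forall x, P x k.
Proof.
move=> mP /(_ _)/cid2-/all_sig2[f f0 fP]; exists (\sum_x f x); first exact: sumr_ge0.
by move=> x; apply: mP (fP x); rewrite (bigD1 x) //= lerDl sumr_ge0.
Qed.

Definition bounded_on A a H := forall i, i \in A -> `|a i| <= H.

Lemma sum_bound A (y a : I -> R) H : bounded_on A a H ->
  `|\sum_(i in A) y i * a i| <= (\sum_(i in A) `|y i|) * H.
Proof.
move=> aH; apply: le_trans (ler_norm_sum _ _ _) _; rewrite mulr_suml.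
by apply: ler_sum => i /aH h; rewrite normrM ler_wpM2l.
Qed.

(* The constant comes from a Farkas certificate, which depends on the points only. *)
Lemma recession A T chi : exists2 k, 0 <= k & forall (a : I -> R) (H h : R), bounded_on A a H ->
  contact A (a +h* h chi) T -> k * H < h ->
  exists2 y, supp A chi y & T \subset tight A chi y.
Proof.
have [TA|nTA] := boolP (T \subset A); last first.
  by exists 0 => // a H h _ /contact_sub TA; rewrite TA in nTA.
have [[y yA yT]|[y [y0 yF yr]]] := affine_farkas chi (fun i => aff_linear (u i)) TA.
  exists 0 => // a H h _ _ _; exists y => //; apply/fintype.subsetP => i iT.
  by apply/tightP; split; [apply: (fintype.subsetP TA)|apply: yT].
set S := \sum_(i in A) y i * chi i in yr.
exists ((\sum_(i in A) `|y i|) / - S).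
  by rewrite divr_ge0 ?sumr_ge0 // oppr_ge0 ltW.
move=> a H h aH [x sx TE] kh; exfalso.
have : 0 <= \sum_(i in A) y i * (a i + h * chi i).
  rewrite -[leLHS](yF x); apply: ler_sum => i iA; have [iT|iT] := boolP (i \in T).
    by move: iT; rewrite TE => /tightP[_ ->].
  by rewrite ler_wpM2l ?sx // y0.
have -> : \sum_(i in A) y i * (a i + h * chi i) = \sum_(i in A) y i * a i + h * S.
  by rewrite mulr_sumr -big_split; apply: eq_bigr => i _ /=; ring.
have := sum_bound y aH; set Y := \sum_(i in A) _ in kh *.
move: kh; rewrite mulrAC ltr_pdivrMr ?oppr_gt0 // => kh.
move=> /ler_normlP[]; lra.
Qed.

(** This provides the direction in which a functional must move for [T] to stay tight while [h]
    decreases. If the equations have no solution, some affine relation among the points of [T] pairs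
    positively with [chi]; evaluated on the tight functional, it expresses [h] through the heights
    [a] and bounds it by a multiple of [H]. *)
Lemma tight_bound A T chi : T \subset A -> exists2 k, 0 <= k & forall (a : I -> R) (H h : R) x, bounded_on A a H ->
  (forall i, i \in T -> aff (u i) x = a i + h * chi i) -> k * H < h ->
  exists y, forall i, i \in T -> aff (u i) y = - chi i.
Proof.
move=> TA; have [[y _ yT]|[y [_ yF]]] :=
  affine_farkas (fun i => - chi i) (fun i => aff_linear (u i)) (subxx T : T \subset T).
  by exists 0 => // *; exists y.
under eq_bigr do rewrite mulrN.
rewrite sumrN oppr_lt0; set S := \sum_(i in T) y i * chi i => S0.
exists ((\sum_(i in T) `|y i|) / S); first by apply: divr_ge0; [apply: sumr_ge0|apply: ltW].
move=> a H h x aH xT; rewrite mulrAC ltr_pdivrMr // => kh; exfalso.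
have : \sum_(i in T) y i * (a i + h * chi i) = 0.
  by rewrite -[RHS](yF x); apply: eq_bigr => i iT; rewrite xT.
have -> : \sum_(i in T) y i * (a i + h * chi i) = \sum_(i in T) y i * a i + h * S.
  by rewrite mulr_sumr -big_split; apply: eq_bigr => i _ /=; ring.
have := @sum_bound T y a H (fun i iT => aH i (fintype.subsetP TA _ iT)).
by move=> /ler_normlP[]; lra.
Qed.

(** The ratio test of the simplex method, for slacks [r] consumed at speeds [d], stopped at time
    [t1] at the latest. *)
Lemma first_hit A (r d : I -> R) t1 : (forall i, i \in A -> 0 <= r i) -> 0 <= t1 ->
  exists t, [/\ 0 <= t <= t1, forall i, i \in A -> t * d i <= r i &
    t = t1 \/ exists2 i, i \in A & 0 < d i /\ t * d i = r i].
Proof.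
move=> r0 t10; have [h|] := pselect (forall i, i \in A -> t1 * d i <= r i).
  by exists t1; split=> //; [rewrite t10 lexx|left].
move=> /existsNP[i0 /not_implyP[i0A /negP]]; rewrite -ltNge => i0r.
have d0 : 0 < d i0.
  by rewrite ltNge; apply/negP => d0; have := r0 _ i0A; nra.
pose P i := (i \in A) && (0 < d i).
have Pi0 : P i0 by rewrite /P i0A.
have [i /andP[iA di] im] := @Order.TotalTheory.arg_minP _ _ _ i0 P (fun i => r i / d i) Pi0.
exists (r i / d i); split.
- rewrite divr_ge0 ?r0 //=; last exact: ltW.
  by apply: le_trans (im _ Pi0) _; rewrite ler_pdivrMr // ltW.
- move=> j jA; have [dj|dj] := ltP 0 (d j).
    by rewrite -ler_pdivlMr // im // /P jA.
  by apply: le_trans (r0 _ jA); rewrite mulr_ge0_le0 // divr_ge0 ?r0 // ltW.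
- by right; exists i => //; split=> //; rewrite divfK // gt_eqF.
Qed.

(* Lower the height until a new point becomes tight: a maximal tight set pins the
   height below the bound. *)
Lemma contact_drop A chi : exists2 k, 0 <= k & forall T (a : I -> R) (H h h0 : R), bounded_on A a H ->
  k * H < h -> h <= h0 -> contact A (a +h* h0 chi) T -> contact A (a +h* h chi) T.
Proof.
have [k k0 kP] : exists2 k, 0 <= k & forall T : {set I}, T \subset A -> forall (a : I -> R) (H h : R) x, 0 <= H ->
    bounded_on A a H -> (forall i, i \in T -> aff (u i) x = a i + h * chi i) -> k * H < h ->
    exists y, forall i, i \in T -> aff (u i) y = - chi i.
  apply: uniform_bound => [T k k' kk' h TA a H h0 x H0 aH xT kh|T].
    by apply: h aH xT _ => //; apply: le_lt_trans kh; rewrite ler_wpM2r.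
  have [TA|nTA] := boolP (T \subset A); last by exists 0.
  by have [k k0 kP] := tight_bound chi TA; exists k => // _ a H h x H0; apply: kP.
exists k => // T a H h h0 aH kh hh0 cT.
have [->|h_neq] := eqVneq h h0; first by [].
have {h_neq}hh0 : h < h0 by rewrite lt_neqAle h_neq.
have [x0 sx0 TE] := cT.
have [T0|[i0 i0T]] := finset.set_0Vmem T.
  exists (0, - \sum_(i in A) `|a i + h * chi i| - 1).
    move=> i iA; rewrite aff_cst; have := ler_norm (- (a i + h * chi i)); rewrite normrN.
    rewrite (bigD1 i) //=; have : 0 <= \sum_(j in A | j != i) `|a j + h * chi j| by apply: sumr_ge0.
    lra.
  apply/finset.setP => i; rewrite T0 finset.in_set0; apply/esym/negP => /tightP[iA].
  rewrite aff_cst (bigD1 i) //=.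
  have : 0 <= \sum_(j in A | j != i) `|a j + h * chi j| by apply: sumr_ge0.
  have := ler_norm (- (a i + h * chi i)); rewrite normrN; lra.
have i0A : i0 \in A by have := fintype.subsetP (contact_sub cT) _ i0T.
have H0 : 0 <= H by apply: le_trans (aH _ i0A).
(* If [T] is also tight at some height below [h], interpolation with the functional at [h0] reaches
   [h]. The tight set is then exactly [T], because the functional at [h0] enters with positive
   weight and touches nothing else. *)
have [|none] := pselect (exists x h1, [/\ h1 < h, supp A (a +h* h1 chi) x &
    T \subset tight A (a +h* h1 chi) x]).
  move=> [x [h1 [h1h sx Tx]]]; pose t := (h - h1) / (h0 - h1).
  have d0 : 0 < h0 - h1 by lra.
  have t0 : 0 < t by rewrite divr_gt0 //; lra.
  have t1 : t < 1 by rewrite ltr_pdivrMr //; lra.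
  have hE : h = h1 + t * (h0 - h1) by rewrite /t divfK ?gt_eqF //; lra.
  have xE i : aff (u i) (t *: x0 + (1 - t) *: x) = t * aff (u i) x0 + (1 - t) * aff (u i) x.
    by rewrite affD !affZ.
  have aE i : a i + h * chi i = t * (a i + h0 * chi i) + (1 - t) * (a i + h1 * chi i).
    by rewrite hE; ring.
  exists (t *: x0 + (1 - t) *: x) => [i iA|].
    rewrite xE aE; apply: lerD; rewrite ler_wpM2l ?subr_ge0 //; do ?exact: ltW.
      exact: sx0.
    exact: sx.
  apply/finset.setP => i; apply/idP/tightP => [iT|[iA]].
    have /tightP[iA xi] := fintype.subsetP Tx _ iT; split=> //.
    by move: iT; rewrite TE => /tightP[_ x0i]; rewrite xE aE xi x0i.
  rewrite xE aE => e; rewrite TE; apply/tightP; split=> //; apply/eqP.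
  rewrite eq_le (sx0 _ iA) /= -(ler_pM2l t0).
  have : (1 - t) * aff (u i) x <= (1 - t) * (a i + h1 * chi i).
    by rewrite ler_wpM2l ?sx //; lra.
  lra.
exfalso.
pose Q (S : {set I}) := exists x h1, [/\ h1 <= h0, supp A (a +h* h1 chi) x,
    T \subset S & S = tight A (a +h* h1 chi) x].
have QT : Q T by exists x0, h0.
have := @finset.maxset_exists I (fun S => `[< Q S >]) T (introT (asboolP _) QT).
move=> [S /finset.maxsetP[/asboolP[x [h1 [h10 sx TS SE]]] mS] _].
have h1h : h <= h1.
  rewrite leNgt; apply/negP => lt; apply: none; exists x, h1; split=> //.
  by rewrite -SE.
have SA : S \subset A by apply/fintype.subsetP => i; rewrite SE => /tightP[].
have [|y yS] := kP S SA a H h1 x H0 aH _ (lt_le_trans kh h1h).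
  by move=> i; rewrite SE => /tightP[].
pose r i := a i + h1 * chi i - aff (u i) x.
have r0 i : i \in A -> 0 <= r i by move=> iA; rewrite subr_ge0 sx.
(* Moving for the full time would bring the height down to [h - 1], which [none] excludes; so a new
   point must become tight on the way. *)
have h1_ge0 : 0 <= h1 - h + 1 by lra.
have [t [/andP[t0 t1] tr tE]] := first_hit (fun i => aff (u i) y + chi i) r0 h1_ge0.
have sx' : supp A (a +h* (h1 - t) chi) (x + t *: y).
  move=> i iA; rewrite affD affZ; have := tr _ iA; rewrite /r; lra.
have SS' : S \subset tight A (a +h* (h1 - t) chi) (x + t *: y).
  apply/fintype.subsetP => i iS; apply/tightP; split; first exact: (fintype.subsetP SA).
  by rewrite affD affZ yS //; move: iS; rewrite SE => /tightP[_ ->]; ring.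
case: tE => [tE|[i iA [di te]]].
  apply: none; exists (x + t *: y), (h1 - t); split=> //; first by rewrite tE; lra.
  exact: fintype.subset_trans SS'.
have iS' : i \in tight A (a +h* (h1 - t) chi) (x + t *: y).
  by apply/tightP; split=> //; rewrite affD affZ; move: te; rewrite /r; lra.
have Q' : Q (tight A (a +h* (h1 - t) chi) (x + t *: y)).
  exists (x + t *: y), (h1 - t); split=> //; first lra.
  exact: fintype.subset_trans SS'.
move: iS'; rewrite (mS _ (introT (asboolP _) Q') SS') => iS.
by move: di; rewrite yS // addNr ltxx.
Qed.

(* The implication from right to left is clear for h large enough; [contact_drop] brings
   h down to a bound in which the heights a only enter through H. *)
Lemma contact_refine A chi : exists2 k, 0 <= k & forall T (a : I -> R) (H h : R), 0 <= H -> bounded_on A a H ->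
  k * H < h -> contact A (a +h* h chi) T <->
    exists2 G, contact A chi G /\ T \subset G & contact G a T.
Proof.
have [k1 k10 k1P] : exists2 k, 0 <= k & forall (T : {set I}) (a : I -> R) (H h : R), 0 <= H -> bounded_on A a H ->
  contact A (a +h* h chi) T -> k * H < h ->
  exists2 y, supp A chi y & T \subset tight A chi y.
  apply: uniform_bound => [T k k' kk' h a H h0 H0 aH cT kh|T].
    by apply: h aH cT _ => //; apply: le_lt_trans kh; rewrite ler_wpM2r.
  by have [k k0 kP] := recession A T chi; exists k => // a H h H0; apply: kP.
have [k2 k20 k2P] := contact_drop A chi.
exists (k1 + k2) => [|T a H h H0 aH]; first exact: addr_ge0.
rewrite mulrDl => kh.
have kh1 : k1 * H < h by apply: le_lt_trans kh; rewrite lerDl mulr_ge0.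
have kh2 : k2 * H < h by apply: le_lt_trans kh; rewrite lerDr mulr_ge0.
have h0 : 0 < h by apply: le_lt_trans kh1; rewrite mulr_ge0.
split=> [cT|[G [[y sy GE] TG] [x sx TE]]].
  have [y sy Ty] := k1P _ _ _ _ H0 aH cT kh1.
  exists (tight A chi y); first by split=> //; exists y.
  have [x sx TE] := cT; exists (x - h *: y) => [i /tightP[iA yi]|].
    by rewrite affD affN affZ yi; have /= := sx _ iA; lra.
  apply/finset.setP => i; apply/idP/tightP => [iT|[/tightP[iA yi]]].
    have iG := fintype.subsetP Ty _ iT; split=> //; have /tightP[iA yi] := iG.
    by move: iT; rewrite TE => /tightP[_ xi]; rewrite affD affN affZ xi yi; ring.
  rewrite affD affN affZ yi => e; rewrite TE; apply/tightP; split=> //; lra.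
have r0 i : i \in A :\: G -> 0 < chi i - aff (u i) y.
  rewrite finset.inE => /andP[iG iA]; rewrite subr_gt0 lt_neqAle sy // andbT.
  by apply: contra iG => yi; rewrite GE finset.inE iA.
have [e e0 eP] := small_positive (fun i => aff (u i) x - a i) r0.
have e10 : 0 < e^-1 by rewrite invr_gt0.
(* The extra height [e^-1] lifts the points outside [G] strictly above the functional [x + h1 *: y];
   it depends on [a] and [x]. *)
pose h1 := h + e^-1.
have lt i : i \in A -> i \notin G -> aff (u i) (x + h1 *: y) < a i + h1 * chi i.
  move=> iA iG; have := eP i; rewrite finset.inE iG iA => /(_ isT).
  rewrite mulrC -ltr_pdivlMr // affD affZ => lt.
  have := sy _ iA; rewrite /h1; nra.
apply: (k2P T a H h h1 aH kh2); first by rewrite /h1 lerDl ltW.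
exists (x + h1 *: y) => [i iA|].
  have [iG|/(lt _ iA)/ltW//] := boolP (i \in G).
  by have := sx _ iG; move: iG; rewrite GE => /tightP[_ yi]; rewrite affD affZ yi; lra.
apply/finset.setP => i; apply/idP/tightP => [iT|[iA xi]].
  have iG := fintype.subsetP TG _ iT; move: iT (iG); rewrite TE GE => /tightP[_ xi] /tightP[iA yi].
  by rewrite affD affZ xi yi.
have iG : i \in G by apply: contraLR (eqxx (a i + h1 * chi i)) => /(lt _ iA); rewrite xi ltxx.
rewrite TE; apply/tightP; split=> //; move: iG xi; rewrite GE => /tightP[_ yi].
by rewrite affD affZ yi => /addIr.
Qed.

Definition growing n (k : R) (M : nat -> R) :=
  (forall s, (s < n)%N -> 0 < M s) /\ (forall s, (s.+1 < n)%N -> k * M s < M s.+1).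

Definition heights (chi : nat -> I -> R) (M : nat -> R) n i := \sum_(s < n) M s * chi s i.

Lemma growingS n n' k k' M : (n' <= n)%N -> k' <= k -> growing n k M -> growing n' k' M.
Proof.
move=> nn kk [M0 Mk]; split=> s sn; first by apply: M0; lia.
apply: le_lt_trans (Mk s _); last by lia.
by rewrite ler_wpM2r // ltW // M0 //; lia.
Qed.

Lemma growing_le n k M s t : 1 <= k -> growing n k M -> (s <= t < n)%N -> M s <= M t.
Proof.
move=> k1 [M0 Mk]; elim: t => [|t IHt] /andP[st tn]; first by have -> : s = 0%N by lia.
move: st; rewrite leq_eqVlt => /predU1P[->//|st].
apply: le_trans (IHt _) _; first by rewrite -ltnS st /=; lia.
apply: ltW; apply: le_lt_trans (Mk _ tn).
by rewrite ler_peMl // ltW // M0 //; lia.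
Qed.

(* The subdivision for chi (n-1) is refined inside each of its cells by the one for
   chi (n-2), and so on. *)
Lemma growing_contact (chi : nat -> I -> R) N : exists2 k, 1 <= k &
  forall n M M' A T, (n <= N)%N -> growing n k M -> growing n k M' ->
    contact A (heights chi M n) T -> contact A (heights chi M' n) T.
Proof.
elim: N => [|N [k k1 kP]].
  exists 1 => // n M M' A T; rewrite leqn0 => /eqP -> _ _.
  by apply: eq_contact => i _; rewrite /heights !big_ord0.
(* The constant is uniform in the set because the induction continues inside the contact set [G] of
   [chi N]. *)
have [k' k'0 k'P] : exists2 k, 0 <= k & forall (A : {set I}) T (a : I -> R) (H h : R), 0 <= H -> bounded_on A a H ->
  k * H < h -> contact A (a +h* h (chi N)) T <->
    exists2 G, contact A (chi N) G /\ T \subset G & contact G a T.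
  apply: uniform_bound => [A k2 k2' kk' h T a H h0 H0 aH kh|A]; last exact: contact_refine.
  by have := h T a H h0 H0 aH (le_lt_trans (ler_wpM2r H0 kk') kh).
(* The heights made of the first [N] terms are bounded by [c0] times the last coefficient among
   them. The ratio [k' * c0] therefore makes the next coefficient dominate them, and the summand [k]
   serves the induction hypothesis. *)
pose c0 := \sum_(s < N) \sum_i `|chi s i|.
have c00 : 0 <= c0 by apply: sumr_ge0 => s _; apply: sumr_ge0.
have k'c0 := mulr_ge0 k'0 c00.
have kk : k <= k + k' * c0 by rewrite lerDl.
exists (k + k' * c0); first by apply: le_trans kk.
move=> n M M' A T; rewrite leq_eqVlt => /predU1P[->|nN gM gM']; last first.
  by rewrite ltnS in nN; exact: kP nN (growingS (leqnn n) kk gM) (growingS (leqnn n) kk gM').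
suff main L : growing N.+1 (k + k' * c0) L -> contact A (heights chi L N.+1) T <->
    exists2 G, contact A (chi N) G /\ T \subset G & contact G (heights chi L N) T.
  move=> gM gM' /(main _ gM)[G GA cG]; apply/(main _ gM'); exists G => //.
  exact: kP (leqnn N) (growingS (leqnSn N) kk gM) (growingS (leqnSn N) kk gM') cG.
move=> gL.
have [Lp Lk] := gL.
have k'1 : 1 <= k + k' * c0 by apply: le_trans kk.
pose H := c0 * L N.-1.
have L0 : 0 < L N.-1 by apply: Lp; lia.
have H0 : 0 <= H by apply: mulr_ge0 => //; apply: ltW.
have lH : bounded_on A (heights chi L N) H.
  move=> i _; apply: le_trans (ler_norm_sum _ _ _) _; rewrite /H mulr_suml.
  apply: ler_sum => s _; rewrite normrM mulrC.
  have sN := ltn_ord s.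
  have Ls : 0 < L s by apply: Lp; lia.
  apply: ler_pM => //; first by rewrite (bigD1 i) //= lerDl sumr_ge0.
  by rewrite gtr0_norm //; apply: (growing_le k'1 gL); lia.
have kH : k' * H < L N.
  (* For [N = 0] the predecessor [N.-1] is again [0]; then [c0] is an empty sum and the bound is
     zero. *)
  rewrite /H mulrA; have [N0|N0] := posnP N.
    by rewrite /c0 N0 big_ord0 mulr0 mul0r Lp.
  apply: (@le_lt_trans _ _ ((k + k' * c0) * L N.-1)).
    by rewrite ler_wpM2r ?lerDr ?ltW // (lt_le_trans ltr01).
  by have := Lk N.-1; rewrite prednK //; apply.
have := k'P A T _ _ _ H0 lH kH; rewrite (_ : (fun i => _) = heights chi L N.+1) //.
by apply/funext => i; rewrite /heights big_ord_recr.
Qed.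

End DominatingHeights.

(** * Extensions obtained by raising the last coefficient *)

Section Extensions.
Variables (R : realType) (I : finType) (w : I -> 'rV[int]_3).
Local Notation u := (fun i => toR R (w i)).
Local Notation point := 'rV[R]_3.
Implicit Types (A B E T : {set I}) (M : nat -> R).
Local Notation conv A := (convex_hull (u @` [set` A])).
Local Notation contact := (contact u).

Lemma direction_conv T i0 (X : seq point) : i0 \in T ->
  (forall i, i \in T -> u i - u i0 \in <<X>>%VS) ->
  (forall x, x \in X -> exists2 i, i \in T & x = u i - u i0) ->
  direction (conv T) <<X>>%VS.
Proof.
move=> i0T TX XT U; split=> [h|/subvP XU p q].
  apply/span_subvP => x /XT[i iT ->]; apply: h; exact: conv_mem.
have base r : conv T r -> r - u i0 \in U.
  move=> /convex_hullP[l [l0 lT l1] ->].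
  have -> : \sum_i l i *: u i - u i0 = \sum_i l i *: (u i - u i0).
    under [RHS]eq_bigr do rewrite scalerBr.
    by rewrite sumrB -scaler_suml l1 scale1r.
  apply: memv_suml => i _; have [iT|/lT ->] := boolP (i \in T).
    by apply: memvZ; apply: XU; apply: TX.
  by rewrite scale0r mem0v.
move=> Tp Tq; have -> : p - q = (p - u i0) - (q - u i0) by rewrite opprB addrA subrK.
by rewrite memvB // base.
Qed.

Lemma convex_hull_sub A (S : set point) : S `<=` conv A -> convex_hull S `<=` conv A.
Proof.
move=> SA p [n [y [l [Sy l0 l1 ->]]]].
have /choice[m mP] : forall j, exists m : I -> R, weights A m /\ y j = \sum_i m i *: u i.
  by move=> j; have /convex_hullP[m mA ->] := SA _ (Sy j); exists m.
apply/convex_hullP; exists (fun i => \sum_j l j * m j i).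
  split=> [i|i iA|].
  - by apply: sumr_ge0 => j _; have [[m0 _ _] _] := mP j; rewrite mulr_ge0.
  - by apply: big1 => j _; have [[_ mA _] _] := mP j; rewrite mA // mulr0.
  - rewrite exchange_big -l1; apply: eq_bigr => j _.
    by have [[_ _ m1] _] := mP j; rewrite -mulr_sumr m1 mulr1.
under [RHS]eq_bigr do rewrite scaler_suml.
rewrite exchange_big; apply: eq_bigr => j _ /=; have [_ ->] := mP j.
by rewrite scaler_sumr; apply: eq_bigr => i _; rewrite scalerA.
Qed.

Lemma convex_hullS (E : lmodType R) (S S' : set E) : S `<=` S' -> convex_hull S `<=` convex_hull S'.
Proof. by move=> SS p [n [y [l [Sy l0 l1 ->]]]]; exists n, y, l; split=> // i; apply: SS. Qed.

Lemma convex_hullU A B : convex_hull (conv A `|` conv B) = conv (A :|: B)%SET.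
Proof.
apply/seteqP; split.
  by apply: convex_hull_sub => p []; apply: convS; rewrite ?finset.subsetUl ?finset.subsetUr.
apply: convex_hullS => p [i iAB <-]; move: iAB => /=; rewrite finset.in_setU => /orP[iA|iB].
  by left; apply: conv_mem.
by right; apply: conv_mem.
Qed.

Variables (chi : nat -> I -> R) (N : nat) (k : R).
Hypothesis kP : forall n M M' A T, (n <= N)%N -> growing n k M -> growing n k M' ->
    contact A (heights chi M n) T -> contact A (heights chi M' n) T.

Lemma heights_le M m n A : (n <= m)%N ->
  (forall s i, (n <= s)%N -> i \in A -> chi s i = 0) ->
  {in A, heights chi M m =1 heights chi M n}.
Proof.
move=> nm chi0 i iA; rewrite -(subnKC nm) /heights big_split_ord /= [X in _ + X]big1 ?addr0 //.
by move=> s _; rewrite chi0 ?mulr0 // leq_addr.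
Qed.

Definition raise n (t : R) M s := if s == n then M s + t else M s.

Lemma heights_raise n t M i :
  heights chi (raise n t M) n.+1 i = heights chi M n.+1 i + t * chi n i.
Proof.
rewrite /heights !big_ord_recr /= /raise eqxx mulrDl addrA; congr (_ + _ + _).
by apply: eq_bigr => s _; rewrite ltn_eqF.
Qed.

Lemma growing_raise n t M : 0 <= t -> growing n.+1 k M -> growing n.+1 k (raise n t M).
Proof.
move=> t0 [M0 Mk]; split=> s sn; rewrite /raise.
  by case: eqP => _; [apply: ltr_wpDr => //|]; apply: M0.
rewrite ltn_eqF //; case: eqP => _; last exact: Mk.
by apply: ltr_wpDr => //; apply: Mk.
Qed.

Variables (e : R) (n : nat) (M : nat -> R) (A Z : {set I}) (D : R).
Local Notation ht M := (fun i => e + heights chi M n.+1 i).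
Hypothesis nN : (n < N)%N.
Hypothesis gM : growing n.+1 k M.
Hypothesis chiA : forall i, i \in A -> chi n i = 0.
Hypothesis chiZ : forall i, i \in Z -> chi n i = D.
Hypothesis D0 : 0 < D.

Lemma contact_indep M' B T : growing n.+1 k M' -> contact B (ht M) T -> contact B (ht M') T.
Proof.
move=> gM' /(@contact_cst _ _ _ _ _ _ (- e)) cT; apply: contact_cst.
by apply: (kP nN gM gM'); apply: eq_contact cT => i _; rewrite addKr.
Qed.

(** Here [A] holds the old points and [Z] the new ones: raising the coefficient [M n] by [t] fixes
    the heights on [A] and adds [t * D] on [Z]. Once [Z] is above the functional [x], the set [T] is
    in contact for the union, and independence of the coefficients brings this back to [M]. *)
Lemma contact_persist T : contact A (ht M) T -> contact (A :|: Z)%SET (ht M) T.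
Proof.
move=> cT; have [x sx TE] := cT.
have r0 i : i \in Z -> 0 < D by [].
have [q q0 qP] := small_positive (fun i => aff (u i) x - (e + heights chi M n.+1 i)) r0.
have gM' : growing n.+1 k (raise n q^-1 M) by apply: growing_raise => //; rewrite invr_ge0 ltW.
suff cT' : contact (A :|: Z)%SET (ht (raise n q^-1 M)) T.
  apply: contact_cst; apply: (kP nN gM' gM).
  by move: cT' => /(@contact_cst _ _ _ _ _ _ (- e)); apply: eq_contact => i _; rewrite addKr.
have eA i : i \in A -> heights chi (raise n q^-1 M) n.+1 i = heights chi M n.+1 i.
  by move=> iA; rewrite heights_raise chiA // mulr0 addr0.
have lt i : i \in Z -> aff (u i) x < e + heights chi (raise n q^-1 M) n.+1 i.
  by move=> iZ; have := qP _ iZ; rewrite -ltr_pdivlMl // heights_raise chiZ //; lra.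
exists x => [i|].
  by rewrite finset.in_setU => /orP[iA|/lt/ltW//]; rewrite eA // sx.
apply/finset.setP => i; rewrite TE !finset.inE.
have [iA|iA] := boolP (i \in A); first by rewrite /= eA.
by have [/lt/lt_eqF ->|] := boolP (i \in Z).
Qed.

Variables (T0 : {set I}) (nu' : point -> R).
Local Notation E := (T0 :&: A)%SET.
Hypothesis winj : injective w.
Hypothesis cT0 : contact (A :|: Z)%SET (ht M) T0.
Hypothesis ZT0 : Z \subset T0.
Hypothesis E0 : E != finset.set0.
Hypothesis nuE : forall p, conv A p -> nu' p = lower_hull u A (ht M) p.
Hypothesis codim1 : exists U W, [/\ direction (conv E) U, direction (conv T0) W &
  \dim W = (\dim U).+1].

Lemma uinj : injective u.
Proof.
move=> i j ij; apply: winj; apply/rowP => s.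
have := congr1 (fun p : point => p 0 s) ij; rewrite !mxE => /eqP.
by rewrite eqr_int => /eqP.
Qed.

Lemma conv_set1 T p i : conv T = [set p] -> i \in T -> T = [set i]%SET /\ p = u i.
Proof.
move=> Tp iT; have up j : j \in T -> u j = p by move=> /(conv_mem u); rewrite Tp.
split; last by rewrite up.
apply/finset.setP => j; rewrite finset.inE; apply/idP/eqP => [jT|->//].
by apply: uinj; rewrite !up.
Qed.

(** A common point lies in an old cell [conv T], which persists in the union. Its weights on [T0]
    are optimal for the union, hence supported in [T], which is part of [A]. *)
Lemma conv_contact_cap : conv A `&` conv T0 = conv E.
Proof.
apply/seteqP; split=> [p [Ap T0p]|p Ep]; last first.
  by split; apply: convS Ep; rewrite ?finset.subsetIl ?finset.subsetIr.
have [T cT Tp] := contact_conv (ht M) Ap.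
have cT' := contact_persist cT.
have /convex_hullP[l lT0 pE] := T0p; move: Tp; rewrite pE => Tp.
have lB : weights (A :|: Z)%SET l := weightsS (contact_sub cT0) lT0.
have [l0 lT l1] := weights_contact cT' lB Tp (lower_hull_weights cT0 lT0).
apply/convex_hullP; exists l => //; split=> // i iE.
have [_ lT0' _] := lT0; have [iT|/lT//] := boolP (i \in T).
apply: lT0'; apply: contra iE => iT0; rewrite finset.inE iT0.
exact: (fintype.subsetP (contact_sub cT)).
Qed.

(** A point of [conv T0] outside [conv A] carries a positive weight [S] on [Z]. Raising the last
    coefficient by [t] raises the lower hull at this point by [t * D * S], so every value [h] above
    the present one is attained, with unchanged contact sets. *)
Lemma extension_cells :
  extension (conv A) nu' (cells u A (ht M)) (conv T0) (cells u (A :|: Z)%SET (ht M)).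
Proof.
have [i0 i0E] := finset.set0Pn _ E0; move: (i0E); rewrite finset.inE => /andP[i0T0 i0A].
have A0 : A != finset.set0 by apply/finset.set0Pn; exists i0.
have T00 : T0 != finset.set0 by apply/finset.set0Pn; exists i0.
have B0 : (A :|: Z)%SET != finset.set0 by apply/finset.set0Pn; exists i0; rewrite finset.inE i0A.
have uw i : u i = toR R (w i) by [].
have BE : (A :|: T0)%SET = (A :|: Z)%SET.
  apply/eqP; rewrite finset.eqEsubset; apply/andP; split.
    by rewrite finset.subUset finset.subsetUl (contact_sub cT0).
  by rewrite finset.setUS.
have cE : contact A (ht M) E := contact_restr (finset.subsetUl A Z) cT0.
split; [exact: conv_lattice_polytope uw A0|exact: (lower_hull_convex_pl nuE A0 uw)| |].
  by rewrite (subdivisionE nuE A0).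
rewrite convex_hullU BE conv_contact_cap; split.
- exact: conv_lattice_polytope uw T00.
- by exists E.
- split=> //; apply: contact_face (contact_persist cE) cT0 _ E0.
  exact: finset.subsetIl.
move=> w0 [/convex_hullP[l lT0 pE] nA]; rewrite pE in nA *.
have [l0 lT01 l1] := lT0.
pose S := \sum_(i in Z) l i.
have S0 : 0 < S.
  rewrite lt_neqAle sumr_ge0 // andbT; apply/negP => /eqP S0.
  apply: nA; apply/convex_hullP; exists l => //; split=> // i iA.
  have [iT0|/lT01 //] := boolP (i \in T0).
  have := fintype.subsetP (contact_sub cT0) _ iT0; rewrite finset.inE (negPf iA) /= => iZ.
  apply/eqP; rewrite eq_le l0 andbT; rewrite S0 /S (bigD1 i) //= lerDl.
  by apply: sumr_ge0.
exists (lower_hull u (A :|: Z)%SET (ht M) (\sum_i l i *: u i)) => h h0h.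
pose t := (h - lower_hull u (A :|: Z)%SET (ht M) (\sum_i l i *: u i)) / (D * S).
have DS : 0 < D * S by apply: mulr_gt0.
have t0 : 0 <= t by rewrite divr_ge0 ?subr_ge0 // ltW.
have gM' := growing_raise t0 gM.
have cells_eq : cells u (A :|: Z)%SET (ht M) = cells u (A :|: Z)%SET (ht (raise n t M)).
  apply/seteqP; split=> _ [T [cT T'0] <-]; exists T => //; split=> //.
    exact: contact_indep cT.
  apply: contact_cst; apply: (kP nN gM' gM).
  by move: cT => /(@contact_cst _ _ _ _ _ _ (- e)); apply: eq_contact => i _; rewrite addKr.
exists (lower_hull u (A :|: Z)%SET (ht (raise n t M))); split.
- exact: (lower_hull_convex_pl (fun _ _ => erefl) B0 uw).
- move=> p Ap; rewrite nuE //; have [T cT /convex_hullP[m mT ->]] := contact_conv (ht M) Ap.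
  rewrite (lower_hull_weights cT mT).
  rewrite (lower_hull_weights (contact_indep gM' (contact_persist cT)) mT).
  apply: eq_bigr => i _; have [_ mT0 _] := mT.
  have [iT|/mT0 ->] := boolP (i \in T); last by rewrite !mul0r.
  by rewrite heights_raise chiA ?mulr0 ?addr0 //; apply: (fintype.subsetP (contact_sub cT)).
- rewrite (lower_hull_weights (contact_indep gM' cT0) lT0).
  have -> : \sum_i l i * (e + heights chi (raise n t M) n.+1 i) =
      \sum_i l i * (e + heights chi M n.+1 i) + t * (D * S).
    have -> : t * (D * S) = \sum_i l i * (t * chi n i).
      rewrite /S !mulr_sumr [RHS](bigID (fun i => i \in Z)) /= [X in _ = _ + X]big1 ?addr0.
        by apply: eq_bigr => i iZ; rewrite chiZ //; ring.
      move=> i iZ; have [iT0|/lT01 ->] := boolP (i \in T0); last by rewrite mul0r.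
      have := fintype.subsetP (contact_sub cT0) _ iT0; rewrite finset.inE (negPf iZ) orbF => iA.
      by rewrite chiA // !mulr0.
    rewrite -big_split; apply: eq_bigr => i _ /=; rewrite heights_raise; ring.
  rewrite -(lower_hull_weights cT0 lT0) /t divfK ?gt_eqF //; ring.
- by rewrite cells_eq (subdivisionE (fun _ _ => erefl) B0).
split; first by exists T0.
move=> p; split=> [[T [cT T'0] Tp]|[[T [cT T'0] Tp]|/(face_contact cT0)[T cT [_ T'0 ->]]]].
- have [i iT] := finset.set0Pn _ T'0; have [TE pi] := conv_set1 Tp iT.
  have [iA|iA] := boolP (i \in A).
    left; exists T => //; split=> //.
    have := contact_restr (finset.subsetUl A Z) cT; suff -> : (T :&: A)%SET = T by [].
    by apply/finset.setIidPl; rewrite TE finset.sub1set.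
  right; rewrite -Tp; apply: (contact_face cT cT0 _ T'0).
  rewrite TE finset.sub1set; apply: (fintype.subsetP ZT0).
  by have := fintype.subsetP (contact_sub cT) _ iT; rewrite finset.inE (negPf iA).
- by exists T => //; split=> //; apply: contact_persist.
- by exists T.
Qed.

End Extensions.

(** * Heights along the lattice path *)

Section PathHeights.
Variables (R : realType) (N : nat) (w : 'I_N.+2 -> 'rV[int]_3) (v : 'rV[rat]_3).
Local Notation I := 'I_N.+2.
Local Notation u := (fun i => toR R (w i)).
Local Notation vR := (map_mx ratr v : 'rV[R]_3).
Local Notation conv A := (convex_hull (u @` [set` A])).
Local Notation contact := (contact u).

Definition level (i : I) : R := dotp (u i) vR.
Hypothesis level_inc : forall i j : I, (i < j)%N -> level i < level j.

Lemma level_inj : injective level.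
Proof.
move=> i j ij; apply: val_inj; case: (ltngtP i j) => // /level_inc; rewrite ij ltxx //.
Qed.

Lemma w_inj : injective w.
Proof. by move=> i j ij; apply: level_inj; rewrite /level ij. Qed.

Variable k : I.

(** [bump] and [unbump] skip [k], so the vertices of the path are numbered from [0] to [N] without a
    gap; the rank is meant for indices other than [k]. *)
Definition path_vertex (m : nat) : I := inord (bump k m).
Definition path_rank (i : I) : nat := unbump k i.

Lemma val_path_vertex m : (m <= N)%N -> path_vertex m = bump k m :> nat.
Proof. by move=> mN; rewrite /path_vertex inordK // /bump; lia. Qed.

Lemma path_vertex_neq m : (m <= N)%N -> path_vertex m != k.
Proof. by move=> mN; apply/eqP => /(congr1 val) /=; rewrite val_path_vertex // /bump; lia. Qed.

Lemma path_rank_le i : i != k -> (path_rank i <= N)%N.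
Proof.
move=> ik; have ik' : i <> k :> nat by move=> /val_inj /eqP; apply/negP.
by rewrite /path_rank /unbump; have := ltn_ord i; have := ltn_ord k; lia.
Qed.

Lemma path_rankK i : i != k -> path_vertex (path_rank i) = i.
Proof.
move=> ik; apply: val_inj; have ik' : i <> k :> nat by move=> /val_inj /eqP; apply/negP.
by rewrite /= val_path_vertex ?path_rank_le // /path_rank /unbump /bump; lia.
Qed.

Lemma path_vertexK m : (m <= N)%N -> path_rank (path_vertex m) = m.
Proof. by move=> mN; rewrite /path_rank val_path_vertex // /unbump /bump; lia. Qed.

Lemma path_rank_lt i j : i != k -> j != k -> (path_rank i < path_rank j)%N = (i < j)%N.
Proof.
move=> ik jk; have ik' : i <> k :> nat by move=> /val_inj /eqP; apply/negP.
have jk' : j <> k :> nat by move=> /val_inj /eqP; apply/negP.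
rewrite /path_rank /unbump; lia.
Qed.

Definition gap s := level (path_vertex s.+1) - level (path_vertex s).
(** The height of the path vertex of rank [m] relative to the first one: [M s] is the slope, with
    respect to the level, of the edge number [s]. *)
Definition profile (M : nat -> R) m := \sum_(s < m) M s * gap s.

Lemma gap_gt0 s : (s < N)%N -> 0 < gap s.
Proof.
by move=> sN; rewrite subr_gt0; apply: level_inc; rewrite !val_path_vertex ?(ltnW sN) // /bump; lia.
Qed.

Definition step s (i : I) := if (s < path_rank i)%N then gap s else 0.

(* Heights of the path vertices, extended to [k] by the parallelogram relation
   [w k + w j = w l + w i]. *)
Definition chi (i j l : I) s x := if x == k then step s l + step s i - step s j else step s x.

Lemma chi0 i j l s x : x != k -> (path_rank x <= s)%N -> chi i j l s x = 0.
Proof. by move=> xk xs; rewrite /chi (negPf xk) /step ltnNge xs. Qed.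

Lemma chi0k i j l s : (path_rank i <= s)%N -> (path_rank j <= s)%N -> (path_rank l <= s)%N -> chi i j l s k = 0.
Proof. by move=> is_ js ls; rewrite /chi eqxx /step !ltnNge is_ js ls /= subr0 addr0. Qed.

Lemma heights_path i j l M n x : x != k -> (path_rank x <= n)%N ->
  heights (chi i j l) M n x = profile M (path_rank x).
Proof.
move=> xk xn; rewrite (heights_le _ xn (A := [set x]%SET)) ?finset.inE //.
  apply: eq_bigr => s _; rewrite /chi (negPf xk) /step ltn_ord //.
by move=> s y xs /finset.set1P ->; apply: chi0.
Qed.

Lemma heights_k i j l M n : i != k -> j != k -> l != k ->
  heights (chi i j l) M n k = heights (chi i j l) M n l + heights (chi i j l) M n i
    - heights (chi i j l) M n j.
Proof.
move=> ik jk lk; rewrite -big_split -sumrB; apply: eq_bigr => s _ /=.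
by rewrite /chi eqxx (negPf ik) (negPf jk) (negPf lk); ring.
Qed.

Variable M : nat -> R.
Hypothesis gM : growing N 1 M.

Lemma M_lt s t : (s < t < N)%N -> M s < M t.
Proof.
move=> /andP[st tN]; have [_ Mk] := gM.
apply: (@lt_le_trans _ _ (M s.+1)); first by rewrite -[M s]mul1r; apply: Mk; lia.
by apply: growing_le gM _ => //; lia.
Qed.

(** The profile after subtraction of the slope [t]. Its increments have the signs of [M m - t], so
    for [t = M s] it decreases up to rank [s], is flat until [s.+1] and increases afterwards. All
    comparisons of heights below come from this. *)
Definition tilt t m := profile M m - t * level (path_vertex m).

Lemma tiltS t m : tilt t m.+1 = tilt t m + (M m - t) * gap m.
Proof. by rewrite /tilt /profile big_ord_recr /= /gap; ring. Qed.

Lemma tilt_dec s m m' : (s < N)%N -> (m < m' <= s)%N -> tilt (M s) m' < tilt (M s) m.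
Proof.
move=> sN; elim: m' => // m' IHm /andP[]; rewrite ltnS leq_eqVlt => mm' m's.
have lt : tilt (M s) m'.+1 < tilt (M s) m'.
  rewrite tiltS gtrDl pmulr_llt0 ?gap_gt0 ?subr_lt0 ?M_lt ?m's //; lia.
case/predU1P: mm' => [->//|mm']; apply: lt_trans lt _; apply: IHm; lia.
Qed.

Lemma tilt_inc s m m' : (s < m < m')%N -> (m' <= N)%N -> tilt (M s) m < tilt (M s) m'.
Proof.
elim: m' => // [|m' IHm] /andP[sm]; first by [].
rewrite ltnS leq_eqVlt => mm' m'N.
have lt : tilt (M s) m' < tilt (M s) m'.+1.
  rewrite tiltS ltrDl mulr_gt0 ?gap_gt0 ?subr_gt0 ?M_lt //; case/predU1P: mm' => ?; lia.
case/predU1P: mm' => [->//|mm']; apply: lt_trans lt; apply: IHm; lia.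
Qed.

Lemma tilt_eq s : tilt (M s) s.+1 = tilt (M s) s.
Proof. by rewrite tiltS subrr mul0r addr0. Qed.

Lemma tilt_min s m : (s < N)%N -> (m <= N)%N -> m != s -> m != s.+1 ->
  tilt (M s) s < tilt (M s) m.
Proof.
move=> sN mN ms ms'; have [lt|ge] := ltnP m s; first by apply: tilt_dec => //; lia.
by rewrite -tilt_eq; apply: tilt_inc => //; lia.
Qed.

End PathHeights.

(** * Reading the heights off the path of a surface *)

Section SurfaceHeights.
Variables (R : realType) (N : nat) (Delta : set 'rV[R]_3).
Variables (w : 'I_N.+2 -> 'rV[int]_3) (v : 'rV[rat]_3).
Local Notation I := 'I_N.+2.
Local Notation u := (fun i => toR R (w i)).
Local Notation conv A := (convex_hull (u @` [set` A])).
Local Notation level := (level R w v).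
Hypothesis level_inc : forall i j : I, (i < j)%N -> level i < level j.

Lemma maximal_termsP (c : I -> R) X i :
  maximal_terms w c X i <-> forall j, c j + dotp (u j) X <= c i + dotp (u i) X.
Proof.
rewrite /maximal_terms /= /trop_surface /trop_poly; split=> [e j|h].
  by rewrite -lee_fin e !EFinD; apply: (le_bigmax_cond -oo%E).
apply/eqP; rewrite eq_le; apply/andP; split.
  by rewrite EFinD; apply: (le_bigmax_cond -oo%E (fun i => (c i)%:E + (dotp (u i) X)%:E)%E).
by apply: bigmax_le => [|j _]; rewrite ?leNye // -EFinD lee_fin.
Qed.

Lemma conv_pair i j : convex_hull [set u i; u j] = conv [set i; j]%SET.
Proof.
congr convex_hull; apply/seteqP; split=> [_ [->|->]|_ [x + <-]].
- by exists i => //=; apply: finset.set21.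
- by exists j => //=; apply: finset.set22.
by move=> /= /finset.set2P[] ->; [left|right].
Qed.

(** Equal hulls need not come from equal index sets, but an exposed point belongs to every
    generating set: weights on [T] representing [u i] sit on maximizers of [X], and such a
    maximizer, written with weights on [T'], is [u i] itself. Levels then identify the index. *)
Lemma exposed_mem (T T' : {set I}) i X : conv T = conv T' -> i \in T' ->
  (forall j, j \in T' -> j != i -> dotp (u j) X < dotp (u i) X) -> i \in T.
Proof.
move=> TT' iT' im.
have [l lT uE] : exists2 l, weights T l & u i = \sum_j l j *: u j.
  by apply/convex_hullP; rewrite TT'; apply: conv_mem.
have le j : j \in T' -> dotp (u j) X <= dotp (u i) X.
  by move=> jT'; have [->//|/(im _ jT')/ltW] := eqVneq j i.
have l1 : weights [set j in T | dotp (u j) X == dotp (u i) X]%SET l.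
  apply: (weights_eq (b := fun j => dotp (u j) X) (c := fun=> dotp (u i) X) lT).
  - move=> j jT; have : conv T' (u j) by rewrite -TT'; apply: conv_mem.
    move=> /convex_hullP[m [m0 mT m1] ->]; rewrite dotp_suml.
    rewrite -[leRHS]mul1r -m1 mulr_suml; apply: ler_sum => y _.
    by have [/le h|/mT ->] := boolP (y \in T'); [rewrite ler_wpM2l|rewrite !mul0r].
  - by move=> j jT e; rewrite finset.inE jT e eqxx.
  - by have [_ _ l1] := lT; rewrite -mulr_suml l1 mul1r -dotp_suml -uE.
have [j + _] := weights_gt0 l1; rewrite finset.inE => /andP[jT /eqP e].
have : conv T' (u j) by rewrite -TT'; apply: conv_mem.
move=> /convex_hullP[m mT' ujE].
have mi : weights [set i]%SET m.
  apply: (weights_eq (b := fun j => dotp (u j) X) (c := fun=> dotp (u i) X) mT') => //.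
    by move=> y yT' ye; rewrite finset.inE; apply/negPn/negP => /(im _ yT'); rewrite ye ltxx.
  by have [_ _ m1] := mT'; rewrite -mulr_suml m1 mul1r -dotp_suml -ujE e.
have : conv [set i]%SET (u j) by apply/convex_hullP; exists m.
rewrite (conv1 u) => uji; suff <- : j = i by [].
apply: (@level_inj _ _ w v level_inc); by rewrite /level uji.
Qed.

Lemma enum_neq (k : I) : [seq i <- enum I | i != k] = [seq path_vertex k m | m <- iota 0 N.+1].
Proof.
pose r := [rel i j : I | (i < j)%N].
have rt : transitive r by move=> y x z; apply: ltn_trans.
have ri : irreflexive r by move=> x; apply: ltnn.
apply: (irr_sorted_eq rt ri).
- apply: sorted_filter => //.
  by have := iota_ltn_sorted 0 N.+2; rewrite -val_enum_ord sorted_map.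
- apply: (@homo_sorted_in _ _ [pred m | (m <= N)%N] _ ltn); last exact: iota_ltn_sorted.
    by move=> m m' /= mN m'N mm'; rewrite /r /= !val_path_vertex // /bump; move: mm'; rewrite /= /ltn /=; lia.
  by apply/seq.allP => m; rewrite mem_iota /=; lia.
move=> i; rewrite mem_filter mem_enum andbT; apply/idP/mapP => [ik|[m]].
  by exists (path_rank k i); rewrite ?path_rankK // mem_iota; have := path_rank_le ik; lia.
by rewrite mem_iota => mN ->; apply: path_vertex_neq; lia.
Qed.

Lemma strict_mono_id (f : nat -> nat) n : (forall m, (m < n)%N -> (f m < n)%N) ->
  (forall m m', (m < m' < n)%N -> (f m < f m')%N) -> forall m, (m < n)%N -> f m = m.
Proof.
move=> fn fm.
have ge m : (m < n)%N -> (m <= f m)%N.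
  elim: m => // m IHm mn; have := fm m m.+1; have := IHm (ltnW mn); lia.
have up d m : (m + d < n)%N -> (f m + d <= f (m + d))%N.
  elim: d => [|d IHd]; first by rewrite !addn0.
  by move=> mdn; have := fm (m + d)%N (m + d.+1)%N; have := IHd; lia.
by move=> m mn; have := ge _ mn; have := up (n.-1 - m)%N m; have := fn n.-1;
   rewrite subnKC; lia.
Qed.

Definition real_growth (M : 'I_N -> rat) (s : nat) : R :=
  if insub s is Some m then ratr (M m) else 0.

Lemma growthP (kappa : rat) M : 0 < kappa -> growth kappa M -> growing N (ratr kappa) (real_growth M).
Proof.
move=> k0 [g0 gs].
have sE s (sN : (s < N)%N) : real_growth M s = ratr (M (Ordinal sN)) by rewrite /real_growth insubT.
have M_gt0 s (sN : (s < N)%N) : 0 < M (Ordinal sN).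
  elim: s sN => [|s IHs] sN; first by apply: lt_trans (g0 (Ordinal sN) _).
  have Ms := IHs (ltnW sN); have := gs (Ordinal (ltnW sN)) (Ordinal sN) erefl.
  by rewrite ltr_pdivlMr //; apply: lt_trans; rewrite mulr_gt0.
split=> s sN; first by rewrite sE ltr0q.
rewrite !sE ?(ltnW sN) // => sN'; rewrite -rmorphM ltr_rat.
have := gs (Ordinal sN') (Ordinal sN) erefl; rewrite ltr_pdivlMr //; exact.
Qed.

(** The equality of two sets of segments does not tell which segment is dual to which point. The
    maximal terms at [X s] span some path segment, numbered [f s]. By convexity along the line the
    levels of the maximal terms do not decrease with [s], which makes [f] strictly increasing on [N]
    indices, hence the identity. The ends of segment [s] then tie at slope [M s], and this is the
    recursion for the heights. *)
Lemma path_heights kappa (k : I) M c Sigma : 1 <= kappa -> growth kappa M ->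
  extends_to Delta w v (Gamma w k) M c Sigma ->
  forall s, (s < N)%N ->
    [/\ - c (path_vertex k s.+1) = - c (path_vertex k s) + real_growth M s * gap R w v k s,
      forall i, - c (path_vertex k s) - real_growth M s * level (path_vertex k s) <=
        - c i - real_growth M s * level i &
      forall i, - c i - real_growth M s * level i =
          - c (path_vertex k s) - real_growth M s * level (path_vertex k s) ->
        level (path_vertex k s) <= level i <= level (path_vertex k s.+1)].
Proof.
move=> k1 gM [_ _ _ PE].
have gr : growing N 1 (real_growth M).
  apply: growingS (growthP _ gM) => //; first by rewrite -[1](rmorph1 (@ratr R)) ler_rat.
  exact: lt_le_trans k1.
pose A := [seq w i | i <- enum I & i != k].
have AE : A = [seq w (path_vertex k m) | m <- iota 0 N.+1] by rewrite /A enum_neq -map_comp.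
have sA : size A = N.+1 by rewrite AE size_map size_iota.
have nA m : (m <= N)%N -> A`_m = w (path_vertex k m).
  by move=> mN; rewrite AE (nth_map 0%N) ?size_iota // nth_iota.
pose X s : 'rV[R]_3 := real_growth M s *: map_mx ratr v.
pose T s := [set i : I | `[< maximal_terms w c (X s) i >]]%SET.
have lvE s i : dotp (u i) (X s) = real_growth M s * level i.
  exact: linear_formZ (dotp_linear _) _ _.
have TP s i : reflect (forall j, c j + real_growth M s * level j <= c i + real_growth M s * level i) (i \in T s).
  rewrite finset.inE; apply: (iffP (asboolP _)) => [/maximal_termsP h j|h]; first by rewrite -!lvE.
  by apply/maximal_termsP => j; rewrite !lvE.
have ex s : exists t, (s < N)%N -> [/\ (t < N)%N, path_vertex k t \in T s, path_vertex k t.+1 \in T s &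
    forall i, i \in T s -> level (path_vertex k t) <= level i <= level (path_vertex k t.+1)].
  have [sN|sN] := ltnP s N; last by exists 0%N.
  have : surface_path w c (config R v M) (dual_cell w c (config R v M (Ordinal sN))).
    by exists (Ordinal sN).
  rewrite -PE => -[t /=]; rewrite -/A sA ltnS => tN; rewrite !nA ?(ltnW tN) // conv_pair => e.
  exists t => _.
  have XE : config R v M (Ordinal sN) = X s by rewrite /X /real_growth insubT.
  have {}e : conv (T s) = conv [set path_vertex k t; path_vertex k t.+1]%SET.
    rewrite e XE; congr convex_hull; apply/seteqP.
    by split=> [_ [i + <-]|_ [i im <-]]; [rewrite /= finset.inE => /asboolP im; exists i
      |exists i => //=; rewrite finset.inE; apply/asboolP].
  have lt : level (path_vertex k t) < level (path_vertex k t.+1).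
    by have := gap_gt0 level_inc k tN; rewrite subr_gt0.
  split=> //.
  - apply: (exposed_mem (X := - map_mx ratr v) e); first exact: finset.set21.
    move=> j /finset.set2P[->|-> _]; first by rewrite eqxx.
    by rewrite -scaleN1r !(linear_formZ (dotp_linear _)) !mulN1r ltrN2.
  - apply: (exposed_mem (X := map_mx ratr v) e); first exact: finset.set22.
    by move=> j /finset.set2P[->|->] //; rewrite eqxx.
  move=> i /(conv_mem u); rewrite e => /convex_hullP[l [l0 lT l1] ui].
  have -> : level i = \sum_j l j * level j by rewrite -dotp_suml -ui.
  rewrite -[level (path_vertex k t)]mul1r -[level (path_vertex k t.+1)]mul1r -l1 !mulr_suml.
  apply/andP; split; apply: ler_sum => j _;
    (have [/finset.set2P[->|->]|/lT ->] := boolP (j \in [set path_vertex k t; path_vertex k t.+1]%SET);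
     [by rewrite ler_wpM2l // ltW|by rewrite ler_wpM2l // ltW|by rewrite !mul0r]).
have {ex}[f fP] := choice ex.
have mono i j s t : (s < t < N)%N -> i \in T s -> j \in T t -> level i <= level j.
  move=> st /TP/(_ j) h1 /TP/(_ i) h2; have := M_lt gr st; nra.
have fid := @strict_mono_id f N.
have {}fid s : (s < N)%N -> f s = s.
  apply: fid => [m /fP[]//|m m' mm'].
  have mN : (m < N)%N by lia.
  have m'N : (m' < N)%N by lia.
  have [fm _ T1 _] := fP _ mN; have [fm' T2 _ _] := fP _ m'N.
  have := mono _ _ _ _ mm' T1 T2; rewrite leNgt => /negP h.
  rewrite ltnNge; apply/negP => le; apply: h; apply: level_inc.
  by rewrite !val_path_vertex ?(ltnW fm') // /bump; lia.
move=> s sN; have [_] := fP _ sN; rewrite fid // => /TP h1 /TP h2 h3; split.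
- by have := h1 (path_vertex k s.+1); have := h2 (path_vertex k s); rewrite /gap; lra.
- by move=> i; have := h1 i; lra.
- by move=> i ei; apply: h3; apply/TP => j; have := h1 j; lra.
Qed.

End SurfaceHeights.

(** * Successive extensions along the path *)

Section LatticePathExtensions.
Variables (R : realType) (N : nat) (w : 'I_N.+2 -> 'rV[int]_3) (v : 'rV[rat]_3).
Local Notation I := 'I_N.+2.
Local Notation u := (fun i => toR R (w i)).
Local Notation vR := (map_mx ratr v : 'rV[R]_3).
Local Notation conv A := (convex_hull (u @` [set` A])).
Local Notation contact := (contact u).
Local Notation level := (level R w v).
Hypothesis level_inc : forall i j : I, (i < j)%N -> level i < level j.

Lemma weights_lt (A : {set I}) l (b : I -> R) c : weights A l -> (forall i, i \in A -> b i < c) ->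
  \sum_i l i * b i < c.
Proof.
move=> lA bc; rewrite ltNge; apply/negP => le.
have : weights (finset.set0 : {set I}) l.
  apply: (weights_eq (b := b) (c := fun=> c) lA) => [i /bc/ltW//|i /bc + e|].
    by rewrite e ltxx.
  by have [_ _ l1] := lA; rewrite -mulr_suml l1 mul1r.
by move=> /weights_gt0[i]; rewrite finset.inE.
Qed.

Variables (k i j l : I).
Hypotheses (ik : i != k) (jk : j != k) (lk : l != k) (ij : (i < j)%N) (jl : (j < l)%N).
Hypothesis parallelogram : w k + w j = w l + w i.
Local Notation chiP := (chi R w v k i j l).
Variable K : R.
Hypothesis K1 : 1 <= K.
Hypothesis kP : forall n M M' A T, (n <= N)%N -> growing n K M -> growing n K M' ->
    contact A (heights chiP M n) T -> contact A (heights chiP M' n) T.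
Variables (e : R) (M : nat -> R).
Hypothesis gM : growing N K M.
Local Notation a := (fun x => e + heights chiP M N x).
Local Notation path_vertex := (path_vertex k).
Local Notation path_rank := (path_rank k).

(** The points present just before [z] is added. [w k] enters together with [w l], since these two
    complete the parallelogram over the edge from [w i] to [w j]. *)
Definition stage (z : I) : {set I} := [set x : I | (x < z)%N && ((x != k) || (l < z)%N)]%SET.

Lemma toRD (x y : 'rV[int]_3) : toR R (x + y) = toR R x + toR R y.
Proof. exact: raddfD. Qed.

Lemma u_parallelogram : u k + u j = u l + u i.
Proof. by rewrite -!toRD parallelogram. Qed.

Lemma level_k : level k = level l + level i - level j.
Proof.
by apply: (addIr (level j)); rewrite /level subrK -!dotpDl u_parallelogram.
Qed.

Lemma k_lt_l : (k < l)%N.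
Proof.
case: (ltngtP k l) => // [lk'|/val_inj kl]; last by have := lk; rewrite -kl eqxx.
have := level_inc lk'; have := level_inc ij; rewrite level_k; lra.
Qed.

Lemma growing1 : growing N 1 M.
Proof. exact: growingS gM. Qed.

Definition tilted t x := heights chiP M N x - t * level x.

Lemma tiltedE t x : x != k -> tilted t x = tilt w v k M t (path_rank x).
Proof.
by move=> xk; rewrite /tilted heights_path ?path_rank_le // /tilt (path_rankK xk).
Qed.

Lemma tilted_k t : tilted t k = tilted t l + tilted t i - tilted t j.
Proof. by rewrite /tilted heights_k // level_k; ring. Qed.

Lemma stageP z x : z != k -> x \in stage z ->
  x != k /\ (path_rank x < path_rank z)%N \/ x = k /\ (l < z)%N.
Proof.
move=> zk; rewrite finset.inE => /andP[xz]; have [->|xk _] := eqVneq x k; first by right.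
by left; rewrite path_rank_lt.
Qed.

Lemma chi_stage z x s : z != k -> x \in stage z -> (path_rank z <= s.+1)%N -> chiP s x = 0.
Proof.
move=> zk /stageP[//|[xk xz]|[-> lz]] zs; first by apply: chi0 => //; lia.
have lz' : (path_rank l < path_rank z)%N by rewrite path_rank_lt.
have jl' : (path_rank j < path_rank l)%N by rewrite path_rank_lt.
have ij' : (path_rank i < path_rank j)%N by rewrite path_rank_lt.
by apply: chi0k; lia.
Qed.

Lemma heights_stage z x : z != k -> x \in stage z :|: [set z]%SET ->
  heights chiP M N x = heights chiP M (path_rank z) x.
Proof.
move=> zk; rewrite !finset.inE => xz.
apply: (heights_le M (path_rank_le zk) (A := stage z :|: [set z])); last by rewrite !finset.inE.
move=> s y zs; rewrite finset.in_setU => /orP[yz|/finset.set1P ->]; last exact: chi0.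
by apply: (chi_stage zk yz); apply: leqW.
Qed.

(** The new cell is the segment from the predecessor of [z] on the path to [z]. It is in contact for
    the functional of slope [M n] along [v], where [n] is the rank of the predecessor. *)
Lemma smooth_step z : z != k -> (0 < path_rank z)%N ->
  smooth_extension v (cells u (stage z) a) (w z) (cells u (stage z :|: [set z])%SET a) /\
  forall T, contact (stage z) a T -> contact (stage z :|: [set z])%SET a T.
Proof.
move=> zk z0; pose n := (path_rank z).-1; have nz : n.+1 = path_rank z by rewrite prednK.
have nN : (n < N)%N by rewrite nz path_rank_le.
have gn : growing n.+1 K M := growingS nN (lexx K) gM.
have aE : {in (stage z :|: [set z])%SET, a =1 (fun x => e + heights chiP M n.+1 x)}.
  by move=> x xz; rewrite nz -(heights_stage zk xz).
have aE' : {in stage z, a =1 (fun x => e + heights chiP M n.+1 x)}.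
  by move=> x xz; apply: aE; rewrite finset.in_setU xz.
have chiA x : x \in stage z -> chiP n x = 0.
  by move=> xz; apply: (chi_stage zk xz); rewrite nz.
have chiZ x : x \in [set z]%SET -> chiP n x = gap R w v k n.
  by move=> /finset.set1P ->; rewrite /chi (negPf zk) /step -nz leqnn.
have D0 := gap_gt0 level_inc k nN.
have pk : path_vertex n != k by apply: path_vertex_neq; apply: ltnW.
have posp : path_rank (path_vertex n) = n by apply: path_vertexK; apply: ltnW.
have pz : path_vertex n \in stage z.
  by rewrite finset.inE pk -(path_rank_lt pk zk) posp -nz ltnSn.
pose T0 := [set path_vertex n; z]%SET.
have tmin x : x \in (stage z :|: [set z])%SET -> x \notin T0 -> tilted (M n) (path_vertex n) < tilted (M n) x.
  have tminp y : y != k -> (y != path_vertex n) -> (y != z) -> tilted (M n) (path_vertex n) < tilted (M n) y.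
    move=> yk yp yz; rewrite !tiltedE // posp; apply: (tilt_min level_inc k growing1) => //.
    - exact: path_rank_le.
    - by apply: contra yp => /eqP <-; rewrite path_rankK.
    - by apply: contra yz; rewrite nz => /eqP e'; rewrite -(path_rankK yk) e' path_rankK.
  rewrite finset.in_setU finset.in_set2 negb_or finset.in_set1.
  move=> xz /andP[xp xz']; move: xz; rewrite (negPf xz') orbF => /(stageP zk)[[xk _]|[-> lz]].
    exact: tminp.
  (* For [w k] the parallelogram relation decides: [tilted l] is at least the minimum, and
     [tilted i] exceeds [tilted j] because both ranks are at most [n], where the tilted heights
     still decrease. *)
  have le : tilted (M n) (path_vertex n) <= tilted (M n) l.
    have [->//|lp] := eqVneq l (path_vertex n); apply/ltW/tminp => //.
    by apply: contraTneq lz => ->; rewrite ltnn.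
  have lt : tilted (M n) j < tilted (M n) i.
    rewrite !tiltedE //; apply: (tilt_dec level_inc k growing1) => //.
    have lz' : (path_rank l < path_rank z)%N by rewrite path_rank_lt.
    have jl' : (path_rank j < path_rank l)%N by rewrite path_rank_lt.
    by rewrite !path_rank_lt // ij /= -ltnS nz (ltn_trans jl').
  by rewrite tilted_k; lra.
have tz : tilted (M n) z = tilted (M n) (path_vertex n).
  by rewrite !tiltedE // posp -nz tilt_eq.
have cT0 : contact (stage z :|: [set z])%SET a T0.
  have xE x : aff (u x) (M n *: vR, a (path_vertex n) - M n * level (path_vertex n)) =
      M n * level x + (a (path_vertex n) - M n * level (path_vertex n)).
    by rewrite /aff /= (linear_formZ (dotp_linear _)).
  exists (M n *: vR, a (path_vertex n) - M n * level (path_vertex n)) => [x xz|].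
    rewrite xE; have [|/(tmin _ xz)] := boolP (x \in T0); last by rewrite /tilted; lra.
    by move=> /finset.set2P[->|->]; [|move: tz; rewrite /tilted]; lra.
  apply/finset.setP => x; apply/idP/tightP => [xT0|[xz]].
    split; first by move: xT0; rewrite finset.in_set2 finset.in_setU finset.in_set1 => /orP[/eqP ->|->];
      rewrite ?pz ?orbT.
    by rewrite xE; move: xT0 => /finset.set2P[->|->]; [|move: tz; rewrite /tilted]; lra.
  rewrite xE => xa; apply: contraT => /(tmin _ xz); rewrite /tilted; lra.
have cT0' := eq_contact aE cT0.
have T0E : (T0 :&: stage z)%SET = [set path_vertex n]%SET.
  apply/finset.setP => x; rewrite finset.in_setI finset.in_set2 finset.in_set1.
  have [->|xp] /= := eqVneq x (path_vertex n); first by [].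
  by have [->|] //= := eqVneq x z; rewrite finset.inE ltnn.
have codim1 : exists U W, [/\ direction (conv (T0 :&: stage z)%SET) U, direction (conv T0) W &
    \dim W = (\dim U).+1].
  exists <<[::]>>%VS, <<[:: u z - u (path_vertex n)]>>%VS; split.
  - rewrite T0E; apply: (direction_conv (i0 := path_vertex n)) => //; first exact: finset.set11.
    by move=> x /finset.set1P ->; rewrite subrr mem0v.
  - apply: (direction_conv (i0 := path_vertex n)) => [|x|x]; first exact: finset.set21.
      by move=> /finset.set2P[->|->]; rewrite ?subrr ?mem0v // memv_span ?mem_head.
    by rewrite inE => /eqP ->; exists z => //; apply: finset.set22.
  - rewrite span_nil dimv0 span_seq1 dim_vline subr_eq0.
    by rewrite (inj_eq (uinj (w_inj level_inc))) -(inj_eq (level_inj level_inc)) gt_eqF //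
         level_inc //; move: pz; rewrite finset.inE => /andP[].
split.
  exists (conv (stage z)), (lower_hull u (stage z) (fun x => e + heights chiP M n.+1 x)), (u (path_vertex n)).
  have lvE (m : I -> R) : dotp (\sum_x m x *: u x) vR = \sum_x m x * level x by rewrite dotp_suml.
  split.
  - move=> p /convex_hullP[m mA ->]; rewrite /precv lvE.
    by apply: (weights_lt mA) => x; rewrite finset.inE => /andP[xz _]; apply: level_inc.
  - exact: conv_mem.
  - move=> p /convex_hullP[m mA ->]; rewrite /precv lvE.
    have le x : x \in stage z -> level x <= level (path_vertex n).
      move=> xz; have [->//|xp] := eqVneq x (path_vertex n); apply/ltW/level_inc.
      have /(stageP zk)[[xk xz']|[-> lz]] := xz.
        rewrite -(path_rank_lt xk pk) posp ltn_neqAle -ltnS nz xz' andbT.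
        by apply: contra xp => /eqP <-; rewrite path_rankK.
      apply: (leq_trans k_lt_l); rewrite leqNgt -(path_rank_lt pk lk) posp -leqNgt.
      by rewrite -ltnS nz path_rank_lt.
    have [h|h] := ltP (\sum_x m x * level x) (level (path_vertex n)); first by right.
    left; have [m0 m1 m2] : weights [set path_vertex n]%SET m.
      apply: (weights_eq (c := fun=> level (path_vertex n)) mA le).
        by move=> x _ /(level_inj level_inc) ->; apply: finset.set11.
      by have [_ _ m1] := mA; rewrite -mulr_suml m1 mul1r.
    have : conv [set path_vertex n]%SET (\sum_x m x *: u x) by apply/convex_hullP; exists m.
    by rewrite conv1.
  rewrite (eq_cells u aE) (eq_cells u aE') conv_pair.
  apply: (extension_cells kP nN gn chiA chiZ D0 (w_inj level_inc) cT0') => //.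
    by rewrite finset.sub1set finset.set22.
  by rewrite T0E; apply/finset.set0Pn; exists (path_vertex n); apply: finset.set11.
move=> T /(eq_contact aE') cT.
by apply: eq_contact (contact_persist kP nN gn chiA chiZ D0 cT) => x /aE ->.
Qed.

(** The hypothesis says that each point of the list, at its turn, finds exactly its [stage]. This
    form serves both the points before [l], starting from a single vertex, and those after [l],
    starting from the extended polytope. *)
Lemma smooth_chain (s : seq I) (A : {set I}) :
  (forall s1 z s2, s = s1 ++ z :: s2 ->
     [/\ z != k, (0 < path_rank z)%N & (A :|: [set x in s1])%SET = stage z]) ->
  smooth_extensions v (cells u A a) [seq w x | x <- s] (cells u (A :|: [set x in s])%SET a) /\
  forall T, contact A a T -> contact (A :|: [set x in s])%SET a T.
Proof.
elim: s A => [|z s IHs] A h.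
  suff -> : (A :|: [set x in [::]])%SET = A by [].
  by apply/finset.setP => x; rewrite !finset.inE orbF.
have [zk z0] := h [::] z s erefl.
have -> : (A :|: [set x in [::]])%SET = A by apply/finset.setP => x; rewrite !finset.inE orbF.
move=> AE; have [st pe] := smooth_step zk z0.
have UE (s' : seq I) : (A :|: [set x in z :: s'])%SET = (stage z :|: [set z] :|: [set x in s'])%SET.
  by rewrite AE; apply/finset.setP => x; rewrite !finset.inE orbA.
have [|ch pe'] := IHs (stage z :|: [set z])%SET.
  move=> s1 y s2 sE; have [yk y0 yE] := h (z :: s1) y s2 (congr1 (cons z) sE).
  by split=> //; rewrite -yE UE.
rewrite UE AE; split; first by exists (cells u (stage z :|: [set z])%SET a).
by move=> T /pe/pe'.
Qed.

Lemma filter_enum_split (P : pred I) s1 z s2 : [seq x <- enum I | P x] = s1 ++ z :: s2 ->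
  P z /\ forall x, (x \in s1) = P x && (x < z)%N.
Proof.
move=> sE; have rt : transitive (fun x y : I => (x < y)%N) by move=> ? ? ?; apply: ltn_trans.
have srt : sorted (fun x y : I => (x < y)%N) (s1 ++ z :: s2).
  rewrite -sE; apply: sorted_filter => //.
  by have := iota_ltn_sorted 0 N.+2; rewrite -val_enum_ord sorted_map.
have memE x : (x \in s1 ++ z :: s2) = P x by rewrite -sE mem_filter mem_enum andbT.
split=> [|x]; first by rewrite -memE mem_cat mem_head orbT.
move: srt; rewrite sorted_pairwise // pairwise_cat /= => /and4P[/allrelP h1 _ /seq.allP h2 _].
apply/idP/andP => [xs|[]]; first by rewrite -memE mem_cat xs h1 ?mem_head.
rewrite -memE mem_cat inE => /or3P[//|/eqP ->|/h2]; first by rewrite ltnn.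
by move=> zx xz; have := ltn_trans zx xz; rewrite ltnn.
Qed.

Local Notation para := [set k; i; j; l]%SET.
Hypothesis cpara : contact finset.setT a para.
Hypothesis para_free : free [:: u j - u i; u k - u i].

Lemma stage_l x : (x \in stage l) = (x != k) && (x < l)%N.
Proof. by rewrite finset.inE ltnn orbF andbC. Qed.

Lemma stage_lU : (stage l :|: [set k; l])%SET = [set x : I | (x <= l)%N]%SET.
Proof.
apply/finset.setP => x; rewrite finset.in_setU stage_l finset.in_set2 finset.inE.
have -> : (x <= l)%N = (x == l) || (x < l)%N by rewrite leq_eqVlt.
have [->|xk] /= := eqVneq x k; first by rewrite k_lt_l orbT.
by rewrite orbC.
Qed.

Lemma para_stage : (para :&: stage l)%SET = [set i; j]%SET.
Proof.
apply/finset.setP => x; rewrite finset.in_setI stage_l !finset.inE.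
have [->|xk] /= := eqVneq x k.
  by rewrite [k == i]eq_sym [k == j]eq_sym (negPf ik) (negPf jk).
have [->|xi] /= := eqVneq x i; first by rewrite (ltn_trans ij jl).
have [->|xj] //= := eqVneq x j.
by have [->|//] := eqVneq x l; rewrite ltnn.
Qed.

(** [w k] and [w l] rise together: the ranks of [i] and [j] do not exceed the last step [n], so on
    [k] and [l] the function [chi n] takes the same value, the gap. The parallelogram thus plays the
    role of [T0] and the pair [{k, l}] that of [Z]. *)
Lemma parallelogram_step :
  (forall T, contact (stage l) a T -> contact [set x : I | (x <= l)%N]%SET a T) /\
  conv (stage l) `&` conv para = conv [set i; j]%SET /\
  face (conv para) (conv [set i; j]%SET) /\
  forall nu', (forall p, conv (stage l) p -> nu' p = lower_hull u (stage l) a p) ->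
    extension (conv (stage l)) nu' (cells u (stage l) a) (conv para)
      (cells u [set x : I | (x <= l)%N]%SET a).
Proof.
have l0 : (0 < path_rank l)%N by apply: leq_ltn_trans (leq0n (path_rank j)) _; rewrite path_rank_lt.
pose n := (path_rank l).-1; have nl : n.+1 = path_rank l by rewrite prednK.
have nN : (n < N)%N by rewrite nl path_rank_le.
have gn : growing n.+1 K M := growingS nN (lexx K) gM.
have jn : (path_rank j <= n)%N by rewrite -ltnS nl path_rank_lt.
have ijn : (path_rank i < path_rank j)%N by rewrite path_rank_lt.
have chi0s x s : x \in (stage l :|: [set k; l])%SET -> (n.+1 <= s)%N -> chiP s x = 0.
  move=> xB ns; move: xB; rewrite finset.in_setU => /orP[xl|].
    by apply: (chi_stage lk xl); rewrite -nl; lia.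
  by move=> /finset.set2P[->|->]; [apply: chi0k|apply: chi0] => //; lia.
have aE : {in (stage l :|: [set k; l])%SET, a =1 (fun x => e + heights chiP M n.+1 x)}.
  move=> x xB; congr (_ + _); apply: (heights_le M nN (A := stage l :|: [set k; l])) => //.
  by move=> s y ns yB; apply: chi0s.
have aE' : {in stage l, a =1 (fun x => e + heights chiP M n.+1 x)}.
  by move=> x xz; apply: aE; rewrite finset.in_setU xz.
have chiA x : x \in stage l -> chiP n x = 0.
  by move=> xl; apply: (chi_stage lk xl); rewrite nl.
have chiZ x : x \in [set k; l]%SET -> chiP n x = gap R w v k n.
  move=> /finset.set2P[->|->]; rewrite /chi ?eqxx ?(negPf lk) /step -nl leqnn //.
  by rewrite !ltnNge jn (leq_trans (ltnW ijn) jn) /= addr0 subr0.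
have D0 := gap_gt0 level_inc k nN.
have cpara' : contact (stage l :|: [set k; l])%SET (fun x => e + heights chiP M n.+1 x) para.
  have := contact_restr (finset.subsetT (stage l :|: [set k; l])) cpara.
  have -> : (para :&: (stage l :|: [set k; l]))%SET = para.
    apply/finset.setIidPl; rewrite stage_lU; apply/fintype.subsetP => x; rewrite !finset.inE -!orbA.
    by have := k_lt_l; move=> kl /or4P[] /eqP ->; lia.
  exact: eq_contact.
have E0 : (para :&: stage l)%SET != finset.set0.
  by rewrite para_stage; apply/finset.set0Pn; exists i; apply: finset.set21.
have Zp : ([set k; l] \subset para)%SET.
  by apply/fintype.subsetP => x /finset.set2P[->|->]; rewrite !finset.inE eqxx ?orbT.
have sub_ij : ([set i; j] \subset para)%SET by rewrite -para_stage finset.subsetIl.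
have persist T : contact (stage l) a T -> contact (stage l :|: [set k; l])%SET a T.
  move=> /(eq_contact aE') cT.
  by apply: eq_contact (contact_persist kP nN gn chiA chiZ D0 cT) => x /aE ->.
have cij : contact (stage l :|: [set k; l])%SET a [set i; j]%SET.
  apply: persist; rewrite -para_stage; apply: contact_restr (finset.subsetUl _ [set k; l]%SET) _.
  by apply: eq_contact cpara' => x /aE ->.
have cap : conv (stage l) `&` conv para = conv [set i; j]%SET.
  by rewrite (conv_contact_cap kP nN gn chiA chiZ D0 cpara') para_stage.
have fc : face (conv para) (conv [set i; j]%SET).
  apply: (contact_face (A := stage l :|: [set k; l]) (a := a) cij) => //.
    by apply: eq_contact cpara' => x /aE ->.
  by apply/finset.set0Pn; exists i; apply: finset.set21.
rewrite -stage_lU; split=> //; split=> //; split=> //.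
move=> nu' nuE; rewrite (eq_cells u aE) (eq_cells u aE').
apply: (extension_cells kP nN gn chiA chiZ D0 (w_inj level_inc) cpara') => //.
  move=> p lp; rewrite nuE //; congr inf; apply/seteqP; split=> h /lower_hull_set[m mA [pE hE]];
    apply/lower_hull_set; exists m => //; split=> //; rewrite hE; apply: eq_bigr => x _;
    (have [xA|xA] := boolP (x \in stage l); [by rewrite aE'|have [_ m0 _] := mA; by rewrite m0 // !mul0r]).
rewrite para_stage.
exists <<[:: u j - u i]>>%VS, <<[:: u j - u i; u k - u i]>>%VS; split.
- apply: (direction_conv (i0 := i)) => [|x|x]; first exact: finset.set21.
    by move=> /finset.set2P[->|->]; rewrite ?subrr ?mem0v // memv_span ?mem_head.
  by rewrite inE => /eqP ->; exists j => //; apply: finset.set22.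
- have mj : u j - u i \in <<[:: u j - u i; u k - u i]>>%VS by apply: memv_span; rewrite mem_head.
  have mk : u k - u i \in <<[:: u j - u i; u k - u i]>>%VS by apply: memv_span; rewrite !inE eqxx orbT.
  apply: (direction_conv (i0 := i)) => [|x|x]; first by rewrite !finset.inE eqxx orbT.
    rewrite !finset.inE -!orbA => /or4P[] /eqP -> //; first by rewrite subrr mem0v.
    have -> : u l - u i = (u j - u i) + (u k - u i).
      by rewrite -[u l](addrK (u i)) -u_parallelogram; rewrite [u k + u j]addrC addrACA -opprD opprD addrA.
    exact: memvD.
  by rewrite !inE => /orP[] /eqP ->; [exists j|exists k] => //; rewrite !finset.inE eqxx ?orbT.
move: para_free; rewrite /free => /eqP ->.
have : free [:: u j - u i] by move: para_free; rewrite -cat1s => /catl_free.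
by rewrite /free => /eqP ->.
Qed.

Lemma image_path (s : seq I) (S : {set I}) : (forall x, (x \in S) = (x \in s)) ->
  convex_hull (toR R @` [set` [seq w x | x <- s]]) = conv S.
Proof.
move=> Ss; congr convex_hull; apply/seteqP; split=> [_ [z /= /mapP[x xs ->] <-]|_ [x xS <-]].
  by exists x => //=; rewrite Ss.
by exists (w x) => //=; apply: map_f; rewrite -Ss.
Qed.

Lemma path_extension nu' :
    (forall p, conv finset.setT p -> nu' p = lower_hull u finset.setT a p) ->
  exists lstar, [/\ precedes_in_path k lstar l,
    convex_hull (toR R @` [set` path_upto w k lstar]) = conv (stage l),
    smooth_triangulation v (path_upto w k lstar) (cells u (stage l) a),
    cells u (stage l) a `<=` cells u finset.setT a &
    extension (conv (stage l)) nu' (cells u (stage l) a) (conv para)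
      (cells u [set x : I | (x <= l)%N]%SET a) /\
    smooth_extensions v (cells u [set x : I | (x <= l)%N]%SET a) (path_after w k l)
      (cells u finset.setT a)].
Proof.
move=> nuE; have l0 : (0 < path_rank l)%N by apply: leq_ltn_trans (leq0n (path_rank j)) _; rewrite path_rank_lt.
pose n := (path_rank l).-1; have nl : n.+1 = path_rank l by rewrite prednK.
have nN : (n <= N)%N by apply: ltnW; rewrite nl path_rank_le.
have pk : path_vertex n != k by apply: path_vertex_neq.
have pn : path_rank (path_vertex n) = n by apply: path_vertexK.
have uptoE x : (x != k) && (x <= path_vertex n)%N = (x \in stage l).
  rewrite stage_l; have [//|xk /=] := eqVneq x k.
  by rewrite leqNgt -(path_rank_lt pk xk) pn -(path_rank_lt xk lk) -nl ltnS -leqNgt.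
have [pe1 [cap [fc ext]]] := parallelogram_step.
have [|ch2 pe2] := @smooth_chain [seq x <- enum I | (x != k) && (l < x)%N] [set x : I | (x <= l)%N]%SET.
  move=> s1 z s2 /filter_enum_split[/andP[zk lz] s1E]; split=> //.
    by apply: leq_ltn_trans (leq0n (path_rank l)) _; rewrite path_rank_lt.
  apply/finset.setP => x; rewrite !finset.inE s1E lz orbT andbT.
  by have := k_lt_l; have [->|_] := eqVneq x k => /=; lia.
have UT : ([set x : I | (x <= l)%N] :|: [set x in [seq x <- enum I | (x != k) && (l < x)%N]])%SET = finset.setT.
  apply/finset.setP => x; rewrite !finset.inE mem_filter mem_enum andbT.
  by have := k_lt_l; have [->|_] := eqVneq x k => /=; lia.
rewrite UT in ch2 pe2.
have pe T : contact (stage l) a T -> contact finset.setT a T by move=> /pe1/pe2.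
exists (path_vertex n); split.
- split=> //; first by rewrite -(path_rank_lt pk lk) pn -nl.
  move=> x /andP[px xl]; apply/eqP; apply: contraLR px => xk.
  by rewrite -(path_rank_lt pk xk) pn -leqNgt -ltnS nl path_rank_lt.
- by apply: image_path => x; rewrite mem_filter mem_enum andbT uptoE.
- rewrite /path_upto.
  have memE x : (x \in [seq x <- enum I | (x != k) && (x <= path_vertex n)%N]) = (x \in stage l).
    by rewrite mem_filter mem_enum andbT uptoE.
  have splitE := @filter_enum_split (fun x => (x != k) && (x <= path_vertex n)%N).
  case: [seq x <- enum I | _] memE splitE => [|z0 s] memE splitE.
    by have := memE (path_vertex n); rewrite -uptoE pk leqnn.
  have [z0P _] := splitE [::] z0 s erefl; rewrite /=.
  have -> : [set [set toR R (w z0)]] = cells u [set z0]%SET a.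
    apply/seteqP; split=> [_ ->|_ [T [cT T0] <-]].
      exists [set z0]%SET; last exact: conv1.
      split; last by apply/finset.set0Pn; exists z0; apply: finset.set11.
      exists (0, a z0) => [x /finset.set1P ->|]; first by rewrite aff_cst.
      by apply/finset.setP => x; rewrite !finset.inE aff_cst; case: eqP => [->|//]; rewrite eqxx.
    have := contact_sub cT; rewrite finset.subset1 (negPf T0) orbF => /eqP ->.
    exact: conv1.
  have [|ch _] := @smooth_chain s [set z0]%SET.
    move=> s1 z s2 sE; have := splitE (z0 :: s1) z s2 (congr1 (cons z0) sE).
    move=> [/[dup] zP /andP[zk _] s1E]; split=> //.
      have := s1E z0; rewrite mem_head => /esym/andP[/andP[z0k _] z0z].
      by apply: leq_ltn_trans (leq0n (path_rank z0)) _; rewrite path_rank_lt.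
    have zl : (z < l)%N by move: zP; rewrite uptoE stage_l => /andP[].
    have lz : (l < z)%N = false by apply/negbTE; rewrite -leqNgt ltnW.
    apply/finset.setP => x; have := s1E x; rewrite !finset.inE => ->.
    rewrite uptoE stage_l lz orbF; have [_|] /= := eqVneq x k; first by rewrite andbF.
    by case: (ltnP x z) => xz; rewrite ?andbF // !andbT (ltn_trans xz).
  suff <- : ([set z0] :|: [set x in s])%SET = stage l by [].
  by apply/finset.setP => x; have := memE x; rewrite !finset.inE.
- by move=> _ [T [cT T0] <-]; exists T => //; split=> //; apply: pe.
split=> //; apply: ext => p lp; rewrite nuE; last exact: convS (finset.subsetT _) _ lp.
(* The contact sets of the lower part persist up to the full set of points, so the global lower hull
   restricts to that of the lower part. *)
have [T cT /convex_hullP[m mT ->]] := contact_conv a lp.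
by rewrite (lower_hull_weights cT mT) (lower_hull_weights (pe _ cT) mT).
Qed.

End LatticePathExtensions.

(** * The position of the circuit relative to the path *)

Section CircuitAnalysis.
Variables (R : realType) (N : nat) (w : 'I_N.+2 -> 'rV[int]_3) (v : 'rV[rat]_3).
Local Notation I := 'I_N.+2.
Local Notation u := (fun i => toR R (w i)).
Local Notation conv A := (convex_hull (u @` [set` A])).
Local Notation contact := (contact u).
Local Notation level := (level R w v).
Hypothesis N0 : (0 < N)%N.
Hypothesis level_inc : forall i j : I, (i < j)%N -> level i < level j.
Variable K : R.
Hypothesis K1 : 1 <= K.
Hypothesis kP : forall k i j l n M M' A T, (n <= N)%N -> growing n K M -> growing n K M' ->
    contact A (heights (chi R w v k i j l) M n) T -> contact A (heights (chi R w v k i j l) M' n) T.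
Variables (k : I) (M : nat -> R) (a : I -> R).
Hypothesis gM : growing N K M.
Local Notation path_vertex := (path_vertex k).
Local Notation path_rank := (path_rank k).
Hypothesis aS : forall s, (s < N)%N -> a (path_vertex s.+1) = a (path_vertex s) + M s * gap R w v k s.
Hypothesis amin : forall s, (s < N)%N -> forall x,
  a (path_vertex s) - M s * level (path_vertex s) <= a x - M s * level x.
Hypothesis aseg : forall s, (s < N)%N -> forall x,
  a x - M s * level x = a (path_vertex s) - M s * level (path_vertex s) ->
  level (path_vertex s) <= level x <= level (path_vertex s.+1).
Variable T : {set I}.
Hypothesis cT : contact finset.setT a T.

Let g1 : growing N 1 M.
Proof. exact: growingS gM. Qed.

Lemma a_path x : x != k -> a x = a (path_vertex 0) + profile w v k M (path_rank x).
Proof.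
move=> xk; rewrite -{1}(path_rankK xk); have := path_rank_le xk; elim: (path_rank x) => [|m IHm] mN.
  by rewrite /profile big_ord0 addr0.
by rewrite aS // IHm ?(ltnW mN) // /profile big_ord_recr /= addrA.
Qed.

Lemma a_tilt t x : x != k -> a x - t * level x = a (path_vertex 0) + tilt w v k M t (path_rank x).
Proof. by move=> xk; rewrite a_path // /tilt (path_rankK xk) addrA. Qed.

(** On a contact set the heights are values of an affine functional and inherit the relations among
    the points. *)
Lemma relation_height x y z t : x \in T -> y \in T -> z \in T -> t \in T ->
  w x + w y = w z + w t -> a x + a y = a z + a t /\ level x + level y = level z + level t.
Proof.
move=> xT yT zT tT e.
have ue : u x + u y = u z + u t by rewrite -!toRD e.
split; last by rewrite -!dotpDl ue.
have [f _ TE] := cT.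
have fE i : i \in T -> a i = dotp (u i) f.1 + f.2 by rewrite TE => /tightP[].
rewrite !fE // addrACA -dotpDl ue dotpDl; exact: addrACA.
Qed.

(** At the slope of the edge ending in [t], the vertex [t] attains the minimum and [z] is strictly
    lower than the earlier [x]. The diagonal [{z, t}] would have a smaller sum than [{x, y}],
    whereas the relation makes the sums equal. *)
Lemma no_path_parallelogram x y z t : x != k -> y != k -> z != k -> t != k ->
  a x + a y = a z + a t -> level x + level y = level z + level t ->
  (x < z)%N -> (z < t)%N -> False.
Proof.
move=> xk yk zk tk ae le xz zt.
pose s := (path_rank t).-1.
have st : s.+1 = path_rank t by rewrite prednK // (leq_ltn_trans (leq0n (path_rank z))) // path_rank_lt.
have sN : (s < N)%N by rewrite st path_rank_le.
have pt : path_vertex s.+1 = t by rewrite st path_rankK.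
have ty : a t - M s * level t <= a y - M s * level y.
  by have := amin sN y; have := aS sN; rewrite pt /gap pt => ->; lra.
have xz' : tilt w v k M (M s) (path_rank z) < tilt w v k M (M s) (path_rank x).
  by apply: (tilt_dec level_inc k g1) => //; rewrite -[(_ <= s)%N]ltnS st !path_rank_lt // xz.
have hx := a_tilt (M s) xk; have hz := a_tilt (M s) zk.
have /= := congr1 (fun r => M s * r) le; rewrite !mulrDr; lra.
Qed.

(** At the slope of the edge starting in [x], this vertex has the lowest level among the minimizing
    points, so weights representing it can only sit on [x]. The last vertex starts no edge; there
    the edge ending in it is used, and it has the highest level. *)
Lemma path_mem x : x != k -> conv T (u x) -> x \in T.
Proof.
move=> xk Tx; have /convex_hullP[m mT uE] := Tx.
have [m0 mT0 m1] := mT.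
have [f sf TE] := cT.
have lvE : level x = \sum_i m i * level i by rewrite -dotp_suml -uE.
have aE : \sum_i m i * a i <= a x.
  apply: le_trans (sf x (finset.in_setT _)); rewrite uE aff_comb //; apply: ler_sum => i _.
  by have [|/mT0 ->] := boolP (i \in T); [rewrite TE => /tightP[_ ->]|rewrite !mul0r].
have on s : (s < N)%N -> a x - M s * level x = a (path_vertex s) - M s * level (path_vertex s) ->
    weights [set i in T | a i - M s * level i == a x - M s * level x]%SET m.
  move=> sN ex; apply: (weights_eq (c := fun i => a i - M s * level i)
    (b := fun=> a x - M s * level x) mT) => [i _|i iT e|].
  - by rewrite ex amin.
  - by rewrite finset.inE iT e eqxx.
  rewrite -mulr_suml m1 mul1r.
  have -> : \sum_i m i * (a i - M s * level i) = \sum_i m i * a i - M s * level x.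
    by rewrite lvE mulr_sumr -sumrB; apply: eq_bigr => i _; ring.
  lra.
have fin (S : {set I}) : weights S m -> S \subset T -> (forall i, i \in S -> level x <= level i) \/
    (forall i, i \in S -> level i <= level x) -> x \in T.
  move=> mS ST h; have mx : weights [set x]%SET m.
    case: h => h.
      apply: (weights_eq (b := fun=> level x) (c := level) mS h) => [i _ /(level_inj level_inc) ->|].
        exact: finset.set11.
      by rewrite -lvE -mulr_suml m1 mul1r.
    apply: (weights_eq (b := level) (c := fun=> level x) mS h) => [i _ /(level_inj level_inc) ->|].
      exact: finset.set11.
    by rewrite -lvE -mulr_suml m1 mul1r.
  have [i iS mi] := weights_gt0 mS; apply: (fintype.subsetP ST).
  suff <- : i = x by [].
  apply/eqP; apply: contraTT mi => ix; have [_ mx0 _] := mx.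
  by rewrite mx0 ?ltxx // finset.inE.
have sub s : [set i in T | a i - M s * level i == a x - M s * level x]%SET \subset T.
  by apply/fintype.subsetP => i; rewrite finset.inE => /andP[].
have [xN|xN] := ltnP (path_rank x) N.
  have ex : a x - M (path_rank x) * level x = a (path_vertex (path_rank x)) - M (path_rank x) * level (path_vertex (path_rank x)).
    by rewrite path_rankK.
  apply: (fin _ (on _ xN ex) (sub _)); left => i; rewrite finset.inE => /andP[_ /eqP e].
  by have := aseg xN (etrans e ex); rewrite path_rankK // => /andP[].
have xE : path_rank x = N by apply/eqP; rewrite eqn_leq xN path_rank_le.
have pN : (N.-1 < N)%N by rewrite prednK.
have px : path_vertex N.-1.+1 = x by rewrite -[RHS](path_rankK xk); congr path_vertex; rewrite xE prednK.
have ex : a x - M N.-1 * level x = a (path_vertex N.-1) - M N.-1 * level (path_vertex N.-1).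
  by have := aS pN; rewrite px /gap px => ->; ring.
apply: (fin _ (on _ pN ex) (sub _)); right => i; rewrite finset.inE => /andP[_ /eqP e].
by have := aseg pN (etrans e ex); rewrite px => /andP[].
Qed.

(* Increasing the last coefficient does not change the contact sets, but it would
   break a dependency involving the last path vertex. *)
Lemma path_independent (y : I -> R) : (forall x, x \notin T -> y x = 0) -> y k = 0 ->
  \sum_x y x = 0 -> \sum_x y x *: u x = 0 -> forall x, y x = 0.
Proof.
move=> yT yk ys yu x0; apply/eqP/negPn/negP => yx0.
have [z yz zm] := @Order.TotalTheory.arg_maxP _ _ _ x0 (fun x => y x != 0) (fun x => (x : nat)) yx0.
have zk : z != k by apply: contraNneq yz => ->; rewrite yk.
have yE (b : I -> R) : \sum_x y x * (b x) = \sum_(x | y x != 0) y x * b x.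
  by rewrite [RHS]big_mkcond; apply: eq_bigr => x _; case: eqP => [->|]; rewrite ?mul0r.
have le x : y x != 0 -> x != k /\ (x <= z)%N.
  by move=> yx; split; [apply: contraNneq yx => ->; rewrite yk|apply: zm].
(* Only path vertices enter this argument, so the three slots of the parallelogram are filled with
   [k]. *)
have ch := kP (k := k) (i := k) (j := k) (l := k).
have [z0|z0] := posnP (path_rank z).
  move: ys; rewrite (bigD1 z) //= big1 ?addr0; first by move=> yz0; rewrite yz0 eqxx in yz.
  move=> x xz; apply/eqP/negPn/negP => /le[xk xz'].
  have : (path_rank x < path_rank z)%N by rewrite path_rank_lt // ltn_neqAle xz' andbT.
  by rewrite z0.
pose n := (path_rank z).-1; have nz : n.+1 = path_rank z by rewrite prednK.
have nN : (n < N)%N by rewrite nz path_rank_le.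
have gn : growing n.+1 K M := growingS nN (lexx K) gM.
pose A := [set x : I | (x != k) && (x <= z)%N]%SET.
have posA x : x \in A -> x != k /\ (path_rank x <= n.+1)%N.
  by rewrite finset.inE => /andP[xk xz]; rewrite nz leqNgt path_rank_lt // -leqNgt.
have cA : contact A (heights (chi R w v k k k k) M n.+1) (T :&: A)%SET.
  have := contact_restr (finset.subsetT A) cT.
  move=> /(contact_cst (- a (path_vertex 0))); apply: eq_contact => x /posA[xk xn].
  by rewrite [a x]a_path // heights_path // addKr.
have [f _ fE] := cA.
have gn' := growing_raise ler01 gn.
have [f' _ fE'] := ch _ _ _ _ _ nN gn gn' cA.
have inTA x : y x != 0 -> x \in (T :&: A)%SET.
  move=> yx; have [xk xz] := le _ yx; rewrite !finset.inE xk xz /= andbT.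
  by apply: contraNT yx => /yT ->.
have aff0 h : \sum_x y x * aff (u x) h = 0.
  under eq_bigr do rewrite /aff mulrDr.
  rewrite big_split /= -mulr_suml ys mul0r addr0 -dotp_suml yu.
  by rewrite dotpC (linear_form0 (dotp_linear _)).
(* The functionals tight before and after raising the last coefficient by one differ on [T :&: A] by
   [chi n], while [y] annihilates both. Among the points with nonzero coefficient only [z] lies
   beyond step [n], so its term alone survives. *)
have : \sum_x y x * (aff (u x) f' - aff (u x) f) = 0.
  by under eq_bigr do rewrite mulrBr; rewrite sumrB !aff0 subrr.
rewrite yE (eq_bigr (fun x => y x * chi R w v k k k k n x)); last first.
  move=> x /inTA xTA; have : x \in (T :&: A)%SET by [].
  rewrite {1}fE => /tightP[_ ->]; move: xTA; rewrite fE' => /tightP[_ ->].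
  by rewrite heights_raise; ring.
rewrite (bigD1 z) //= big1 ?addr0 => [|x /andP[/le[xk xz] xz']]; last first.
  rewrite chi0 ?mulr0 // -ltnS nz path_rank_lt // ltn_neqAle xz andbT.
  by apply: contra xz' => /eqP/val_inj ->.
rewrite /chi (negPf zk) /step -nz ltnSn => /eqP; rewrite mulf_eq0 (negPf yz) /=.
by rewrite gt_eqF // (gap_gt0 level_inc).
Qed.

Variables (x y z : I).
Hypotheses (xk : x != k) (yk : y != k) (zk : z != k) (xy : x != y) (xz : x != z) (yz : (y < z)%N).
Hypothesis rel : w k + w x = w y + w z.
Hypotheses (Tk : conv T (u k)) (Tx : conv T (u x)) (Ty : conv T (u y)) (Tz : conv T (u z)).

Let xT : x \in T. Proof. exact: path_mem. Qed.
Let yT : y \in T. Proof. exact: path_mem. Qed.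
Let zT : z \in T. Proof. exact: path_mem. Qed.

(** Otherwise [u k] is a combination of path vertices of [T]. Comparison with [u y + u z - u x]
    gives a relation among them whose coefficient at [x] is at least one, contrary to
    independence. *)
Lemma k_mem : k \in T.
Proof.
have [//|kT] := boolP (k \in T); exfalso.
have /convex_hullP[m [m0 mT m1] uE] := Tk.
pose d (i j : I) : R := (j == i)%:R.
have dE (V : lmodType R) i (F : I -> V) : \sum_j d i j *: F j = F i.
  by rewrite (bigD1 i) //= /d eqxx scale1r big1 ?addr0 // => j /negPf ->; rewrite scale0r.
pose c i := m i - d y i - d z i + d x i.
have c0 : forall i, c i = 0.
  have dT i j : i \in T -> j \notin T -> d i j = 0.
    by move=> iT jT; rewrite /d; case: eqP jT => [->|//]; rewrite iT.
  apply: path_independent => [i iT||| ].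
  - by rewrite /c mT // !dT //; ring.
  - by rewrite /c mT // !dT //; ring.
  - have d1 i : \sum_j d i j = 1.
      by rewrite (bigD1 i) //= /d eqxx big1 ?addr0 // => j /negPf ->.
    by rewrite big_split /= !sumrB m1 !d1; ring.
  under eq_bigr do rewrite !(scalerDl, scaleNr).
  rewrite !big_split /= !sumrN !dE -uE.
  have : u k + u x = u y + u z by rewrite -!toRD rel.
  by move=> e; rewrite -[X in X + _]addrA -opprD addrAC e subrr.
have := c0 x; rewrite /c /d eqxx (negPf xy) (negPf xz) /=.
have := m0 x; lra.
Qed.

(** If [x] came after both others, the slope of the edge starting in [y] would put [w k] strictly
    below the minimum; if it came before both, the slope of the edge ending in [z] would. *)
Lemma relation_order : (y < x < z)%N.
Proof.
have [ae le] := relation_height k_mem xT yT zT rel.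
case: (ltngtP y x) => [yx|lt|/val_inj e]; last by have := xy; rewrite e eqxx.
  case: (ltngtP x z) => [//|lt|/val_inj e]; last by have := xz; rewrite e eqxx.
  exfalso.
  pose s := path_rank y; have sN : (s < N)%N by apply: leq_trans (path_rank_le zk); rewrite path_rank_lt.
  have := amin sN k; rewrite !path_rankK //.
  have hx := a_tilt (M s) xk; have hz := a_tilt (M s) zk.
  have : tilt w v k M (M s) (path_rank z) < tilt w v k M (M s) (path_rank x).
    by apply: (tilt_inc level_inc k g1); rewrite ?path_rank_le // /s !path_rank_lt // yz.
  have /= := congr1 (fun r => M s * r) le; rewrite !mulrDr; lra.
exfalso; pose s := (path_rank z).-1.
have xz' : (x < z)%N := ltn_trans lt yz.
have sz : s.+1 = path_rank z by rewrite prednK // (leq_ltn_trans (leq0n (path_rank x))) // path_rank_lt.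
have sN : (s < N)%N by rewrite sz path_rank_le.
have pz : path_vertex s.+1 = z by rewrite sz path_rankK.
have := amin sN k.
have := aS sN; rewrite pz /gap pz => az.
have hx := a_tilt (M s) xk; have hy := a_tilt (M s) yk.
have : tilt w v k M (M s) (path_rank y) < tilt w v k M (M s) (path_rank x).
  by apply: (tilt_dec level_inc k g1) => //; rewrite -[(_ <= s)%N]ltnS sz !path_rank_lt // lt.
have /= := congr1 (fun r => M s * r) le; rewrite !mulrDr; lra.
Qed.

Lemma parallelogram_heights : {in finset.setT, a =1
  (fun i => a (path_vertex 0) + heights (chi R w v k y x z) M N i)}.
Proof.
have hE i : i != k -> a i = a (path_vertex 0) + heights (chi R w v k y x z) M N i.
  by move=> ik; rewrite a_path // heights_path // path_rank_le.
move=> i _; have [->|/hE //] := eqVneq i k.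
rewrite heights_k //; have [ae _] := relation_height k_mem xT yT zT rel.
have := hE _ xk; have := hE _ yk; have := hE _ zk; lra.
Qed.

(** Independence of the path vertices in [T] excludes a Farkas certificate, so some functional
    vanishes at [y], [x], [z] and is at most [-1] on the other path vertices of [T]. By the relation
    it vanishes at [k] too, and a small tilt along it cuts the parallelogram out of the cell
    [conv T]. *)
Lemma parallelogram_contact : contact finset.setT a [set k; y; x; z]%SET.
Proof.
pose P := [set y; x; z]%SET.
have PT : P \subset T :\ k.
  by apply/fintype.subsetP => i; rewrite !finset.inE -!orbA => /or3P[] /eqP ->;
    rewrite ?xT ?yT ?zT ?xk ?yk ?zk.
have [[q qA qP]|[c [c0 cF cr]]] :=
  affine_farkas (fun i => if i \in P then 0 else -1) (fun i => aff_linear (u i)) PT; last first.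
  exfalso; move: cr; rewrite big1 ?ltxx // => i iT.
  pose c' i := if i \in T :\ k then c i else 0.
  have cE (F : I -> R) : \sum_i c' i * F i = \sum_(i in T :\ k) c i * F i.
    by rewrite [RHS]big_mkcond; apply: eq_bigr => j _; rewrite /c'; case: ifP => // _; rewrite mul0r.
  have c1 : \sum_i c' i = 0.
    by rewrite -[RHS](cF (0, 1)) -cE; apply: eq_bigr => j _; rewrite aff_cst mulr1.
  have : forall i, c' i = 0.
    apply: path_independent => //.
    - by move=> j jT; rewrite /c' !finset.inE (negPf jT) andbF.
    - by rewrite /c' !finset.inE eqxx.
    - apply: dotp_inj => X; rewrite [RHS]dotpC (linear_form0 (dotp_linear _)) dotp_suml cE.
      by rewrite -[RHS](cF (X, 0)); apply: eq_bigr => j _; rewrite /aff /= addr0.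
  by move=> /(_ i); rewrite /c' iT => ->; rewrite mul0r.
have uk : u k = u y + u z - u x by rewrite -toRD -rel toRD addrK.
have affk : aff (u k) q = aff (u y) q + aff (u z) q - aff (u x) q.
  have e (d1 d2 d3 b : R) : d1 + d2 - d3 + b = (d1 + b) + (d2 + b) - (d3 + b) by ring.
  by rewrite /aff uk !dotpDl dotpNl; apply: e.
have q0 i : i \in P -> aff (u i) q = 0 by move=> iP; rewrite qP // iP.
have [yP xP zP] : [/\ y \in P, x \in P & z \in P] by rewrite !finset.inE !eqxx ?orbT.
have qk : aff (u k) q = 0 by rewrite affk !q0 //; ring.
have [f sf TE] := cT.
have qT i : i \in tight u finset.setT a f -> aff (u i) q <= 0.
  rewrite -TE => iT; have [->|ik] := eqVneq i k; first by rewrite qk.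
  apply: le_trans (qA i _) _; first by rewrite !finset.inE ik.
  by case: ifP => // _; rewrite lerN10.
have := perturb sf qT; rewrite -TE.
suff -> : [set i in T | aff (u i) q == 0]%SET = [set k; y; x; z]%SET by [].
apply/finset.setP => i; apply/idP/idP.
  rewrite finset.inE => /andP[iT /eqP qi].
  have [->|ik] := eqVneq i k; first by rewrite !finset.inE eqxx.
  have [iP|iP] := boolP (i \in P); first by move: iP; rewrite !finset.inE -!orbA => ->; rewrite orbT.
  have := qA i; rewrite (negPf iP) finset.in_setD1 ik iT qi => /(_ isT); lra.
rewrite !finset.inE -!orbA => /or4P[] /eqP ->; rewrite ?k_mem ?yT ?xT ?zT /=; apply/eqP => //; exact: q0.
Qed.

Lemma parallelogram_free : free [:: u x - u y; u k - u y].
Proof.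
have -> : u k - u y = u z - u x.
  have : u k + u x = u y + u z by rewrite -!toRD rel.
  by move=> e; rewrite -[u k](addrK (u x)) e addrAC [u y + _]addrC addrK.
have xyz : [/\ y != x, z != x & z != y].
  by split; rewrite 1?eq_sym //; move: yz; rewrite ltn_neqAle => /andP[].
have ind (b c : R) : b *: (u x - u y) + c *: (u z - u x) = 0 -> b = 0 /\ c = 0.
  move=> e; pose d (i : I) : R := if i == x then b - c else if i == y then - b else if i == z then c else 0.
  have [yx zx zy] := xyz.
  have sE (V : lmodType R) (F : I -> V) : \sum_i d i *: F i =
      (b - c) *: F x - b *: F y + c *: F z.
    rewrite (bigD1 x) //= (bigD1 y) //= (bigD1 z) //=; last by rewrite zx zy.
    rewrite big1 ?addr0 => [|i /andP[/andP[ix iy] iz]]; last first.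
      by rewrite /d (negPf ix) (negPf iy) (negPf iz) scale0r.
    by rewrite /d !eqxx (negPf yx) (negPf zx) (negPf zy) scaleNr addrA.
  have d0 : forall i, d i = 0.
    apply: path_independent.
    - move=> i iT; rewrite /d; case: eqP => [ix|_]; first by rewrite ix xT in iT.
      case: eqP => [iy|_]; first by rewrite iy yT in iT.
      by case: eqP => [iz|_] //; rewrite iz zT in iT.
    - by rewrite /d eq_sym (negPf xk) eq_sym (negPf yk) eq_sym (negPf zk).
    - rewrite (_ : \sum_i d i = \sum_i d i *: (1 : R^o)).
        by rewrite (sE R^o) /GRing.scale /= !mulr1; ring.
      by apply: eq_bigr => i _; rewrite /GRing.scale /= mulr1.
    - rewrite sE -e !scalerBr scalerBl; rewrite -!addrA; congr (_ + _).
      by rewrite addrC -addrA; congr (_ + _); rewrite addrC.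
  by have := d0 y; have := d0 z; rewrite /d !eqxx (negPf yx) (negPf zx) (negPf zy); lra.
apply/(@freeP _ _ _ (in_tuple _)) => c; rewrite !big_ord_recl big_ord0 addr0 /= => /ind[c0 c1].
case=> [[|[|//]]] p; first by rewrite -c0; congr c; apply: val_inj.
by rewrite -c1; congr c; apply: val_inj.
Qed.

Lemma parallelogram_circuit : [/\ (y < x < z)%N,
  {in finset.setT, a =1 (fun i => a (path_vertex 0) + heights (chi R w v k y x z) M N i)},
  contact finset.setT a [set k; y; x; z]%SET & free [:: u x - u y; u k - u y]].
Proof.
split; [exact: relation_order|exact: parallelogram_heights|exact: parallelogram_contact|].
exact: parallelogram_free.
Qed.

End CircuitAnalysis.

(** * Identification of the parallelogram and uniqueness *)

Section MainTheorem.
Variables (R : realType) (N : nat) (Delta : set 'rV[R]_3).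
Variables (w : 'I_N.+2 -> 'rV[int]_3) (v : 'rV[rat]_3).
Local Notation I := 'I_N.+2.
Local Notation u := (fun i => toR R (w i)).
Local Notation conv A := (convex_hull (u @` [set` A])).
Local Notation contact := (contact u).
Local Notation level := (level R w v).
Hypothesis N0 : (0 < N)%N.
Hypothesis level_inc : forall i j : I, (i < j)%N -> level i < level j.
Hypothesis DeltaE : Delta = conv (finset.setT : {set I}).
Hypothesis lattice_points : forall p, Delta (toR R p) <-> exists i, p = w i.
Variable K : R.
Hypothesis K1 : 1 <= K.
Hypothesis kP : forall k i j l n M M' A T, (n <= N)%N -> growing n K M -> growing n K M' ->
    contact A (heights (chi R w v k i j l) M n) T -> contact A (heights (chi R w v k i j l) M' n) T.
Variable kappa : rat.
Hypothesis kappa1 : 1 <= kappa.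
Hypothesis kappaK : K <= ratr kappa.

Lemma nu_SE (c : I -> R) : nu_S w c = lower_hull u finset.setT (fun i => - c i).
Proof.
apply/funext => p; congr inf; apply/seteqP.
by split=> h; apply: convex_hullS => _ [i _ <-]; exists i => //=; rewrite finset.in_setT.
Qed.

(** For the diagonals [{a, d}] and [{b, c}]: the least of the four precedes both ends of the other
    diagonal, which come in either order. Each case is an instance for [no_path_parallelogram]. *)
Lemma extremal_pair_cases (a b c d : nat) : a <> b -> a <> c -> d <> b -> d <> c -> b <> c -> a <> d ->
  ((b < d /\ d < a) \/ (b < a /\ a < d) \/ (c < d /\ d < a) \/ (c < a /\ a < d) \/
  (d < b /\ b < c) \/ (d < c /\ c < b) \/ (a < b /\ b < c) \/ (a < c /\ c < b))%N.
Proof. by lia. Qed.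

Lemma free_pair_neq (p q : 'rV[R]_3) : free [:: p; q] -> [/\ p != 0, q != 0, p != q & p + q != 0].
Proof.
move=> pq; have p0 : p != 0 by apply: (free_not0 pq); rewrite mem_head.
have q0 : q != 0 by apply: (free_not0 pq); rewrite !inE eqxx orbT.
move: pq; rewrite free_cons => /andP[pq _]; split=> //.
  by apply: contra pq => /eqP ->; rewrite memv_span ?mem_head.
by apply: contra pq; rewrite addr_eq0 => /eqP ->; rewrite memvN memv_span ?mem_head.
Qed.

(** If [w k] were not in the circuit, there would be a parallelogram of path vertices, which is
    impossible. Whichever corner [w k] is, the opposite corner becomes [j], and the remaining two
    are named by their order. *)
Lemma circuit_parallelogram k C M c Sigma :
    growth kappa M -> extends_to Delta w v (Gamma w k) M c Sigma ->
    circuit_of Sigma C -> type_D R C ->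
  exists (i j l : I) (e : R),
  [/\ (i < j < l)%N, [/\ i != k, j != k & l != k], C = [fset w k; w i; w j; w l]%fset,
    w k + w j = w l + w i &
    let a (x : I) := e + heights (chi R w v k i j l) (real_growth R M) N x in
    [/\ Sigma = cells u finset.setT a,
      forall p, conv finset.setT p -> nu_S w c p = lower_hull u finset.setT a p,
      contact finset.setT a [set k; i; j; l]%SET & free [:: u j - u i; u k - u i]]].
Proof.
move=> gM ext [_ [d0 Sd0 Cd0]] [[ca [cb [cc [cd [CE bd fr]]]]] _].
have ph := path_heights level_inc kappa1 gM ext.
have gr : growing N K (real_growth R M).
  exact: (growingS (leqnn N) kappaK (growthP R (lt_le_trans ltr01 kappa1) gM)).
set a := fun x => - c x.
have aS s : (s < N)%N -> a (path_vertex k s.+1) = a (path_vertex k s) + real_growth R M s * gap R w v k s.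
  by move=> /ph[].
have amin s : (s < N)%N -> forall x, a (path_vertex k s) - real_growth R M s * level (path_vertex k s) <=
    a x - real_growth R M s * level x by move=> /ph[].
have aseg s : (s < N)%N -> forall x,
  a x - real_growth R M s * level x = a (path_vertex k s) - real_growth R M s * level (path_vertex k s) ->
  level (path_vertex k s) <= level x <= level (path_vertex k s.+1) by move=> /ph[].
have T0 : (finset.setT : {set I}) != finset.set0.
  by apply/finset.set0Pn; exists k; rewrite finset.in_setT.
have SE : Sigma = cells u finset.setT a.
  have [_ _ -> _] := ext; rewrite DeltaE nu_SE.
  exact: (subdivisionE (fun _ _ => erefl) T0).
move: Sd0; rewrite SE => -[T [cT _] d0E].
have inC p : p \in C -> exists2 i, p = w i & conv T (u i).
  move=> /Cd0; rewrite -d0E => Tp.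
  have : Delta (toR R p) by rewrite DeltaE; apply: convS Tp; apply: finset.subsetT.
  by move=> /lattice_points[i pE]; exists i => //; rewrite -pE.
have [xa caE Ta] : exists2 i, ca = w i & conv T (u i) by apply: inC; rewrite CE !inE eqxx.
have [xb cbE Tb] : exists2 i, cb = w i & conv T (u i) by apply: inC; rewrite CE !inE eqxx ?orbT.
have [xc ccE Tc] : exists2 i, cc = w i & conv T (u i) by apply: inC; rewrite CE !inE eqxx ?orbT.
have [xd cdE Td] : exists2 i, cd = w i & conv T (u i) by apply: inC; rewrite CE !inE eqxx ?orbT.
move: bd fr CE {inC Cd0}; rewrite {}caE {}cbE {}ccE {}cdE => bd fr CE.
have rel : w xb + w xc = w xd + w xa.
  by rewrite -[w xb](subrK (w xa)) bd addrAC subrK.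
have [nba nca nbc nda] := free_pair_neq fr.
have toR0 : toR R 0 = 0 by apply: raddf0.
have ab' : xa != xb by apply: contraNneq nba => ->; rewrite subrr toR0.
have ac' : xa != xc by apply: contraNneq nca => ->; rewrite subrr toR0.
have bc' : xb != xc by apply: contraNneq nbc => ->.
have db' : xd != xb.
  apply: contraNneq ac' => db; move: rel; rewrite db => /addrI/(w_inj level_inc) ->; exact: eqxx.
have dc' : xd != xc.
  apply: contraNneq ab' => dc; move: rel; rewrite dc addrC => /addrI/(w_inj level_inc) ->; exact: eqxx.
have ad' : xa != xd.
  apply: contraNneq nda => ad; rewrite -toRD addrACA rel -ad -opprD subrr toR0 //.
have mem := path_mem N0 level_inc aS amin aseg cT.
have concl x y z : x != k -> y != k -> z != k -> x != y -> x != z -> y != z ->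
    w k + w x = w y + w z -> C = [fset w k; w x; w y; w z]%fset ->
    conv T (u k) -> conv T (u x) -> conv T (u y) -> conv T (u z) ->
  exists (i j l : I) (e : R),
  [/\ (i < j < l)%N, [/\ i != k, j != k & l != k], C = [fset w k; w i; w j; w l]%fset,
    w k + w j = w l + w i &
    let a (x : I) := e + heights (chi R w v k i j l) (real_growth R M) N x in
    [/\ Sigma = cells u finset.setT a,
      forall p, conv finset.setT p -> nu_S w c p = lower_hull u finset.setT a p,
      contact finset.setT a [set k; i; j; l]%SET & free [:: u j - u i; u k - u i]]].
  wlog yz : y z / (y < z)%N => [th xk yk zk xy xz yz' rl CE' Tk Tx Ty Tz|].
    case: (ltngtP y z) => [yz|zy|/val_inj e]; last by rewrite e eqxx in yz'.
      exact: (th y z).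
    apply: (th z y) => //; first by rewrite eq_sym.
      by rewrite rl addrC.
    rewrite CE'; apply/fsetP => q; rewrite !inE -!orbA; congr (_ || (_ || _)); exact: orbC.
  move=> xk yk zk xy xz _ rl CE' Tk Tx Ty Tz.
  have [ord hE cP fP] := parallelogram_circuit N0 level_inc K1 kP gr aS amin aseg cT
    xk yk zk xy xz yz rl Tk Tx Ty Tz.
  exists y, x, z, (a (path_vertex k 0)); split=> //.
  - rewrite CE'; apply/fsetP => q; rewrite !inE -!orbA; congr (_ || _).
    by rewrite orbCA.
  - by rewrite rl addrC.
  move=> b; split=> //.
  - by rewrite SE; apply: eq_cells.
  - move=> p _; rewrite nu_SE; congr inf; apply/seteqP; split=> h /lower_hull_set[m mA [pE hE']];
      apply/lower_hull_set; exists m => //; split=> //; rewrite hE'; apply: eq_bigr => q _;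
      by have := hE q (finset.in_setT _); rewrite /a => ->.
  - exact: eq_contact cP.
rewrite -SE.
have [ak|ak] := eqVneq xa k.
  subst xa; apply: (concl xd xb xc) => //; rewrite 1?eq_sym //.
  - by rewrite addrC -rel.
  - by rewrite CE; apply/fsetP => q; rewrite !inE; do 4?case: (_ == _).
have [dk|dk] := eqVneq xd k.
  subst xd; apply: (concl xa xb xc) => //; rewrite 1?eq_sym //.
  - by rewrite CE; apply/fsetP => q; rewrite !inE; do 4?case: (_ == _).
have [bk|bk] := eqVneq xb k.
  subst xb; apply: (concl xc xd xa) => //; rewrite 1?eq_sym //.
  - by rewrite CE; apply/fsetP => q; rewrite !inE; do 4?case: (_ == _).
have [ck|ck] := eqVneq xc k.
  subst xc; apply: (concl xb xd xa) => //; rewrite 1?eq_sym //.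
  - by rewrite addrC.
  - by rewrite CE; apply/fsetP => q; rewrite !inE; do 4?case: (_ == _).
exfalso.
have [ae le] := relation_height v cT (mem _ bk Tb) (mem _ ck Tc) (mem _ dk Td) (mem _ ak Ta) rel.
have no := no_path_parallelogram level_inc K1 gr aS amin.
have neq (x y : I) : x != y -> (x : nat) <> y by move=> xy /val_inj/eqP; apply/negP.
have := extremal_pair_cases (neq _ _ ab') (neq _ _ ac') (neq _ _ db') (neq _ _ dc') (neq _ _ bc') (neq _ _ ad').
case=> [[h1 h2]|[[h1 h2]|[[h1 h2]|[[h1 h2]|[[h1 h2]|[[h1 h2]|[[h1 h2]|[h1 h2]]]]]]]].
- exact: (no xb xc xd xa).
- by apply: (no xb xc xa xd) => //; [rewrite ae addrC|rewrite le addrC].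
- by apply: (no xc xb xd xa) => //; [rewrite addrC|rewrite addrC].
- by apply: (no xc xb xa xd) => //; [rewrite addrC ae addrC|rewrite addrC le addrC].
- by apply: (no xd xa xb xc).
- by apply: (no xd xa xc xb) => //; [rewrite -ae addrC|rewrite -le addrC].
- by apply: (no xa xd xb xc) => //; [rewrite addrC|rewrite addrC].
- by apply: (no xa xd xc xb) => //; [rewrite addrC -ae addrC|rewrite addrC -le addrC].
Qed.

(** The order makes the labelling of the circuit unique, so equal circuits give equal triples and
    hence the same step functions [chi]. *)
Lemma fset4_inj (k i j l i' j' l' : I) : i != k -> j != k -> l != k -> i' != k -> j' != k -> l' != k ->
  (i < j < l)%N -> (i' < j' < l')%N ->
  [fset w k; w i; w j; w l]%fset = [fset w k; w i'; w j'; w l']%fset -> [/\ i' = i, j' = j & l' = l].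
Proof.
move=> ik jk lk ik' jk' lk' /andP[ij jl] /andP[ij' jl'] /fsetP e.
have E x : x != k -> (x == i) || (x == j) || (x == l) = (x == i') || (x == j') || (x == l').
  by move=> xk; have := e (w x); rewrite !inE !(inj_eq (w_inj level_inc)) (negPf xk).
have in' x : x != k -> x \in [:: i; j; l] -> [\/ x = i', x = j' | x = l'].
  by move=> xk; rewrite !inE orbA E // -orbA => /or3P[] /eqP; [apply: Or31|apply: Or32|apply: Or33].
have in_ x : x != k -> x \in [:: i'; j'; l'] -> [\/ x = i, x = j | x = l].
  by move=> xk; rewrite !inE orbA -E // -orbA => /or3P[] /eqP; [apply: Or31|apply: Or32|apply: Or33].
have [i_in l_in] : i \in [:: i; j; l] /\ l \in [:: i; j; l] by rewrite !inE !eqxx !orbT.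
have [i_in' j_in' l_in'] : [/\ i' \in [:: i'; j'; l'], j' \in [:: i'; j'; l'] & l' \in [:: i'; j'; l']].
  by rewrite !inE !eqxx !orbT.
have il := ltn_trans ij jl; have il' := ltn_trans ij' jl'.
have ii' : i' = i.
  have le : (i' <= i)%N by have [->|->|->] := in' i ik i_in; rewrite ?leqnn //; apply: ltnW.
  have ge : (i <= i')%N by have [->|->|->] := in_ i' ik' i_in'; rewrite ?leqnn //; apply: ltnW.
  by apply/val_inj/eqP; rewrite eqn_leq le.
have ll' : l' = l.
  have le : (l <= l')%N by have [->|->|->] := in' l lk l_in; rewrite ?leqnn //; apply: ltnW.
  have ge : (l' <= l)%N by have [->|->|->] := in_ l' lk' l_in'; rewrite ?leqnn //; apply: ltnW.
  by apply/val_inj/eqP; rewrite eqn_leq ge.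
split=> //; have [ji|//|jl0] := in_ j' jk' j_in'.
  by move: ij'; rewrite ii' ji ltnn.
by move: jl'; rewrite ll' jl0 ltnn.
Qed.

End MainTheorem.

Theorem lemma3p9 (R : realType) (N : nat) (Delta : set 'rV[R]_3)
    (w : 'I_N.+2 -> 'rV[int]_3) (v : 'rV[rat]_3) :
  lattice_setting Delta w v ->
  exists2 kappa : rat, 0 < kappa &
  forall (k : 'I_N.+2) (C : {fset 'rV[int]_3}) (M : 'I_N -> rat)
         (c : 'I_N.+2 -> R) (Sigma : set (set 'rV[R]_3)),
    growth kappa M ->
    extends_to Delta w v (Gamma w k) M c Sigma ->
    circuit_of Sigma C -> type_D R C ->
  exists i j l : 'I_N.+2,
  [/\ (i < j < l)%N, k \notin [:: i; j; l],
      C = [fset w k; w i; w j; w l]%fset,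
      (forall (M' : 'I_N -> rat) (c' : 'I_N.+2 -> R) (Sigma' : set (set 'rV[R]_3)),
         growth kappa M' ->
         extends_to Delta w v (Gamma w k) M' c' Sigma' ->
         circuit_of Sigma' C ->
         Sigma' = Sigma) &
      exists (lstar : 'I_N.+2) (Sigma0 Sigma1 : set (set 'rV[R]_3)),
      let low := convex_hull (toR R @` [set` path_upto w k lstar]) in
      let edge := convex_hull [set toR R (w i); toR R (w j)] in
      [/\ precedes_in_path k lstar l,
          smooth_triangulation v (path_upto w k lstar) Sigma0,
          Sigma0 `<=` Sigma,
          fconv C `&` low = edge /\ face (fconv C) edge &
          extension low (nu_S w c) Sigma0 (fconv C) Sigma1 /\
          smooth_extensions v Sigma1 (path_after w k l) Sigma]].
Proof.
move=> [N0 latD memD _ [_ _ prec]].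
pose u i := toR R (w i).
have level_inc (i j : 'I_N.+2) : (i < j)%N -> level R w v i < level R w v j by apply: prec.
have DeltaE : Delta = convex_hull (u @` [set` (finset.setT : {set 'I_N.+2})]).
  have [V V0 DV] := latD.
  pose A : {set 'I_N.+2} := [set i | w i \in V]%SET.
  have DA : Delta = convex_hull (u @` [set` A]).
    rewrite DV; congr convex_hull; apply/seteqP; split=> [_ [p pV <-]|_ [i iA <-]].
      have : Delta (toR R p).
        rewrite DV; exists 1%N, (fun=> toR R p), (fun=> 1); split=> [_|_||].
        - by exists p.
        - exact: ler01.
        - by rewrite big_ord_recl big_ord0 addr0.
        - by rewrite big_ord_recl big_ord0 addr0 scale1r.
      by move=> /memD[i pE]; exists i; rewrite /u -?pE //= finset.inE -pE.
    by exists (w i) => //; move: iA; rewrite /= finset.inE.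
  apply/seteqP; split; first by rewrite DA; apply: convS; apply: finset.subsetT.
  rewrite DA; apply: convex_hull_sub => _ [i _ <-]; rewrite -DA.
  by apply/memD; exists i.
(* The step functions depend only on the points, [v] and the quadruple [(k, i, j, l)]. There are
   finitely many quadruples, so one constant can be chosen before any surface is given. *)
pose I4 := ('I_N.+2 * 'I_N.+2 * ('I_N.+2 * 'I_N.+2))%type.
have [K0 K00 K0P] : exists2 K : R, 0 <= K & forall t : I4, forall n M M' A T, (n <= N)%N ->
    growing n K M -> growing n K M' ->
    contact u A (heights (chi R w v t.1.1 t.1.2 t.2.1 t.2.2) M n) T ->
    contact u A (heights (chi R w v t.1.1 t.1.2 t.2.1 t.2.2) M' n) T.
  apply: uniform_bound => [t k k' kk' h n M M' A T nN gM gM'|t].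
    exact: (h n M M' A T nN (growingS (leqnn n) kk' gM) (growingS (leqnn n) kk' gM')).
  have [K K1 KP] := growing_contact u (chi R w v t.1.1 t.1.2 t.2.1 t.2.2) N.
  by exists K => //; apply: le_trans K1.
pose K := 1 + K0.
have K1 : 1 <= K by rewrite lerDl.
have KK0 : K0 <= K by rewrite lerDr.
have kP k i j l n M M' A T : (n <= N)%N -> growing n K M -> growing n K M' ->
    contact u A (heights (chi R w v k i j l) M n) T ->
    contact u A (heights (chi R w v k i j l) M' n) T.
  move=> nN gM gM'; apply: (K0P (k, i, (j, l)) n M M' A T nN);
  by apply: (growingS (leqnn n) KK0).
(* [growth] takes a rational constant, so the real number [K] is rounded up to a natural one. *)
pose kappa : rat := (Num.bound K)%:R.
have Kb : K < (Num.bound K)%:R by apply: archi_boundP; apply: le_trans K1.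
have kappaK : K <= ratr kappa by rewrite ratr_nat ltW.
have kappa1 : 1 <= kappa.
  by rewrite -(ler_rat R) rmorph1 (le_trans K1).
have kappa0 : 0 < kappa by apply: lt_le_trans kappa1.
exists kappa => // k C M c Sigma gM ext cC tD.
have main := circuit_parallelogram N0 level_inc DeltaE memD K1 kP kappa1 kappaK.
have [i [j [l [e [ijl [ik jk lk] CE rel [SE nuE cP fP]]]]]] := main _ _ _ _ _ gM ext cC tD.
have real (M0 : 'I_N -> rat) : growth kappa M0 -> growing N K (real_growth R M0).
  by move=> g0; exact: (growingS (leqnn N) kappaK (growthP R kappa0 g0)).
have [ij jl] := andP ijl.
exists i, j, l; split=> //.
- by rewrite !inE !negb_or eq_sym ik eq_sym jk eq_sym lk.
- move=> M' c' Sigma' gM' ext' cC'.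
  have [i' [j' [l' [e' [ijl' [ik' jk' lk'] CE' _ [SE' _ _ _]]]]]] := main _ _ _ _ _ gM' ext' cC' tD.
  have [ii jj ll] := fset4_inj level_inc ik jk lk ik' jk' lk' ijl ijl' (etrans (esym CE) CE').
  subst i' j' l'; rewrite SE SE'.
  (* With the triple fixed by the circuit, the two subdivisions come from the same step functions
     and differ only in the coefficients and the additive constant, on which the contact sets do not
     depend. *)
  have ch M1 M2 e1 e2 T : growing N K M1 -> growing N K M2 ->
      contact u finset.setT (fun x => e1 + heights (chi R w v k i j l) M1 N x) T ->
      contact u finset.setT (fun x => e2 + heights (chi R w v k i j l) M2 N x) T.
    move=> g1 g2 /(contact_cst (- e1)) cT; apply: contact_cst.
    by apply: (kP _ _ _ _ _ _ _ _ _ (leqnn N) g1 g2); apply: eq_contact cT => x _; rewrite addKr.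
  by apply/seteqP; split=> _ [T [cT T0] <-]; exists T => //; split=> //;
    apply: ch cT; apply: real.
have [lstar [pre lowE tri sub [ex sm]]] :=
  path_extension level_inc ik jk lk ij jl rel K1 (kP k i j l) (real _ gM) cP fP nuE.
have [_ [cap [fc _]]] :=
  parallelogram_step level_inc ik jk lk ij jl rel K1 (kP k i j l) (real _ gM) cP fP.
have CP : fconv C = convex_hull (u @` [set` [set k; i; j; l]%SET]).
  rewrite CE /fconv; congr convex_hull; apply/seteqP; split=> [_ [p + <-]|_ [x + <-]].
    by rewrite /= !inE -!orbA => /or4P[] /eqP ->; [exists k|exists i|exists j|exists l];
      rewrite //= !finset.inE eqxx ?orbT.
  by rewrite /= !finset.inE -!orbA => /or4P[] /eqP ->; [exists (w k)|exists (w i)|exists (w j)|exists (w l)];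
      rewrite //= !inE eqxx ?orbT.
exists lstar, (cells u (stage k l l) (fun x => e + heights (chi R w v k i j l) (real_growth R M) N x)),
  (cells u [set x : 'I_N.+2 | (x <= l)%N]%SET
     (fun x => e + heights (chi R w v k i j l) (real_growth R M) N x)).
move=> low edge.
have edgeE : edge = convex_hull (u @` [set` [set i; j]%SET]) by apply: conv_pair.
rewrite /low lowE CP edgeE SE; split=> //.
by rewrite setIC cap.
Qed.
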